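(* Let $\pi:A\to C$ be a $*$-homomorphism between C$^*$-algebras (making $C$ an $A$-bimodule). Assume that $C$ is injective and that $A\subseteq\mathrm{B}(\mathcal{H})$ for some Hilbert space $\mathcal{H}$ such that there exists a bounded left $A$-module map $\phi:\mathrm{K}(\mathcal{H})\to C$ the kernel of which does not contain any nontrivial right ideals. If $\pi(A)$ is equal to its relative double commutant $\pi(A)^{cc}$ in $C$, then $A$ is a von Neumann algebra (on $\mathcal{H}$).
   Context: $\mathrm{K}(\mathcal{H})$ is the C$^*$-algebra of compact operators on $\mathcal{H}$, a left $A$-module via left multiplication by $A\subseteq\mathrm{B}(\mathcal{H})$; $C$ is a left $A$-module via $a\cdot c=\pi(a)c$, so that $\phi$ satisfies $\phi(ax)=\pi(a)\phi(x)$ for $a\in A$, $x\in\mathrm{K}(\mathcal{H})$. ''Right ideals'' means right ideals of $\mathrm{K}(\mathcal{H})$, and nontrivial means nonzero. For a subset $S\subseteq C$, $S^c=\{c\in C: cs=sc\ \forall s\in S\}$ is its relative commutant in $C$ and $S^{cc}=(S^c)^c$. A C$^*$-algebra $C$ is injective if it is injective as an operator space: for every inclusion of operator spaces $X\subseteq Y$ each completely bounded map $X\to C$ extends to a completely bounded map $Y\to C$ with the same cb-norm. *)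

(* Defs.v *)
From HB Require Import structures.
From mathcomp Require Import all_boot all_order all_algebra.
From mathcomp Require Import sesquilinear complex.
From mathcomp Require Import boolp classical_sets functions reals topology.
From mathcomp Require Import normedtype.

Set Implicit Arguments.
Unset Strict Implicit.
Unset Printing Implicit Defensive.

Import Order.TTheory GRing.Theory Num.Theory.
Import numFieldNormedType.Exports.

Local Open Scope classical_set_scope.
Local Open Scope complex_scope.
Local Open Scope ring_scope.

(* In a normed space over R[i] the library norm [`|x|] is itself an element of *)
(* R[i] (real and nonnegative); [rnorm x] is the same number, seen in R.       *)
Definition rnorm (R : realType) (V : normedZmodType R[i]) (x : V) : R :=
  complex.Re `|x|.

Definition lin_subspace (K : pzRingType) (V : lmodType K) (S : set V) : Prop :=
  S 0 /\ forall (k : K) (x y : V), S x -> S y -> S (k *: x + y).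

(* Maps defined on a subspace S only are encoded as functions on the whole     *)
(* ambient type, whose values off S are never looked at.                       *)
Definition linear_on (K : pzRingType) (V W : lmodType K) (S : set V)
    (f : V -> W) : Prop :=
  forall (k : K) (x y : V), S x -> S y -> f (k *: x + y) = k *: f x + f y.

(* Complex Hilbert spaces. [inner] is linear in its first argument.            *)
HB.mixin Record isHilbert (R : realType) H of CompleteNormedModule R[i] H := {
  inner : {dot H for (@Num.conj R[i])};
  inner_norm : forall x : H, `|x| ^+ 2 = inner x x
}.

#[short(type="hilbertType")]
HB.structure Definition Hilbert (R : realType) :=
  {H of CompleteNormedModule R[i] H & isHilbert R H}.

(* C*-algebras, not assumed to have a unit (hence not library rings).          *)
HB.mixin Record isCstarAlgebra (R : realType) C
    of CompleteNormedModule R[i] C := {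
  cmul : C -> C -> C;
  cstar : C -> C;
  cmulA : associative cmul;
  cmulDl : left_distributive cmul +%R;
  cmulDr : right_distributive cmul +%R;
  cmulZl : forall (k : R[i]) (x y : C), cmul (k *: x) y = k *: cmul x y;
  cmulZr : forall (k : R[i]) (x y : C), cmul x (k *: y) = k *: cmul x y;
  cstarK : involutive cstar;
  cstarD : {morph cstar : x y / x + y};
  cstarZ : forall (k : R[i]) (x : C), cstar (k *: x) = k^* *: cstar x;
  cstarM : forall x y : C, cstar (cmul x y) = cmul (cstar y) (cstar x);
  cnormM : forall x y : C, `|cmul x y| <= `|x| * `|y|;
  cnorm_star : forall x : C, `|cmul (cstar x) x| = `|x| ^+ 2
}.

#[short(type="cstarType")]
HB.structure Definition CstarAlgebra (R : realType) :=
  {C of CompleteNormedModule R[i] C & isCstarAlgebra R C}.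

Definition commutant (R : realType) (C : cstarType R) (S : set C) : set C :=
  [set c | forall s, S s -> cmul c s = cmul s c].

Section Operators.
Context {R : realType} {H : hilbertType R}.
Implicit Types (S T : H -> H) (A : set (H -> H)).

Definition bounded_op : set (H -> H) :=
  [set T | linear T /\ exists M : R, forall x, rnorm (T x) <= M * rnorm x].

Definition opnorm T : R := sup [set rnorm (T x) | x in [set x | rnorm x <= 1]].

Definition compact_op : set (H -> H) :=
  [set T | linear T /\ precompact (T @` [set x | rnorm x <= 1])].

Definition is_adjoint T S : Prop :=
  forall x y, inner (T x) y = inner x (S y).

Definition star_subalgebra A : Prop :=
  [/\ A `<=` bounded_op,
      lin_subspace A,
      forall S T, A S -> A T -> A (S \o T)
    & forall T, A T -> exists2 S, A S & is_adjoint T S].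

Definition norm_closed A : Prop :=
  forall T, bounded_op T ->
    (forall e : R, 0 < e -> exists2 S, A S & opnorm (T - S) < e) -> A T.

(* The C*-subalgebras of B(H) are its norm-closed *-subalgebras; they need not *)
(* contain the identity operator.                                              *)
Definition cstar_subalgebra A : Prop := star_subalgebra A /\ norm_closed A.

(* The weak operator topology: the coarsest one making all the functions       *)
(* T |-> <T x, y> continuous.                                                  *)
Definition wot : Type := @initial_topology (H -> H)
  {ptws (H * H)%type -> R[i]^o} (fun T p => inner (T p.1) p.2).

Definition von_neumann A : Prop :=
  [/\ star_subalgebra A,
      A idfun
    & closure (A : set wot) `&` bounded_op `<=` A].

Definition star_morphism (C : cstarType R) A (pi : (H -> H) -> C) : Prop :=
  [/\ linear_on A pi,
      forall S T, A S -> A T -> pi (S \o T) = cmul (pi S) (pi T)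
    & forall S T, A S -> A T -> is_adjoint S T -> pi T = cstar (pi S)].

Definition compact_right_ideal (J : set (H -> H)) : Prop :=
  [/\ J `<=` compact_op,
      lin_subspace J
    & forall S T, J S -> compact_op T -> J (S \o T)].

Definition bounded_on (C : cstarType R) (X : set (H -> H))
    (f : (H -> H) -> C) : Prop :=
  exists M : R, forall T, X T -> rnorm (f T) <= M * opnorm T.

End Operators.

Arguments wot {R} H.

Section MatrixNorms.
Context {R : realType}.

Definition l2norm n (v : 'cV[R[i]]_n) : R :=
  Num.sqrt (\sum_i rnorm (v i 0) ^+ 2).

Definition scalar_mxnorm m n (a : 'M[R[i]]_(m, n)) : R :=
  sup [set l2norm (a *m v) | v in [set v | l2norm v <= 1]].

Definition is_mxnorm (V : lmodType R[i]) n (nu : 'M[V]_n -> R) : Prop :=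
  [/\ forall x y, nu (x + y) <= nu x + nu y,
      forall (k : R[i]) x, nu (map_mx ( *:%R k) x) = rnorm k * nu x
    & forall x, nu x = 0 -> x = 0].

Definition scalar_mxmul (V : lmodType R[i]) m n
    (a : 'M[R[i]]_(m, n)) (x : 'M[V]_n) (b : 'M[R[i]]_(n, m)) : 'M[V]_m :=
  \matrix_(i, j) \sum_k \sum_l (a i k * b l j) *: x k l.

End MatrixNorms.

(* Abstract operator spaces: a norm on each M_n(V), subject to Ruan's axioms.  *)
HB.mixin Record isOpSpace (R : realType) V of GRing.Lmodule R[i] V := {
  mxnorm : forall n, 'M[V]_n -> R;
  mxnormP : forall n, is_mxnorm (mxnorm n);
  mxnorm_block : forall m n (x : 'M[V]_m) (y : 'M[V]_n),
    mxnorm (m + n)%N (block_mx x 0 0 y) = Num.max (mxnorm m x) (mxnorm n y);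
  mxnorm_scalar : forall m n (a : 'M[R[i]]_(m, n)) (x : 'M[V]_n)
      (b : 'M[R[i]]_(n, m)),
    mxnorm m (scalar_mxmul a x b)
      <= scalar_mxnorm a * mxnorm n x * scalar_mxnorm b
}.

#[short(type="opSpaceType")]
HB.structure Definition OpSpace (R : realType) :=
  {V of GRing.Lmodule R[i] V & isOpSpace R V}.

Arguments mxnorm {R s n}.

Section Injectivity.
Context {R : realType}.

Section CompletelyBounded.
Variables (C : cstarType R) (nu : forall n, 'M[C]_n -> R) (Y : opSpaceType R).

Definition cmxmul n (x y : 'M[C]_n) : 'M[C]_n :=
  \matrix_(i, j) \sum_k cmul (x i k) (y k j).

Definition cmxstar n (x : 'M[C]_n) : 'M[C]_n := \matrix_(i, j) cstar (x j i).

Definition is_cstar_mxnorm : Prop :=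
  (forall n, [/\ is_mxnorm (@nu n),
      forall x y, nu (cmxmul x y) <= @nu n x * @nu n y
    & forall x, nu (cmxmul (cmxstar x) x) = @nu n x ^+ 2])
  /\ forall c : C, nu (const_mx c : 'M[C]_1) = rnorm c.

Definition cb_values (X : set Y) (u : Y -> C) : set R :=
  [set r | exists n (x : 'M[Y]_n),
     [/\ forall i j, X (x i j), mxnorm x <= 1 & r = nu (map_mx u x)]].

Definition completely_bounded (X : set Y) (u : Y -> C) : Prop :=
  linear_on X u /\ has_ubound (cb_values X u).

Definition cbnorm (X : set Y) (u : Y -> C) : R := sup (cb_values X u).

End CompletelyBounded.

(* The algebra M_n(C) carries exactly one C*-norm, so the existential below    *)
(* is a definite description of the operator space structure of C.             *)
Definition injective_cstar (C : cstarType R) : Prop :=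
  exists2 nu : forall n, 'M[C]_n -> R, is_cstar_mxnorm nu &
    forall (Y : opSpaceType R) (X : set Y) (u : Y -> C),
      lin_subspace X -> completely_bounded nu X u ->
      exists v : Y -> C,
        [/\ forall x, X x -> v x = u x,
            completely_bounded nu setT v
          & cbnorm nu setT v = cbnorm nu X u].

End Injectivity.

(* Main.v *)
From HB Require Import structures.
Require Import Defs.
From mathcomp Require Import all_boot all_order all_algebra.
From mathcomp Require Import sesquilinear complex.
From mathcomp Require Import boolp classical_sets functions reals topology.
From mathcomp Require Import normedtype sequences.
From mathcomp Require Import ring lra.

Set Implicit Arguments.
Unset Strict Implicit.
Unset Printing Implicit Defensive.

Import Order.TTheory GRing.Theory Num.Theory.
Import numFieldNormedType.Exports.

Local Open Scope classical_set_scope.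
Local Open Scope complex_scope.
Local Open Scope ring_scope.

(** Let [b] be a selfadjoint operator in the weak closure of [A].  If some
    bounded family [g] in [A] converges strongly to [b], then [g x] converges
    in norm to [b x] for every compact [x], so [pi g * phi x = phi (g x)]
    converges in norm to [phi (b x)].  Suppose that the bounded family [pi g]
    has a limit [c] in [C] which respects these products and commutes with
    everything that commutes with [pi A].  Then [c * phi x = phi (b x)], and
    [c] lies in the double commutant of [pi A], that is, [c = pi a] with [a]
    in [A].  Now [phi] vanishes on the right ideal of the operators
    [(a - b) x] with [x] compact, so [a = b] ([bicommutant_mem]).  The same
    argument applied to a unit of [C] puts the identity operator in [A]
    ([unit_mem]).

    Both the limit [c] and the unit come from injectivity
    ([injective_generalized_limit], [injective_unital]).  The bounded families
    of multipliers of [C] form a unital *-algebra [mult C I], which is an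
    operator space containing [C].  On the subspace of the families that
    converge in norm to an element of [C], the limit is a complete contraction,
    and it extends to a completely contractive [v : mult C I -> C] that fixes
    [C].  Tomiyama's argument, run with projections of 2 x 2 matrices whose
    corners are squares, shows that [v] is a map of [C]-bimodules
    ([tomiyama], [retr_left], [retr_right]); then [v 1] is a unit, and [v] of
    a bounded family is the wanted limit.

    That [mult C I] satisfies Ruan's axioms has to be derived from C*-norms
    that are given separately on each [M_n(C)].  They are tied together by the
    uniqueness of the C*-norm on [C] ([cstar_norm_unique]): this gives crude
    entrywise estimates, and the spectral radius formula makes them sharp
    ([mu_spectral]).  All the functional calculus in [C] comes down to the
    square root of [1 - x], as a norm limit of polynomials ([cstar_sqrt]).

    On the side of the Hilbert space, bounded families come from the proof of
    Kaplansky's density theorem, in the form of the bounded transform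
    [g = a (1 + a^2)^-1].  It turns strong approximation by unbounded families
    of selfadjoint [a] ([strong_approx]) into approximation by contractions
    ([bounded_transform_dist]); [2 pi g] is a contraction because it is
    the real part of a unitary ([morphism_transform_contract]). *)


Local Notation "x ** y" := (cmul x y) (at level 40, left associativity).
Local Notation "k *:: x" := (map_mx ( *:%R k) x) (at level 40).

(** * Identities in abelian groups *)

Section AbelianIdentities.
Variable V : zmodType.

Inductive zexp : Type :=
  | ZVar of nat | Zero | ZAdd of zexp & zexp | ZOpp of zexp.

Fixpoint zeval (env : seq V) (e : zexp) : V :=
  match e with
  | ZVar n => nth 0 env n
  | Zero => 0
  | ZAdd a b => zeval env a + zeval env b
  | ZOpp a => - zeval env a
  end.

Fixpoint zcoef (i : nat) (e : zexp) : int :=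
  match e with
  | ZVar n => (n == i)%:Z
  | Zero => 0
  | ZAdd a b => zcoef i a + zcoef i b
  | ZOpp a => - zcoef i a
  end.

Lemma zevalE (env : seq V) e :
  zeval env e = \sum_(i < size env) nth 0 env i *~ zcoef i e.
Proof.
elim: e => [n||a IHa b IHb|a IHa] /=.
- have [ne|ne] := ltnP n (size env).
    rewrite (bigD1 (Ordinal ne)) //= eqxx mulr1z big1 ?addr0 // => i hi.
    rewrite (_ : (n == i) = false) ?mulr0z //.
    by apply: contraNF hi => /eqP ni; apply/eqP/val_inj.
  rewrite nth_default // big1 // => i _.
  by rewrite (_ : (n == i) = false) ?mulr0z // gtn_eqF // (leq_trans _ ne).
- by rewrite big1 // => i _; rewrite mulr0z.
- by rewrite IHa IHb -big_split; apply: eq_bigr => i _; rewrite mulrzDr.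
- by rewrite IHa -sumrN; apply: eq_bigr => i _; rewrite mulrNz.
Qed.

(** Two formal sums with the same integral coefficients have the same value;
    this decides the identities that hold in every abelian group. *)
Lemma zeval_eq (env : seq V) e f :
  all (fun i => zcoef i e == zcoef i f) (iota 0 (size env)) ->
  zeval env e = zeval env f.
Proof.
move/allP => h; rewrite !zevalE; apply: eq_bigr => i _; congr (_ *~ _).
by apply/eqP/h; rewrite mem_iota add0n ltn_ord.
Qed.

End AbelianIdentities.

(* Atoms are compared up to conversion: one product may be typed through several
   structures. *)
Ltac zmem x env :=
  match env with
  | nil => constr:(false)
  | ?y :: _ => let _ := match goal with _ => unify x y end in constr:(true)
  | _ :: ?l => zmem x l
  end.
Ltac zindex x env :=
  match env with
  | ?y :: _ => let _ := match goal with _ => unify x y end in constr:(0%N)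
  | _ :: ?l => let n := zindex x l in constr:(S n)
  end.
Ltac zatoms env e :=
  lazymatch e with
  | @GRing.zero _ => env
  | @GRing.add _ ?a ?b => let env' := zatoms env a in zatoms env' b
  | @GRing.opp _ ?a => zatoms env a
  | _ => match zmem e env with
         | true => env
         | false => constr:(e :: env)
         end
  end.
Ltac zreify env e :=
  lazymatch e with
  | @GRing.zero _ => constr:(Zero)
  | @GRing.add _ ?a ?b =>
      let a' := zreify env a in let b' := zreify env b in
      constr:(ZAdd a' b')
  | @GRing.opp _ ?a => let a' := zreify env a in constr:(ZOpp a')
  | _ => let n := zindex e env in constr:(ZVar n)
  end.
Ltac abel :=
  lazymatch goal with
  | |- @eq ?T ?a ?b =>
      let env := zatoms (@nil T) a in
      let env := zatoms env b in
      let ea := zreify env a in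
      let eb := zreify env b in
      exact: (@zeval_eq _ env ea eb isT)
  end.

(** * Real-valued norms *)

Section RealNorm.
Context {R : realType}.

Section Semi.
Variable V : normedZmodType R[i].
Implicit Types x y : V.

Lemma normE x : `|x| = (rnorm x)%:C.
Proof.
rewrite /rnorm; have := normr_ge0 x; rewrite lecE => /andP[/eqP + _].
by case: (`|x|) => a b /= ->.
Qed.

Lemma rnorm_ge0 x : 0 <= rnorm x.
Proof. by rewrite -(@lecR R) -normE normr_ge0. Qed.

Lemma rnorm_eq0 x : rnorm x = 0 -> x = 0.
Proof. by move=> h; apply/normr0_eq0; rewrite normE h. Qed.

Lemma rnorm0 : rnorm (0 : V) = 0.
Proof. by rewrite /rnorm normr0. Qed.

Lemma rnormN x : rnorm (- x) = rnorm x.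
Proof. by rewrite /rnorm normrN. Qed.

Lemma ler_rnormD x y : rnorm (x + y) <= rnorm x + rnorm y.
Proof. by rewrite -(@lecR R) rmorphD /= -!normE ler_normD. Qed.

Lemma ler_rnormB x y : rnorm (x - y) <= rnorm x + rnorm y.
Proof. by rewrite -(rnormN y); exact: ler_rnormD. Qed.

Lemma rnormBC x y : rnorm (x - y) = rnorm (y - x).
Proof. by rewrite -rnormN opprB. Qed.

Lemma ler_rnorm_sum (I : Type) (r : seq I) (P : pred I) (F : I -> V) :
  rnorm (\sum_(i <- r | P i) F i) <= \sum_(i <- r | P i) rnorm (F i).
Proof.
elim/big_rec2: _ => [|i a b _ h]; first by rewrite rnorm0.
exact: le_trans (ler_rnormD _ _) (lerD _ _).
Qed.

Lemma rnorm_small x (K : R) :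
  (forall e, 0 < e -> rnorm x <= K * e) -> x = 0.
Proof.
move=> h; apply: rnorm_eq0; apply/eqP; rewrite eq_le rnorm_ge0 andbT.
apply/ler_addgt0Pl => e e0; rewrite addr0.
have K0 : 0 < `|K| + 1 by rewrite ltr_wpDl.
apply: le_trans (h (e / (`|K| + 1)) _) _; first by rewrite divr_gt0.
rewrite mulrA ler_pdivrMr // mulrC ler_pM2l //.
by apply: le_trans (ler_norm _) _; rewrite lerDl.
Qed.

End Semi.

Lemma rnormZ (V : normedModType R[i]) (k : R[i]) (x : V) :
  rnorm (k *: x) = rnorm k * rnorm x.
Proof.
apply: (@complexI R); rewrite -normE normrZ.
by rewrite rmorphM /= -!normE.
Qed.

Lemma rnormM (a b : R[i]) : rnorm (a * b) = rnorm a * rnorm b.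
Proof. by apply: (@complexI R); rewrite rmorphM /= -!normE normrM. Qed.

Lemma rnorm_real (r : R) : rnorm (r%:C) = `|r|.
Proof. by rewrite /rnorm normc_def /= expr0n addr0 sqrtr_sqr. Qed.

Lemma rnorm_nat n : rnorm (n%:R : R[i]) = n%:R.
Proof. by rewrite /rnorm normr_nat -(rmorph_nat (real_complex R)). Qed.

Lemma rnormC_conj (k : R[i]) : rnorm (Num.conj k) = rnorm k.
Proof. by rewrite /rnorm norm_conjC. Qed.

Lemma rnormC_sqr (k : R[i]) : ((rnorm k) ^+ 2)%:C = k * Num.conj k.
Proof. by rewrite rmorphXn /= -normE normCK. Qed.

Lemma rnorm1 : rnorm (1 : R[i]) = 1.
Proof. by rewrite /rnorm normr1. Qed.

Lemma Re_le_rnorm (k : R[i]) : complex.Re k <= rnorm k.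
Proof.
rewrite -(@lecR R) -normE.
apply: le_trans (normc_ge_Re k); rewrite lecR; exact: ler_norm.
Qed.

Lemma complete_rnorm (V : completeNormedModType R[i]) (u : nat -> V) :
  (forall e : R, 0 < e -> exists N, forall m n, (N <= m)%N -> (m <= n)%N ->
     rnorm (u n - u m) < e) ->
  exists l, forall e : R, 0 < e -> exists N, forall n, (N <= n)%N ->
    rnorm (u n - l) < e.
Proof.
move=> hu.
have cu : cauchy (u @ \oo).
  apply: cauchy_exP => e e0.
  have [eR ee] : exists r : R, e = r%:C.
    move: e0; rewrite ltcE => /andP[/eqP h _].
    by exists (complex.Re e); case: e h => a b /= ->.
  move: e0; rewrite ee (@ltcR R) => e0.
  have [N hN] := hu _ e0.
  exists (u N); exists N => // n /= Nn.
  by rewrite -ball_normE /= normE ltcR rnormBC; apply: hN.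
have /cvg_ex[l ul] : cvg (u @ \oo) by apply: cauchy_cvg.
exists l => e e0.
have e0C : 0 < e%:C by rewrite ltcR.
have [N _ hN] := (cvgrPdist_lt (F := \oo) u l).1 ul _ e0C.
exists N => n Nn.
by have := hN n Nn; rewrite /= normE ltcR rnormBC.
Qed.

(** Constants disappear under [2^k]-th roots.  The exponent [2^k - 1] leaves
    room for one factor that is estimated separately. *)
Lemma root_le (a q K : R) : 0 <= a -> 0 <= q ->
  (forall k, a ^+ (2 ^ k) <= K * q ^+ (2 ^ k).-1) -> a <= q.
Proof.
move=> a0 q0 h; case: (leP a q) => // qa.
have ap : 0 < a by apply: le_lt_trans qa.
pose d := 1 - q / a.
have d1 : 0 < d by rewrite subr_gt0 ltr_pdivrMr // mul1r.
have key k : a * (1 + (2 ^ k).-1%:R * d) <= K.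
  have Kp : a * a ^+ (2 ^ k).-1 <= K * q ^+ (2 ^ k).-1.
    by rewrite -exprS prednK ?expn_gt0.
  set N := (2 ^ k).-1 in Kp *.
  have B : (q / a) ^+ N * (1 + N%:R * d) <= 1.
    elim: (N) => [|n IH]; first by rewrite expr0 mul0r addr0 mul1r.
    have qa0 : 0 <= q / a by rewrite divr_ge0.
    have : (q / a) ^+ n * ((q / a) * (1 + n.+1%:R * d)) <=
           (q / a) ^+ n * (1 + n%:R * d).
      apply: ler_wpM2l; first exact: exprn_ge0.
      have -> : q / a = 1 - d by rewrite /d; lra.
      have n0 : (0 : R) <= n%:R by [].
      rewrite -natr1; nra.
    move/le_trans/(_ IH); apply: le_trans.
    by rewrite [X in X <= _](_ : _ = (q / a) ^+ n * ((q / a) * (1 + n.+1%:R * d))) // exprSr !mulrA.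
  have aN : 0 < a ^+ N by rewrite exprn_gt0.
  have s0 : 0 <= 1 + N%:R * d by rewrite addr_ge0 // mulr_ge0 // ltW.
  have K0 : 0 <= K.
    case: (eqVneq q 0) => [q0'|qn].
      have := h 0%N; rewrite expr1 expn0 /= expr0 mulr1; lra.
    have qN : 0 < q ^+ N by rewrite exprn_gt0 // lt0r qn.
    rewrite -(pmulr_lge0 _ qN); apply: le_trans Kp.
    by rewrite mulr_ge0 // ltW.
  have : a * a ^+ N * (1 + N%:R * d) <= K * q ^+ N * (1 + N%:R * d).
    exact: ler_wpM2r.
  rewrite -(ler_pM2r (_ : 0 < (a ^+ N)^-1)) ?invr_gt0 //.
  have -> : a * a ^+ N * (1 + N%:R * d) / a ^+ N = a * (1 + N%:R * d).
    by field; rewrite gt_eqF.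
  have -> : K * q ^+ N * (1 + N%:R * d) / a ^+ N =
     K * ((q / a) ^+ N * (1 + N%:R * d)).
    by rewrite expr_div_n; field; rewrite gt_eqF.
  by move=> /le_trans; apply; rewrite -[leRHS]mulr1 ler_wpM2l.
have ad : 0 < a * d by rewrite mulr_gt0.
have := archi_boundP (_ : 0 <= `|K| / (a * d)).
rewrite divr_ge0 ?(ltW ad) // => /(_ isT).
move: (Num.bound _) => n hn.
have hn2 : (n%:R : R) <= (2 ^ n).-1%:R.
  by rewrite ler_nat -ltnS prednK ?expn_gt0 //; apply: ltn_expl.
have {key} key := key n.
have {}hn : `|K| < n%:R * (a * d) by rewrite -ltr_pdivrMr.
have K1 := ler_norm K.
move: (2 ^ n).-1 hn2 key => N hn2 key.
have h3 : n%:R * (a * d) <= N%:R * (a * d) by rewrite ler_pM2r.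
have h4 : a * (1 + N%:R * d) = a + N%:R * (a * d) by ring.
lra.
Qed.

End RealNorm.

(** * C*-algebras without unit *)

Section CstarBasics.
Context {R : realType} {C : cstarType R}.
Implicit Types (x y z c d : C) (k : R[i]).

Lemma cmul0l y : 0 ** y = 0.
Proof. by rewrite -(scale0r (0 : C)) cmulZl !scale0r. Qed.

Lemma cmul0r y : y ** 0 = 0.
Proof. by rewrite -(scale0r (0 : C)) cmulZr !scale0r. Qed.

Lemma cmulNl x y : (- x) ** y = - (x ** y).
Proof. by rewrite -scaleN1r cmulZl scaleN1r. Qed.

Lemma cmulNr x y : x ** (- y) = - (x ** y).
Proof. by rewrite -scaleN1r cmulZr scaleN1r. Qed.

Lemma cmulBl x y z : (x - y) ** z = x ** z - y ** z.
Proof. by rewrite cmulDl cmulNl. Qed.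

Lemma cmulBr x y z : z ** (x - y) = z ** x - z ** y.
Proof. by rewrite cmulDr cmulNr. Qed.

Lemma cmul_suml (I : Type) (r : seq I) (P : pred I) (F : I -> C) y :
  (\sum_(i <- r | P i) F i) ** y = \sum_(i <- r | P i) F i ** y.
Proof. by apply: (big_morph (cmul^~ y)) => [a b|]; rewrite ?cmulDl ?cmul0l. Qed.

Lemma cmul_sumr (I : Type) (r : seq I) (P : pred I) (F : I -> C) y :
  y ** (\sum_(i <- r | P i) F i) = \sum_(i <- r | P i) y ** F i.
Proof. by apply: (big_morph (cmul y)) => [a b|]; rewrite ?cmulDr ?cmul0r. Qed.

Lemma cstar0 : cstar (0 : C) = 0.
Proof. by rewrite -(scale0r (0 : C)) cstarZ rmorph0 !scale0r. Qed.

Lemma cstarN x : cstar (- x) = - cstar x.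
Proof. by rewrite -scaleN1r cstarZ rmorphN1 scaleN1r. Qed.

Lemma cstarB x y : cstar (x - y) = cstar x - cstar y.
Proof. by rewrite cstarD cstarN. Qed.

Lemma cstar_sum (I : Type) (r : seq I) (P : pred I) (F : I -> C) :
  cstar (\sum_(i <- r | P i) F i) = \sum_(i <- r | P i) cstar (F i).
Proof. by apply: (big_morph cstar) => [a b|]; rewrite ?cstarD ?cstar0. Qed.

Lemma cstarZr (r : R) x : cstar (r%:C *: x) = r%:C *: cstar x.
Proof. by rewrite cstarZ (CrealP _) // complex_real. Qed.

Lemma rnormcM x y : rnorm (x ** y) <= rnorm x * rnorm y.
Proof. by rewrite -(@lecR R) rmorphM /= -!normE cnormM. Qed.

Lemma rnorm_star_sqr x : rnorm (cstar x ** x) = rnorm x ^+ 2.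
Proof. by apply: (@complexI R); rewrite rmorphXn /= -!normE cnorm_star. Qed.

(** Nondegeneracy of the product: elements of [C] are determined by their
    action on [C]. *)
Lemma cmul_nondeg x : (forall z, cstar x ** z = 0) -> x = 0.
Proof.
move=> h; apply: rnorm_eq0; apply/eqP.
by rewrite -sqrf_eq0 -rnorm_star_sqr h rnorm0.
Qed.

End CstarBasics.

Section CstarNorm.
Context {R : realType} {C : cstarType R}.
Implicit Types (x y z c d : C) (k : R[i]).

(** Completeness is left out, because the norms induced on [C] by the corners of
    [M_n(C)] are not known to be complete beforehand. *)
Definition is_cstar_norm (N : C -> R) : Prop :=
  [/\ forall x y, N (x + y) <= N x + N y,
      forall k x, N (k *: x) = rnorm k * N x,
      forall x, N x = 0 -> x = 0,
      forall x y, N (x ** y) <= N x * N y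
    & forall x, N (cstar x ** x) = N x ^+ 2].

Lemma rnorm_is_cstar_norm : is_cstar_norm (fun x => rnorm x).
Proof.
split; [exact: ler_rnormD|exact: rnormZ|exact: rnorm_eq0|exact: rnormcM|].
exact: rnorm_star_sqr.
Qed.

Section Theory.
Variable N : C -> R.
Hypothesis HN : is_cstar_norm N.

Lemma cn_D x y : N (x + y) <= N x + N y. Proof. by case: HN. Qed.
Lemma cn_Z k x : N (k *: x) = rnorm k * N x. Proof. by case: HN. Qed.
Lemma cn_def x : N x = 0 -> x = 0. Proof. by case: HN => ? ? + _ _; apply. Qed.
Lemma cn_M x y : N (x ** y) <= N x * N y. Proof. by case: HN. Qed.
Lemma cn_S x : N (cstar x ** x) = N x ^+ 2. Proof. by case: HN. Qed.
Lemma cn_0 : N 0 = 0. Proof. by rewrite -(scale0r 0) cn_Z rnorm0 mul0r. Qed.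
Lemma cn_N x : N (- x) = N x.
Proof. by rewrite -scaleN1r cn_Z rnormN rnorm1 mul1r. Qed.
Lemma cn_ge0 x : 0 <= N x.
Proof. by have := cn_D x (- x); rewrite subrr cn_0 cn_N; lra. Qed.
Lemma cn_star x : N (cstar x) = N x.
Proof.
suff h y : N y <= N (cstar y).
  by apply/eqP; rewrite eq_le h andbT; have := h (cstar x); rewrite cstarK.
have [->|y0] := eqVneq (N y) 0; first exact: cn_ge0.
have yp : 0 < N y by rewrite lt0r y0 cn_ge0.
by rewrite -(ler_pM2r yp) -expr2 -cn_S cn_M.
Qed.
(** The powers [y = x^(2^n)] have the expected norm for all C*-norms at once,
    and they are squares of selfadjoint elements. *)
Lemma cn_sa_pow x (n : nat) : cstar x = x ->
  exists2 y, cstar y = y & [/\ N y = N x ^+ (2 ^ n),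
     (forall N', is_cstar_norm N' -> N' y = N' x ^+ (2 ^ n))
     & (n != 0)%N -> exists2 z, cstar z = z & y = z ** z].
Proof.
move=> sx; elim: n => [|n [y sy [Ny N'y _]]].
  by exists x => //; split => // N' _; rewrite expr1.
exists (y ** y); first by rewrite cstarM sy.
split; last by exists y.
  by rewrite -{1}sy cn_S Ny -exprM expnSr.
move=> N' HN'; rewrite -{1}sy.
by case: (HN') => _ _ _ _ ->; rewrite N'y // -exprM expnSr.
Qed.

End Theory.
End CstarNorm.

Section Sqrt.
Context {R : realType} {C : cstarType R}.
Implicit Types (x y z c d : C) (k : R[i]).
Let rN := rnorm_is_cstar_norm (C := C).

Let half : R := 2^-1.
Let ystep x y := half%:C *: (x + y ** y).
Let cstep (c : R) := half * (1 + c ^+ 2).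
Let y_ x n := iter n (ystep x) 0.
Let c_ n := iter n cstep 0.

Let c01 n : 0 <= c_ n <= 1.
Proof.
elim: n => [|n /andP[c0 c1]]; first by rewrite lexx ler01.
by rewrite /c_ iterS -/(c_ n) /cstep /half; apply/andP; split; nra.
Qed.

Let cS n : c_ n.+1 = half * (1 + c_ n ^+ 2). Proof. by []. Qed.
Let yS x n : y_ x n.+1 = half%:C *: (x + y_ x n ** y_ x n). Proof. by []. Qed.

Let cmono m n : (m <= n)%N -> c_ m <= c_ n.
Proof.
move=> /subnK <-; elim: (n - m)%N => [|p IH] //; rewrite addSn.
apply: le_trans IH _; rewrite cS; move: (c_ _) => c; rewrite /half; have := sqr_ge0 (1 - c); nra.
Qed.

Let ycomm x n d : x ** d = d ** x -> y_ x n ** d = d ** y_ x n.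
Proof.
move=> xd; elim: n => [|n IH]; first by rewrite cmul0l cmul0r.
rewrite yS cmulZl cmulZr cmulDl cmulDr xd; congr (_ *: (_ + _)).
by rewrite -cmulA IH !cmulA IH.
Qed.

Let ystar x n : cstar x = x -> cstar (y_ x n) = y_ x n.
Proof.
move=> sx; elim: n => [|n IH]; first exact: cstar0.
by rewrite yS cstarZr cstarD cstarM sx IH.
Qed.

Let half_abs : rnorm (half%:C : R[i]) = half.
Proof. by rewrite rnorm_real ger0_norm // invr_ge0. Qed.

Let ybd x n : rnorm x <= 1 -> rnorm (y_ x n) <= c_ n.
Proof.
move=> x1; elim: n => [|n IH]; first by rewrite rnorm0.
rewrite yS cS rnormZ half_abs ler_pM2l ?invr_gt0 //.
apply: le_trans (ler_rnormD _ _) _; apply: lerD => //.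
apply: le_trans (rnormcM _ _) _; rewrite expr2.
by apply: ler_pM => //; exact: rnorm_ge0.
Qed.

Let ycau x m n : rnorm x <= 1 -> (m <= n)%N ->
  rnorm (y_ x n - y_ x m) <= c_ n - c_ m.
Proof.
move=> x1; elim: m n => [|m IH] n; first by rewrite !subr0 => _; exact: ybd.
case: n => // n; rewrite ltnS => mn.
rewrite !yS !cS -scalerBr rnormZ half_abs -mulrBr ler_pM2l ?invr_gt0 //.
have comm : y_ x n ** y_ x m = y_ x m ** y_ x n.
  by apply: ycomm; rewrite ycomm.
have -> : x + y_ x n ** y_ x n - (x + y_ x m ** y_ x m) =
   (y_ x n + y_ x m) ** (y_ x n - y_ x m).
  by rewrite cmulDl !cmulBr comm; abel.
have -> : 1 + c_ n ^+ 2 - (1 + c_ m ^+ 2) = (c_ n + c_ m) * (c_ n - c_ m).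
  by ring.
apply: le_trans (rnormcM _ _) _; apply: ler_pM; rewrite ?rnorm_ge0 //.
  by apply: le_trans (ler_rnormD _ _) _; apply: lerD; exact: ybd.
exact: IH.
Qed.

(** The binomial series for [1 - sqrt (1 - x)] converges in norm up to the
    boundary [`|x| = 1]; it is the limit of the iteration
    [y := (x + y ^ 2) / 2], whose scalar counterpart at [x = 1] increases to
    [1] and dominates it.  [1 - y] is a formal square root of [1 - x], also
    when [C] has no unit. *)
Lemma cstar_sqrt x : cstar x = x -> rnorm x <= 1 ->
  exists y, [/\ cstar y = y, rnorm y <= 1, y + y = x + y ** y
    & forall d, x ** d = d ** x -> y ** d = d ** y].
Proof.
move=> sx x1.
have cc (e : R) : 0 < e -> exists M, forall m n, (M <= m)%N -> (m <= n)%N ->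
    c_ n - c_ m < e.
  move=> e0.
  have hs : has_sup [set c_ n | n in [set: nat]].
    split; first by exists 0, 0%N.
    by exists 1 => _ [n _ <-]; case/andP: (c01 n).
  have [_ [M _ <-] hM] := sup_adherent e0 hs.
  exists M => m n Mm mn.
  have : c_ n <= sup [set c_ n | n in [set: nat]] by apply: sup_upper_bound => //; exists n.
  by have := cmono Mm; lra.
have [|y hy] := complete_rnorm (u := y_ x).
  move=> e /cc[M hM]; exists M => m n Mm mn.
  by apply: le_lt_trans (ycau x1 mn) _; exact: hM.
have ylim (z : C) (K : R) : (forall n, rnorm z <= K * rnorm (y_ x n - y)
      + K * rnorm (y_ x n.+1 - y)) -> z = 0.
  move=> hz; apply: (@rnorm_small _ _ _ (`|K| + `|K|)) => e e0.
  have [M hM] := hy e e0; apply: le_trans (hz M) _.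
  rewrite mulrDl; apply: lerD.
    apply: le_trans (_ : `|K| * rnorm (y_ x M - y) <= _).
      by rewrite ler_wpM2r ?rnorm_ge0 ?ler_norm.
    by rewrite ler_wpM2l // ltW // hM.
  apply: le_trans (_ : `|K| * rnorm (y_ x M.+1 - y) <= _).
    by rewrite ler_wpM2r ?rnorm_ge0 ?ler_norm.
  by rewrite ler_wpM2l // ltW // hM.
have sy : cstar y = y.
  apply/eqP; rewrite -subr_eq0; apply/eqP; apply: (ylim _ 2) => n.
  have -> : cstar y - y = (y_ x n - y) - cstar (y_ x n - y).
    by rewrite cstarB ystar //; abel.
  apply: le_trans (ler_rnormB _ _) _; rewrite (cn_star rN).
  have := rnorm_ge0 (y_ x n.+1 - y); lra.
have y1 : rnorm y <= 1.
  apply/ler_addgt0Pl => e e0; have [M hM] := hy e e0.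
  have -> : y = y_ x M - (y_ x M - y) by rewrite opprB addrC subrK.
  apply: le_trans (ler_rnormB _ _) _; rewrite addrC lerD ?(ltW (hM _ _)) //.
  by apply: le_trans (ybd M x1) _; case/andP: (c01 M).
exists y; split => //.
- apply/eqP; rewrite -subr_eq0; apply/eqP; apply: (ylim _ 2) => n.
  have -> : y + y - (x + y ** y) =
     - (2%:R *: (y_ x n.+1 - y)) + (y_ x n ** (y_ x n - y) + (y_ x n - y) ** y).
    rewrite cmulBr cmulBl yS scalerBr.
    have -> : 2%:R *: (half%:C *: (x + y_ x n ** y_ x n)) = x + y_ x n ** y_ x n.
      rewrite scalerA -(rmorph_nat (real_complex R)) -rmorphM /= divff ?scale1r //.
      by rewrite pnatr_eq0.
    by rewrite scaler_nat mulr2n; abel.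
  apply: le_trans (ler_rnormD _ _) _; rewrite addrC rnormN rnormZ rnorm_nat.
  rewrite lerD2r; apply: le_trans (ler_rnormD _ _) _.
  have a1 := rnormcM (y_ x n) (y_ x n - y).
  have a2 := rnormcM (y_ x n - y) y.
  have a3 : rnorm (y_ x n) <= 1.
    by apply: le_trans (ybd n x1) _; case/andP: (c01 n).
  have := rnorm_ge0 (y_ x n - y); nra.
move=> d xd; apply/eqP; rewrite -subr_eq0; apply/eqP.
apply: (ylim _ (2 * rnorm d)) => n.
have -> : y ** d - d ** y = d ** (y_ x n - y) - (y_ x n - y) ** d.
  by rewrite cmulBr cmulBl ycomm //; abel.
apply: le_trans (ler_rnormB _ _) _.
have a1 := rnormcM d (y_ x n - y).
have a2 := rnormcM (y_ x n - y) d.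
have a3 := rnorm_ge0 (y_ x n.+1 - y).
have a4 := rnorm_ge0 d; nra.
Qed.

End Sqrt.

(** * Families of multipliers *)

Section Multipliers.
Context {R : realType} {C : cstarType R} {I : Type}.
Implicit Types (x y z c d : C) (k : R[i]) (T : I -> C -> C).

Definition bdd_family T : Prop :=
  exists M : R, forall i x, rnorm (T i x) <= M * rnorm x.

Definition adj_family T T' : Prop :=
  forall i x z, cstar (T i x) ** z = cstar x ** T' i z.

Definition mult_family : pred (I -> C -> C) := fun T =>
  `[< bdd_family T /\ exists2 T', bdd_family T' & adj_family T T' >].

Lemma bdd_family_lin k T S : bdd_family T -> bdd_family S ->
  bdd_family (k *: T + S).
Proof.
move=> [M hM] [M' hM']; exists (rnorm k * M + M') => i x.
apply: le_trans (ler_rnormD _ _) _; rewrite rnormZ mulrDl lerD //.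
by rewrite -mulrA ler_wpM2l ?rnorm_ge0.
Qed.

Lemma bdd_family_comp T S : bdd_family T -> bdd_family S ->
  bdd_family (fun i => T i \o S i).
Proof.
move=> [M hM] [M' hM']; exists (`|M| * M') => i x /=.
apply: le_trans (hM _ _) _; apply: le_trans (_ : `|M| * rnorm (S i x) <= _).
  by rewrite ler_wpM2r ?rnorm_ge0 ?ler_norm.
by rewrite -mulrA ler_wpM2l.
Qed.

Lemma adj_family_lin k T S T' S' : adj_family T T' -> adj_family S S' ->
  adj_family (k *: T + S) (k^* *: T' + S').
Proof.
move=> h h' i x z /=.
by rewrite cstarD cstarZ cmulDl cmulZl h h' cmulDr cmulZr.
Qed.

Lemma adj_family_comp T S T' S' : adj_family T T' -> adj_family S S' ->
  adj_family (fun i => T i \o S i) (fun i => S' i \o T' i).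
Proof. by move=> h h' i x z /=; rewrite h h'. Qed.

Lemma adj_familyC T T' : adj_family T T' -> adj_family T' T.
Proof.
move=> h i x z; apply: (can_inj cstarK).
by rewrite !cstarM !cstarK h.
Qed.

(** Adjointability alone forces additivity, homogeneity and right
    [C]-linearity, because the product of [C] is nondegenerate. *)
Lemma adj_familyD T T' i x y : adj_family T T' ->
  T i (x + y) = T i x + T i y.
Proof.
move=> h; apply/eqP; rewrite -subr_eq0; apply/eqP/cmul_nondeg => z.
by rewrite cstarB cstarD cmulBl cmulDl !h cstarD cmulDl subrr.
Qed.

Lemma adj_familyZ T T' i k x : adj_family T T' -> T i (k *: x) = k *: T i x.
Proof.
move=> h; apply/eqP; rewrite -subr_eq0; apply/eqP/cmul_nondeg => z.
by rewrite cstarB !cstarZ cmulBl cmulZl !h cstarZ cmulZl subrr.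
Qed.

Lemma adj_familyM T T' i x y : adj_family T T' -> T i (x ** y) = T i x ** y.
Proof.
move=> h; apply/eqP; rewrite -subr_eq0; apply/eqP/cmul_nondeg => z.
by rewrite cstarB !cstarM cmulBl !h cstarM -!cmulA h subrr.
Qed.

Lemma adj_family_uniq T T' T'' : adj_family T T' -> adj_family T T'' -> T' = T''.
Proof.
move=> h h'; apply/funext => i; apply/funext => z.
apply/eqP; rewrite -subr_eq0; apply/eqP/cmul_nondeg => x.
rewrite -[x]cstarK -cstarM; apply: (can_inj cstarK).
by rewrite cstarK cmulBr -h -h' subrr cstar0.
Qed.

Lemma mult_family_submod : submod_closed mult_family.
Proof.
split.
  apply/asboolP; split.
    by exists 0 => i x; rewrite mul0r /= rnorm0.
  exists 0; first by exists 0 => i x; rewrite mul0r /= rnorm0.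
  by move=> i x z /=; rewrite cstar0 cmul0l cmul0r.
move=> k T S /asboolP[bT [T' bT' h]] /asboolP[bS [S' bS' h']].
apply/asboolP; split; first exact: bdd_family_lin.
by exists (k^* *: T' + S'); [exact: bdd_family_lin|exact: adj_family_lin].
Qed.

HB.instance Definition _ := GRing.isSubmodClosed.Build _ _ mult_family mult_family_submod.

End Multipliers.

(** Uniformly bounded families, indexed by [I], of adjointable maps of [C],
    regarded as a right Hilbert module over itself.  They form a unital
    *-algebra, whether or not [C] has a unit; the elements of [C] act in it by
    left multiplication. *)
Structure mult {R : realType} (C : cstarType R) (I : Type) := Mult {
  mfun : I -> C -> C;
  _ : mult_family mfun
}.

Section MultAlgebra.
Context {R : realType} {C : cstarType R} {I : Type}.

HB.instance Definition _ := [isSub of mult C I for @mfun R C I].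
HB.instance Definition _ := [Choice of mult C I by <:].
HB.instance Definition _ := [SubChoice_isSubLmodule of mult C I by <:].
Implicit Types (a b : mult C I) (x y z c d : C) (k : R[i]) (i : I).

Lemma mfun_inj a b : (forall i x, mfun a i x = mfun b i x) -> a = b.
Proof. by move=> h; apply: val_inj; apply/funext => i; apply/funext => x; exact: h. Qed.

Lemma mfunD a b i x : mfun (a + b) i x = mfun a i x + mfun b i x.
Proof. by []. Qed.
Lemma mfunZ k a i x : mfun (k *: a) i x = k *: mfun a i x.
Proof. by []. Qed.
Lemma mfunN a i x : mfun (- a) i x = - mfun a i x.
Proof. by []. Qed.
Lemma mfun0 i x : mfun (0 : mult C I) i x = 0.
Proof. by []. Qed.

Lemma mult_adjP a : exists2 T', bdd_family T' & adj_family (mfun a) T'.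
Proof. by have /asboolP[] := valP a. Qed.
Lemma mult_bdd a : bdd_family (mfun a).
Proof. by have /asboolP[] := valP a. Qed.

Lemma mfun_arg0 a i : mfun a i 0 = 0.
Proof.
have [T' _ h] := mult_adjP a.
by rewrite -(scale0r (0 : C)) (adj_familyZ _ _ _ h) !scale0r.
Qed.
Lemma mfun_argD a i x y : mfun a i (x + y) = mfun a i x + mfun a i y.
Proof. by have [T' _ h] := mult_adjP a; exact: adj_familyD h. Qed.
Lemma mfun_argZ a i k x : mfun a i (k *: x) = k *: mfun a i x.
Proof. by have [T' _ h] := mult_adjP a; exact: adj_familyZ h. Qed.
Lemma mfun_argM a i x y : mfun a i (x ** y) = mfun a i x ** y.
Proof. by have [T' _ h] := mult_adjP a; exact: adj_familyM h. Qed.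
Lemma mfun_argN a i x : mfun a i (- x) = - mfun a i x.
Proof. by rewrite -scaleN1r mfun_argZ scaleN1r. Qed.
Lemma mfun_sum a i (J : Type) (r : seq J) (P : pred J) (F : J -> C) :
  mfun a i (\sum_(j <- r | P j) F j) = \sum_(j <- r | P j) mfun a i (F j).
Proof. by apply: (big_morph (mfun a i)) => [x y|]; rewrite ?mfun_argD ?mfun_arg0. Qed.
Lemma sum_mfun i x (J : Type) (r : seq J) (P : pred J) (F : J -> mult C I) :
  mfun (\sum_(j <- r | P j) F j) i x = \sum_(j <- r | P j) mfun (F j) i x.
Proof. by apply: (big_morph (fun a => mfun a i x)). Qed.

Fact one_subproof : mult_family (fun (_ : I) (x : C) => x).
Proof.
apply/asboolP; have b : bdd_family (fun (_ : I) (x : C) => x).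
  by exists 1 => i x; rewrite mul1r.
by split => //; exists (fun _ x => x).
Qed.
Definition mult_one : mult C I := Mult one_subproof.

Fact mul_subproof a b : mult_family (fun i => mfun a i \o mfun b i).
Proof.
apply/asboolP; split; first by apply: bdd_family_comp; exact: mult_bdd.
have [T bT hT] := mult_adjP a; have [S bS hS] := mult_adjP b.
exists (fun i => S i \o T i); first exact: bdd_family_comp.
exact: adj_family_comp.
Qed.
Definition mult_mul a b : mult C I := Mult (mul_subproof a b).

Fact mult_mulA : associative mult_mul.
Proof. by move=> a b c; apply: mfun_inj. Qed.
Fact mult_mul1l : left_id mult_one mult_mul.
Proof. by move=> a; apply: mfun_inj. Qed.
Fact mult_mul1r : right_id mult_one mult_mul.
Proof. by move=> a; apply: mfun_inj. Qed.
Fact mult_mulDl : left_distributive mult_mul +%R.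
Proof. by move=> a b c; apply: mfun_inj. Qed.
Fact mult_mulDr : right_distributive mult_mul +%R.
Proof. by move=> a b c; apply: mfun_inj => i x; rewrite /= mfun_argD. Qed.

HB.instance Definition _ := GRing.Zmodule_isPzRing.Build (mult C I)
  mult_mulA mult_mul1l mult_mul1r mult_mulDl mult_mulDr.

(* [mult C I] is the zero ring when [C = 0]; it is therefore treated as a ring
   and a module, linked by these two compatibilities. *)
Fact mult_scalAl k (a b : mult C I) : k *: (a * b) = (k *: a) * b.
Proof. by apply: mfun_inj. Qed.
Fact mult_scalAr k (a b : mult C I) : k *: (a * b) = a * (k *: b).
Proof. by apply: mfun_inj => i x; rewrite /= mfun_argZ. Qed.


Lemma mfunM a b i x : mfun (a * b) i x = mfun a i (mfun b i x).
Proof. by []. Qed.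
Lemma mfun1 i x : mfun (1 : mult C I) i x = x.
Proof. by []. Qed.

Definition dag_fun a := projT1 (cid2 (mult_adjP a)).
Fact dag_subproof a : mult_family (dag_fun a).
Proof.
rewrite /dag_fun; case: cid2 => T bT hT /=; apply/asboolP; split => //.
by exists (mfun a); [exact: mult_bdd|exact: adj_familyC].
Qed.
Definition dag a : mult C I := Mult (dag_subproof a).

Lemma dagP a : adj_family (mfun a) (mfun (dag a)).
Proof. by rewrite /= /dag_fun; case: cid2. Qed.

Lemma mfun_dag a i x z : cstar (mfun a i x) ** z = cstar x ** mfun (dag a) i z.
Proof. exact: dagP. Qed.

Lemma dag_uniq a b : adj_family (mfun a) (mfun b) -> dag a = b.
Proof.
by move=> h; apply: val_inj; apply: adj_family_uniq h; exact: dagP.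
Qed.

Lemma dagK a : dag (dag a) = a.
Proof. by apply: dag_uniq; apply: adj_familyC; exact: dagP. Qed.
Lemma dagD a b : dag (a + b) = dag a + dag b.
Proof.
apply: dag_uniq => i x z.
by rewrite !mfunD cstarD cmulDl !mfun_dag cmulDr.
Qed.
Lemma dagZ k a : dag (k *: a) = k^* *: dag a.
Proof.
apply: dag_uniq => i x z.
by rewrite !mfunZ cstarZ cmulZl !mfun_dag cmulZr.
Qed.
Lemma dagM a b : dag (a * b) = dag b * dag a.
Proof. by apply: dag_uniq => i x z; rewrite !mfunM !mfun_dag. Qed.
Lemma dag1 : dag (1 : mult C I) = 1.
Proof. by apply: dag_uniq => i x z. Qed.
Lemma dag0 : dag (0 : mult C I) = 0.
Proof. by rewrite -(scale0r (0 : mult C I)) dagZ rmorph0 !scale0r. Qed.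
Lemma dagN a : dag (- a) = - dag a.
Proof. by rewrite -scaleN1r dagZ rmorphN1 scaleN1r. Qed.
Lemma dag_sum (J : Type) (r : seq J) (P : pred J) (F : J -> mult C I) :
  dag (\sum_(j <- r | P j) F j) = \sum_(j <- r | P j) dag (F j).
Proof. by apply: (big_morph dag) => [a b|]; rewrite ?dagD ?dag0. Qed.

Fact lmul_subproof (s : I -> C) : (exists M : R, forall i, rnorm (s i) <= M) ->
  mult_family (fun i x => s i ** x).
Proof.
move=> [M hM]; apply/asboolP; split.
  exists M => i x; apply: le_trans (rnormcM _ _) _.
  by rewrite ler_wpM2r ?rnorm_ge0.
exists (fun i x => cstar (s i) ** x).
  exists M => i x; apply: le_trans (rnormcM _ _) _.
  by rewrite ler_wpM2r ?rnorm_ge0 ?(cn_star (rnorm_is_cstar_norm (C := C))).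
by move=> i x z; rewrite cstarM cmulA.
Qed.
Definition lmul_fam (s : I -> C) hs : mult C I := Mult (@lmul_subproof s hs).

Fact const_bdd c : exists M : R, forall i : I, rnorm c <= M.
Proof. by exists (rnorm c). Qed.
Definition lmul c : mult C I := lmul_fam (const_bdd c).

Lemma mfun_lmul c i x : mfun (lmul c) i x = c ** x.
Proof. by []. Qed.
Lemma lmulD c d : lmul (c + d) = lmul c + lmul d.
Proof. by apply: mfun_inj => i x; rewrite mfunD !mfun_lmul cmulDl. Qed.
Lemma lmulZ k c : lmul (k *: c) = k *: lmul c.
Proof. by apply: mfun_inj => i x; rewrite mfunZ !mfun_lmul cmulZl. Qed.
Lemma lmulM c d : lmul (c ** d) = lmul c * lmul d.
Proof. by apply: mfun_inj => i x; rewrite mfunM !mfun_lmul cmulA. Qed.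
Lemma lmul0 : lmul 0 = 0.
Proof. by apply: mfun_inj => i x; rewrite mfun_lmul cmul0l. Qed.
Lemma lmulN c : lmul (- c) = - lmul c.
Proof. by rewrite -scaleN1r lmulZ scaleN1r. Qed.
Lemma lmulB c d : lmul (c - d) = lmul c - lmul d.
Proof. by rewrite lmulD lmulN. Qed.
Lemma dag_lmul c : dag (lmul c) = lmul (cstar c).
Proof. by apply: dag_uniq => i x z; rewrite !mfun_lmul cstarM cmulA. Qed.

(** A unitary multiplier is isometric for every C*-norm, complete or not. *)
Lemma cn_unitary (N : C -> R) (u : mult C I) i x : is_cstar_norm N ->
  dag u * u = 1 -> N (mfun u i x) = N x.
Proof.
move=> HN hu; apply/eqP.
rewrite -(@eqrXn2 _ 2) ?(cn_ge0 HN) // -!(cn_S HN) mfun_dag -mfunM hu mfun1.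
exact: eqxx.
Qed.

(** The real part of a unitary is a contraction for every C*-norm. *)
Lemma cn_contract (N : C -> R) (s t : mult C I) i x : is_cstar_norm N ->
  dag s = s -> dag t = t -> s * t = t * s -> s * s + t * t = 1 ->
  N (mfun s i x) <= N x.
Proof.
move=> HN ss st cst hst.
have iJ : ('i%C : R[i])^* = - 'i%C by rewrite conjCi.
pose w := s + 'i%C *: t; pose w' := s - 'i%C *: t.
have dw : dag w = w' by rewrite dagD dagZ ss st conjCi scaleNr.
have dw' : dag w' = w by rewrite -dw dagK.
have ii : 'i%C *: ('i%C *: (t * t)) = - (t * t).
  by rewrite scalerA -expr2 sqrCi scaleN1r.
have ww : dag w * w = 1.
  rewrite dw /w /w' mulrBl !mulrDr -!mult_scalAl -!mult_scalAr ii cst -hst; abel.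
have ww' : dag w' * w' = 1.
  rewrite dw' /w /w' mulrDl !mulrBr -!mult_scalAl -!mult_scalAr ii cst -hst; abel.
have e : mfun s i x + mfun s i x = mfun w i x + mfun w' i x.
  rewrite /w /w' !mfunD mfunN; abel.
have := cn_D HN (mfun w i x) (mfun w' i x).
rewrite -e (cn_unitary _ _ HN ww) (cn_unitary _ _ HN ww').
rewrite -[mfun s i x]scale1r -scalerDl (cn_Z HN).
rewrite (_ : (1 + 1 : R[i]) = 2%:R) ?rnorm_nat ?scale1r; last by rewrite mulr2n.
lra.
Qed.

End MultAlgebra.
Arguments lmul {R C I}.

(** * Uniqueness of the C*-norm *)

Section UniqueNorm.
Context {R : realType} {C : cstarType R}.
Implicit Types (x y z c d : C) (k : R[i]).
Let D := mult C unit.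
Let rN := rnorm_is_cstar_norm (C := C).

(** The formal element [1 - y] of [cstar_sqrt] becomes an actual square root
    in the algebra of multipliers. *)
Lemma lmul_sqrt I x y : y + y = x + y ** y ->
  (1 - lmul y) * (1 - lmul y) = 1 - lmul x :> mult C I.
Proof.
move=> h; rewrite mulrBl !mulrBr !mul1r mulr1 -lmulM.
have -> : x = y + y - y ** y by rewrite h; abel.
rewrite lmulB lmulD; abel.
Qed.

Lemma dag_1B_lmul I y : cstar y = y -> dag (1 - lmul y) = 1 - lmul y :> mult C I.
Proof. by move=> sy; rewrite dagD dagN dag1 dag_lmul sy. Qed.

Lemma comm_1B_lmul I y z : y ** z = z ** y ->
  (1 - lmul y) * lmul z = lmul z * (1 - lmul y) :> mult C I.
Proof. by move=> yz; rewrite mulrBl mulrBr mul1r mulr1 -!lmulM yz. Qed.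

(** A selfadjoint contraction [z] is the real part of the unitary
    [z + i sqrt (1 - z^2)]. *)
Lemma cn_sa_contract N z x : is_cstar_norm N -> cstar z = z -> rnorm z <= 1 ->
  N (z ** x) <= N x.
Proof.
move=> HN sz z1.
have sx : cstar (z ** z) = z ** z by rewrite cstarM sz.
have x1 : rnorm (z ** z) <= 1.
  by rewrite -{1}sz rnorm_star_sqr exprn_ile1 ?rnorm_ge0.
have [y [sy _ hy cy]] := cstar_sqrt sx x1.
apply: (@cn_contract _ _ _ N (lmul z) (1 - lmul y : D) tt x HN).
- by rewrite dag_lmul sz.
- exact: dag_1B_lmul.
- by rewrite comm_1B_lmul //; apply: cy; rewrite cmulA.
- rewrite (lmul_sqrt _ hy) -lmulM; abel.
Qed.

(** By the C*-identity it is enough to treat a selfadjoint contraction [z], and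
    there [N z ^ 2 = N (z z) <= N z]. *)
Lemma cn_le N c : is_cstar_norm N -> N c <= rnorm c.
Proof.
move=> HN; rewrite -(@ler_pXn2r _ 2) ?nnegrE ?(cn_ge0 HN) ?rnorm_ge0 //.
rewrite -(cn_S HN) -rnorm_star_sqr.
have : cstar (cstar c ** c) = cstar c ** c by rewrite cstarM cstarK.
move: (cstar c ** c) => {}c sc.
have [c0|c0] := eqVneq (rnorm c) 0.
  by rewrite (rnorm_eq0 c0) (cn_0 HN) rnorm_ge0.
have cp : 0 < rnorm c by rewrite lt0r c0 rnorm_ge0.
pose z := (rnorm c)^-1%:C *: c.
have zE (N' : C -> R) : is_cstar_norm N' -> N' z = N' c / rnorm c.
  by move=> HN'; rewrite (cn_Z HN') rnorm_real ger0_norm ?invr_ge0 ?rnorm_ge0 // mulrC.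
have sz : cstar z = z by rewrite cstarZr sc.
have z1 : rnorm z <= 1 by rewrite (zE _ rN) divff.
have := cn_sa_contract z HN sz z1.
rewrite -{1}sz (cn_S HN) zE // => h.
rewrite -[leRHS]mul1r -ler_pdivrMr //.
have := cn_ge0 HN c => n0; have : 0 <= N c / rnorm c by rewrite divr_ge0 ?rnorm_ge0.
move: h; set t := N c / _; nra.
Qed.

(** If a C*-norm [N] were smaller than the complete norm somewhere, some
    positive [h] would have norm [1] and [N h <= 1/4].  Then [2h - y], with
    [1 - y = sqrt ((1 - 2h)^2) = |1 - 2h|], is annihilated by
    [2 - 2h - y], which is invertible for [N]; so [y = 2h], although [y] has
    norm at most [1]. *)
Lemma cn_ge N c : is_cstar_norm N -> rnorm c <= N c.
Proof.
move=> HN; rewrite -(@ler_pXn2r _ 2) ?nnegrE ?(cn_ge0 HN) ?rnorm_ge0 //.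
rewrite -(cn_S HN) -rnorm_star_sqr.
have : cstar (cstar c ** c) = cstar c ** c by rewrite cstarM cstarK.
move: (cstar c ** c) => {}c sc.
case: (leP (rnorm c) (N c)) => // Nc.
have cp : 0 < rnorm c by apply: le_lt_trans Nc; exact: cn_ge0.
pose w := (rnorm c)^-1%:C *: c.
have wE (N' : C -> R) : is_cstar_norm N' -> N' w = N' c / rnorm c.
  by move=> HN'; rewrite (cn_Z HN') rnorm_real ger0_norm ?invr_ge0 ?rnorm_ge0 // mulrC.
have sw : cstar w = w by rewrite cstarZr sc.
have w1 : rnorm w = 1 by rewrite (wE _ rN) divff // gt_eqF.
have Nw : N w < 1 by rewrite wE // ltr_pdivrMr // mul1r.
have [n hn] : exists n, N w ^+ (2 ^ n.+1) <= 4^-1.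
  apply: contrapT => hno.
  have : 1 <= N w ^+ 2.
    apply: (@root_le _ _ _ (4 * N w ^+ 2)) => // [|k].
      by rewrite exprn_ge0 // (cn_ge0 HN).
    rewrite expr1n -mulrA -exprS prednK ?expn_gt0 // -exprM -expnS.
    by case: (leP (N w ^+ (2 ^ k.+1)) 4^-1) => hk; [case: hno; exists k|lra].
  by have := cn_ge0 HN w; nra.
have [h sh [_ hN' /(_ isT)[z sz hz]]] := cn_sa_pow HN n.+1 sw.
have h1 : rnorm h = 1 by rewrite (hN' _ rN) w1 expr1n.
have Nh : N h <= 4^-1 by rewrite (hN' _ HN).
have h1le : rnorm h <= 1 by rewrite h1.
have [y [sy _ hy cy]] := cstar_sqrt sh h1le.
have yz : y ** z = z ** y by apply: cy; rewrite hz cmulA.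
pose Z : D := lmul z; pose B : D := 1 - lmul y; pose P : D := lmul h.
have ZZ : Z * Z = P by rewrite -lmulM -hz.
have BB : B * B = 1 - P by exact: lmul_sqrt.
have BZ : B * Z = Z * B by exact: comm_1B_lmul.
have dZ : dag Z = Z by rewrite dag_lmul sz.
have dB : dag B = B by exact: dag_1B_lmul.
clearbody Z B; pose t := Z * B + Z * B; pose s := P + P - 1.
have ZP : P * Z = Z * P by rewrite -ZZ mulrA.
have BP : B * P = P * B by rewrite -ZZ mulrA BZ -mulrA BZ mulrA.
have tt' : t * t = P + P + (P + P) - (P * P + P * P + (P * P + P * P)).
  have ZBZB : Z * B * (Z * B) = P - P * P.
    by rewrite -mulrA (mulrA B) BZ !mulrA ZZ -mulrA BB mulrBr mulr1.
  by rewrite /t mulrDl !mulrDr ZBZB; abel.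
have contr (u : C) : rnorm (mfun t tt u) <= rnorm u.
  apply: (cn_contract (t := s) tt u rN).
  - by rewrite dagD dagM dZ dB BZ.
  - by rewrite !dagD dagN dag1 dag_lmul sh.
  - have PZB : P * (Z * B) = Z * B * P by rewrite mulrA ZP -!mulrA BP.
    by rewrite /t /s mulrBl mulrBr !mulrDl !mulrDr mul1r mulr1 PZB.
  - rewrite tt' /s mulrDl !mulrDr !mulrDl !mulrN !mulNr !mulr1 !mul1r; abel.
pose x := h + h + (h + h) - (h ** h + h ** h + (h ** h + h ** h)).
have tx u : x ** u = mfun t tt (mfun t tt u).
  rewrite -mfunM tt' /P /x !(mfunD, mfunN, mfunM, mfun_lmul).
  by rewrite cmulBl !cmulDl -!cmulA.
have sx : cstar x = x by rewrite cstarB !cstarD cstarM sh.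
have x1 : rnorm x <= 1.
  have : rnorm x ^+ 2 <= rnorm x.
    rewrite -rnorm_star_sqr sx tx; exact: le_trans (contr _) (contr _).
  by have := rnorm_ge0 x; nra.
have [y2 [sy2 y21 hy2 cy2]] := cstar_sqrt sx x1.
have hy2C : y2 ** h = h ** y2.
  by apply: cy2; rewrite cmulBl cmulBr !cmulDl !cmulDr -!cmulA.
pose p := h + h - y2.
have pE : p + p = p ** (h + h + y2).
  rewrite /p cmulBl !cmulDl !cmulDr hy2C.
  have -> : y2 ** y2 = y2 + y2 - x by rewrite hy2; abel.
  rewrite /x; abel.
have p0 : p = 0.
  apply: (cn_def HN); apply/eqP; rewrite eq_le (cn_ge0 HN) andbT.
  have a1 : N (p + p) = 2 * N p.
    by rewrite -mulr2n -scaler_nat (cn_Z HN) rnorm_nat.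
  have a2 := cn_M HN p (h + h + y2).
  have a3 := cn_D HN (h + h) y2.
  have a4 := cn_D HN h h.
  have a5 : N y2 <= 1 := le_trans (cn_le y2 HN) y21.
  have a6 := cn_ge0 HN p.
  rewrite pE in a1; nra.
have : rnorm (h + h) <= 1.
  by have -> : h + h = y2 by rewrite -[RHS]addr0 -p0 /p; abel.
rewrite -mulr2n -scaler_nat rnormZ rnorm_nat h1; lra.
Qed.

Theorem cstar_norm_unique N c : is_cstar_norm N -> N c = rnorm c.
Proof. by move=> HN; apply/eqP; rewrite eq_le cn_le ?cn_ge. Qed.

End UniqueNorm.

(** * Matrices over the multipliers *)

Section MatrixMultipliers.
Context {R : realType} {C : cstarType R} {I : Type}.
Local Notation D := (mult C I).
Implicit Types (c d : C) (k : R[i]) (i : I).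

Definition adag m n (a : 'M[D]_(m, n)) : 'M[D]_(n, m) :=
  \matrix_(p, q) dag (a q p).

Lemma adagM m n p (a : 'M[D]_(m, n)) (b : 'M[D]_(n, p)) :
  adag (a *m b) = adag b *m adag a.
Proof.
apply/matrixP => r s; rewrite !mxE dag_sum.
by apply: eq_bigr => j _; rewrite dagM !mxE.
Qed.

Lemma adagK m n (a : 'M[D]_(m, n)) : adag (adag a) = a.
Proof. by apply/matrixP => r s; rewrite !mxE dagK. Qed.

Lemma adagD m n (a b : 'M[D]_(m, n)) : adag (a + b) = adag a + adag b.
Proof. by apply/matrixP => r s; rewrite !mxE dagD. Qed.

Lemma adagN m n (a : 'M[D]_(m, n)) : adag (- a) = - adag a.
Proof. by apply/matrixP => r s; rewrite !mxE dagN. Qed.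

Lemma adag0 m n : adag (0 : 'M[D]_(m, n)) = 0.
Proof. by apply/matrixP => r s; rewrite !mxE dag0. Qed.

Lemma adag1 n : adag (1%:M : 'M[D]_n) = 1%:M.
Proof.
apply/matrixP => r s; rewrite !mxE eq_sym.
by case: (_ == _); rewrite ?dag1 ?dag0.
Qed.

Lemma adag_block m n (x : 'M[D]_m) (y : 'M[D]_n) :
  adag (block_mx x 0 0 y) = block_mx (adag x) 0 0 (adag y).
Proof.
apply/matrixP => r s; rewrite mxE.
by case: (split_ordP r) => p ->; case: (split_ordP s) => q ->;
  rewrite !(block_mxEul, block_mxEur, block_mxEdl, block_mxEdr) !mxE ?dag0.
Qed.

Definition act n i (a : 'M[D]_n) (x : 'M[C]_n) : 'M[C]_n :=
  \matrix_(p, q) \sum_j mfun (a p j) i (x j q).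

Lemma actM n i (a b : 'M[D]_n) x : act i (a *m b) x = act i a (act i b x).
Proof.
apply/matrixP => p q; rewrite !mxE.
under eq_bigr do rewrite mxE sum_mfun.
rewrite exchange_big; apply: eq_bigr => j _ /=.
by rewrite mxE mfun_sum.
Qed.

Lemma act1 n i (x : 'M[C]_n) : act i 1%:M x = x.
Proof.
apply/matrixP => p q; rewrite mxE (bigD1 p) //= big1 => [|j jp].
  by rewrite mxE eqxx addr0 mfun1.
by rewrite mxE eq_sym (negbTE jp) mfun0.
Qed.

Lemma actD n i (a b : 'M[D]_n) x : act i (a + b) x = act i a x + act i b x.
Proof.
apply/matrixP => p q; rewrite !mxE -big_split; apply: eq_bigr => j _ /=.
by rewrite mxE mfunD.
Qed.

Lemma actN n i (a : 'M[D]_n) x : act i (- a) x = - act i a x.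
Proof.
apply/matrixP => p q; rewrite !mxE -sumrN; apply: eq_bigr => j _ /=.
by rewrite mxE mfunN.
Qed.

Lemma act_argZ n i k (a : 'M[D]_n) (x : 'M[C]_n) : act i a (k *:: x) = k *:: act i a x.
Proof.
apply/matrixP => p q; rewrite !mxE scaler_sumr.
by apply: eq_bigr => j _; rewrite mxE mfun_argZ.
Qed.

Lemma actZ n i k (a : 'M[D]_n) (x : 'M[C]_n) : act i (k *:: a) x = k *:: act i a x.
Proof.
apply/matrixP => p q; rewrite !mxE scaler_sumr.
by apply: eq_bigr => j _; rewrite mxE mfunZ.
Qed.

(** [act] is a *-representation on [M_n(C)], regarded as a right Hilbert module
    over itself. *)
Lemma act_dag n i (a : 'M[D]_n) x z :
  cmxmul (cmxstar (act i a x)) z = cmxmul (cmxstar x) (act i (adag a) z).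
Proof.
apply/matrixP => p q; rewrite !mxE.
under eq_bigr do rewrite !mxE cstar_sum cmul_suml.
under [RHS]eq_bigr do rewrite !mxE cmul_sumr.
rewrite exchange_big; apply: eq_bigr => j _; apply: eq_bigr => r _.
by rewrite mxE mfun_dag.
Qed.

Lemma act_lmul n i (a x : 'M[C]_n) : act i (map_mx lmul a) x = cmxmul a x.
Proof.
by apply/matrixP => p q; rewrite !mxE; apply: eq_bigr => j _; rewrite mxE.
Qed.

Lemma cmxstarK n (x : 'M[C]_n) : cmxstar (cmxstar x) = x.
Proof. by apply/matrixP => p q; rewrite !mxE cstarK. Qed.

(** [C] is an ideal of its multipliers. *)
Lemma map_lmulM n i (a : 'M[D]_n) (x : 'M[C]_n) : (forall p q i', mfun (a p q) i' = mfun (a p q) i) ->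
  a *m map_mx lmul x = map_mx lmul (act i a x).
Proof.
move=> ha; apply/matrixP => p q; rewrite !mxE; apply: mfun_inj => i' z.
rewrite sum_mfun mfun_lmul cmul_suml; apply: eq_bigr => j _.
by rewrite mxE mfunM mfun_lmul ha mfun_argM.
Qed.

End MatrixMultipliers.

(** * The matrix norms of the multipliers *)

Section MatrixNorm.
Context {R : realType} {C : cstarType R} {I : Type} (i0 : I).
Variable nu : forall n, 'M[C]_n -> R.
Hypothesis Hnu : is_cstar_mxnorm nu.
Local Notation D := (mult C I).
Implicit Types (c d : C) (k : R[i]) (i : I).

Lemma nu_D n (x y : 'M[C]_n) : nu (x + y) <= nu x + nu y.
Proof. by have [[]] := Hnu.1 n. Qed.
Lemma nu_Z n k (x : 'M[C]_n) : nu (k *:: x) = rnorm k * nu x.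
Proof. by have [[_ + _] _ _] := Hnu.1 n; apply. Qed.
Lemma nu_def n (x : 'M[C]_n) : nu x = 0 -> x = 0.
Proof. by have [[_ _ +] _ _] := Hnu.1 n; apply. Qed.
Lemma nu_M n (x y : 'M[C]_n) : nu (cmxmul x y) <= nu x * nu y.
Proof. by have [_ + _] := Hnu.1 n; apply. Qed.
Lemma nu_S n (x : 'M[C]_n) : nu (cmxmul (cmxstar x) x) = nu x ^+ 2.
Proof. by have [_ _ +] := Hnu.1 n; apply. Qed.
Lemma nu_0 n : nu (0 : 'M[C]_n) = 0.
Proof.
have := nu_Z 0 (0 : 'M[C]_n); rewrite rnorm0 mul0r => <-; congr (nu _).
by apply/matrixP => p q; rewrite !mxE scale0r.
Qed.
Lemma nu_N n (x : 'M[C]_n) : nu (- x) = nu x.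
Proof.
have := nu_Z (- 1) x; rewrite rnormN rnorm1 mul1r => <-; congr (nu _).
by apply/matrixP => p q; rewrite !mxE scaleN1r.
Qed.
Lemma nu_ge0 n (x : 'M[C]_n) : 0 <= nu x.
Proof. by have := nu_D x (- x); rewrite subrr nu_0 nu_N; lra. Qed.
Lemma nu_star n (x : 'M[C]_n) : nu (cmxstar x) = nu x.
Proof.
suff h (y : 'M[C]_n) : nu y <= nu (cmxstar y).
  by apply/eqP; rewrite eq_le h andbT; have := h (cmxstar x); rewrite cmxstarK.
have [->|y0] := eqVneq (nu y) 0; first exact: nu_ge0.
have yp : 0 < nu y by rewrite lt0r y0 nu_ge0.
by rewrite -(ler_pM2r yp) -expr2 -nu_S nu_M.
Qed.
Lemma nu_sum n (J : Type) (r : seq J) (P : pred J) (F : J -> 'M[C]_n) :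
  nu (\sum_(j <- r | P j) F j) <= \sum_(j <- r | P j) nu (F j).
Proof.
elim/big_rec2: _ => [|j a b _ h]; first by rewrite nu_0.
exact: le_trans (nu_D _ _) (lerD _ _).
Qed.

Lemma nu_unitary n i (u : 'M[D]_n) x : adag u *m u = 1%:M -> nu (act i u x) = nu x.
Proof.
move=> hu; apply/eqP; rewrite -(@eqrXn2 _ 2) ?nu_ge0 // -!nu_S.
by rewrite act_dag -actM hu act1.
Qed.

(** [1 - 2 p] is unitary. *)
Lemma nu_proj n i (p : 'M[D]_n) x : adag p = p -> p *m p = p ->
  nu (act i p x) <= nu x.
Proof.
move=> sp pp; pose u := 1%:M - (p + p).
have uu : adag u *m u = 1%:M.
  rewrite /u adagD adagN adagD adag1 sp mulmxBl !mulmxBr mul1mx mulmx1 mul1mx.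
  by rewrite mulmxDl !mulmxDr pp; abel.
have e : 2%:R *:: act i p x = x - act i u x.
  rewrite /u actD actN actD act1; apply/matrixP => r s; rewrite mxE scaler_nat mulr2n.
  by rewrite !mxE; abel.
have := nu_D x (- act i u x); rewrite -e nu_N nu_unitary // nu_Z rnorm_nat; lra.
Qed.

Definition cdelta n (p q : 'I_n) c : 'M[C]_n :=
  \matrix_(r, s) if (r == p) && (s == q) then c else 0.

Lemma cdelta_mul n (p q r : 'I_n) c d :
  cmxmul (cdelta p q c) (cdelta q r d) = cdelta p r (c ** d).
Proof.
apply/matrixP => s t; rewrite !mxE (bigD1 q) //= big1 => [|j jq].
  rewrite !mxE !eqxx /= addr0 andbT.
  by case: (s == p) => /=; case: (t == r) => //=; rewrite ?cmul0l ?cmul0r.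
by rewrite !mxE (negbTE jq) andbF cmul0l.
Qed.

Lemma cdelta_star n (p q : 'I_n) c : cmxstar (cdelta p q c) = cdelta q p (cstar c).
Proof.
by apply/matrixP => s t; rewrite !mxE andbC; case: ifP => _; rewrite ?cstar0.
Qed.

(** The corner [c E_pp] carries a C*-norm of [c].  This is what relates the
    norms of matrices of different sizes. *)
Lemma nu_delta_diag n (p : 'I_n) c : nu (cdelta p p c) = rnorm c.
Proof.
apply: (@cstar_norm_unique _ _ (fun c => nu (cdelta p p c))); split.
- move=> x y; apply: le_trans (nu_D _ _); rewrite le_eqVlt; apply/orP; left; apply/eqP.
  by congr (nu _); apply/matrixP => s t; rewrite !mxE; case: ifP => _; rewrite ?addr0.
- move=> k x; rewrite -nu_Z; congr (nu _).
  by apply/matrixP => s t; rewrite !mxE; case: ifP => _; rewrite ?scaler0.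
- by move=> x /nu_def/matrixP/(_ p p); rewrite !mxE !eqxx.
- by move=> x y; rewrite -(cdelta_mul p p p); exact: nu_M.
- by move=> x; rewrite -nu_S cdelta_star cdelta_mul.
Qed.

Lemma nu_delta n (p q : 'I_n) c : nu (cdelta p q c) = rnorm c.
Proof.
apply/eqP; rewrite -(@eqrXn2 _ 2) ?nu_ge0 ?rnorm_ge0 // -nu_S cdelta_star cdelta_mul.
by rewrite nu_delta_diag rnorm_star_sqr.
Qed.

Lemma nu_le_sum n (x : 'M[C]_n) : nu x <= \sum_p \sum_q rnorm (x p q).
Proof.
have {1}-> : x = \sum_p \sum_q cdelta p q (x p q).
  apply/matrixP => s t; rewrite summxE (bigD1 s) //= summxE (bigD1 t) //= mxE !eqxx /=.
  rewrite !big1 ?addr0 // => [j js|j jt]; last by rewrite mxE (eq_sym t) (negbTE jt) andbF.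
  by rewrite summxE big1 // => l _; rewrite mxE (eq_sym s) (negbTE js).
apply: le_trans (nu_sum _ _ _) _; apply: ler_sum => p _.
apply: le_trans (nu_sum _ _ _) _; apply: ler_sum => q _.
by rewrite nu_delta.
Qed.

Lemma nu_row n (p : 'I_n) (x : 'M[C]_n) :
  nu (\matrix_(r, s) if r == p then x r s else 0) <= nu x.
Proof.
pose e : 'M[D]_n := delta_mx p p.
have -> : (\matrix_(r, s) if r == p then x r s else 0) = act i0 e x.
  apply/matrixP => r s; rewrite !mxE (bigD1 p) //= big1 => [|j jp].
    by rewrite mxE eqxx andbT addr0; case: eqP => [->|_]; rewrite ?mfun1 ?mfun0.
  by rewrite mxE (negbTE jp) andbF mfun0.
apply: nu_proj; last by rewrite mul_delta_mx.
apply/matrixP => r s; rewrite !mxE andbC.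
by case: (_ && _); rewrite ?dag1 ?dag0.
Qed.

Lemma nu_entry n (p q : 'I_n) (x : 'M[C]_n) : rnorm (x p q) <= nu x.
Proof.
rewrite -(nu_delta p q) -nu_star cdelta_star.
apply: le_trans (nu_row p x); rewrite -[leRHS]nu_star.
set y := cmxstar _; apply: le_trans (nu_row q y).
rewrite le_eqVlt; apply/orP; left; apply/eqP; congr (nu _).
apply/matrixP => r s; rewrite !mxE.
by case: eqP => //= ->; case: eqP => [->|]; rewrite ?cstar0.
Qed.

End MatrixNorm.

(** * Scalar matrices *)

Section ScalarMatrices.
Context {R : realType}.
Implicit Types (k : R[i]).

Lemma l2norm_ge0 n (v : 'cV[R[i]]_n) : 0 <= l2norm v.
Proof. exact: sqrtr_ge0. Qed.

Lemma l2norm_sqr n (v : 'cV[R[i]]_n) : l2norm v ^+ 2 = \sum_i rnorm (v i 0) ^+ 2.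
Proof. by rewrite sqr_sqrtr // sumr_ge0 // => i _; exact: sqr_ge0. Qed.

Lemma l2norm_entry n (v : 'cV[R[i]]_n) i : rnorm (v i 0) <= l2norm v.
Proof.
rewrite -(@ler_pXn2r _ 2) ?nnegrE ?l2norm_ge0 ?rnorm_ge0 // l2norm_sqr.
rewrite (bigD1 i) //= lerDl sumr_ge0 // => j _; exact: sqr_ge0.
Qed.

Lemma l2normZ n (v : 'cV[R[i]]_n) k : l2norm (k *: v) = rnorm k * l2norm v.
Proof.
apply/eqP; rewrite -(@eqrXn2 _ 2) ?mulr_ge0 ?l2norm_ge0 ?rnorm_ge0 //.
rewrite exprMn !l2norm_sqr mulr_sumr; apply/eqP/eq_bigr => i _.
by rewrite mxE rnormM exprMn.
Qed.

Lemma l2norm_eq0 n (v : 'cV[R[i]]_n) : l2norm v = 0 -> v = 0.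
Proof.
move=> v0; apply/matrixP => i j; rewrite ord1 mxE; apply: rnorm_eq0.
by apply/eqP; rewrite eq_le rnorm_ge0 -v0 l2norm_entry.
Qed.

Lemma l2norm_le_sum n (v : 'cV[R[i]]_n) : l2norm v <= \sum_i rnorm (v i 0).
Proof.
rewrite -(@ler_pXn2r _ 2) ?nnegrE ?l2norm_ge0 ?sumr_ge0 //; last first.
  by move=> i _; exact: rnorm_ge0.
rewrite l2norm_sqr expr2 mulr_suml; apply: ler_sum => i _.
rewrite expr2 ler_wpM2l ?rnorm_ge0 // (bigD1 i) //= lerDl sumr_ge0 // => j _.
exact: rnorm_ge0.
Qed.

Lemma l2norm_CS n (u v : 'cV[R[i]]_n) :
  rnorm (\sum_i u i 0 * (v i 0)^*) <= l2norm u * l2norm v.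
Proof.
apply: le_trans (ler_rnorm_sum _ _ _) _.
have [u0|u0] := eqVneq (l2norm u) 0.
  rewrite (l2norm_eq0 u0) big1 ?mulr_ge0 ?l2norm_ge0 // => i _.
  by rewrite mxE mul0r rnorm0.
have [v0|v0] := eqVneq (l2norm v) 0.
  rewrite (l2norm_eq0 v0) big1 ?mulr_ge0 ?l2norm_ge0 // => i _.
  by rewrite mxE rmorph0 mulr0 rnorm0.
have up : 0 < l2norm u by rewrite lt0r u0 l2norm_ge0.
have vp : 0 < l2norm v by rewrite lt0r v0 l2norm_ge0.
set a := l2norm u in up *; set b := l2norm v in vp *.
have h i : rnorm (u i 0 * (v i 0)^*) <=
    (b / a / 2) * rnorm (u i 0) ^+ 2 + (a / b / 2) * rnorm (v i 0) ^+ 2.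
  rewrite rnormM rnormC_conj; move: (rnorm _) (rnorm _) => y x.
  have -> : b / a / 2 * x ^+ 2 + a / b / 2 * y ^+ 2 =
     x * y + (b * x - a * y) ^+ 2 / (2 * a * b).
    by field; rewrite !gt_eqF.
  by rewrite lerDl divr_ge0 ?sqr_ge0 // !mulr_ge0 // ltW.
apply: le_trans (ler_sum _ (fun i _ => h i)) _.
rewrite big_split /= -!mulr_sumr -!l2norm_sqr -/a -/b.
have -> : b / a / 2 * a ^+ 2 + a / b / 2 * b ^+ 2 = a * b.
  by field; rewrite !gt_eqF.
by [].
Qed.

Definition ctr m n (a : 'M[R[i]]_(m, n)) : 'M[R[i]]_(n, m) :=
  \matrix_(i, j) (a j i)^*.

Lemma l2norm0 n : l2norm (0 : 'cV[R[i]]_n) = 0.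
Proof. by rewrite /l2norm big1 ?sqrtr0 // => i _; rewrite mxE rnorm0 expr0n. Qed.

Lemma scalar_mxnorm_has_ubound m n (a : 'M[R[i]]_(m, n)) :
  has_ubound [set l2norm (a *m v) | v in [set v | l2norm v <= 1]].
Proof.
exists (\sum_i \sum_j rnorm (a i j)) => _ [w /= w1 <-].
apply: le_trans (l2norm_le_sum _) _; apply: ler_sum => i _.
rewrite mxE; apply: le_trans (ler_rnorm_sum _ _ _) _; apply: ler_sum => j _.
rewrite rnormM -[leRHS]mulr1 ler_wpM2l ?rnorm_ge0 //.
exact: le_trans (l2norm_entry _ _) w1.
Qed.

Lemma scalar_mxnorm_ub m n (a : 'M[R[i]]_(m, n)) v :
  l2norm (a *m v) <= scalar_mxnorm a * l2norm v.
Proof.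
have [v0|v0] := eqVneq (l2norm v) 0.
  by rewrite (l2norm_eq0 v0) mulmx0 !l2norm0 mulr0.
have vp : 0 < l2norm v by rewrite lt0r v0 l2norm_ge0.
rewrite -ler_pdivrMr // mulrC.
have inv : rnorm ((l2norm v)^-1%:C : R[i]) = (l2norm v)^-1.
  by rewrite rnorm_real ger0_norm // invr_ge0 ltW.
rewrite -inv -l2normZ scalemxAr.
apply: ub_le_sup; first exact: scalar_mxnorm_has_ubound.
by exists ((l2norm v)^-1%:C *: v) => //=; rewrite l2normZ inv mulVf.
Qed.

Lemma scalar_mxnorm_ge0 m n (a : 'M[R[i]]_(m, n)) : 0 <= scalar_mxnorm a.
Proof.
apply: ub_le_sup; first exact: scalar_mxnorm_has_ubound.
by exists 0; rewrite /= ?mulmx0 l2norm0.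
Qed.

Lemma scalar_mxnorm_le m n (a : 'M[R[i]]_(m, n)) (s : R) : 0 <= s ->
  (forall v, l2norm (a *m v) <= s * l2norm v) -> scalar_mxnorm a <= s.
Proof.
move=> s0 h; apply: ge_sup.
  by exists (l2norm (a *m 0)); exists 0; rewrite /= ?l2norm0.
by move=> _ [v /= v1 <-]; apply: le_trans (h v) _; rewrite -[leRHS]mulr1 ler_wpM2l.
Qed.

(** From [|a^* u|^2 = (a a^* u, u)] and the Cauchy-Schwarz inequality. *)
Lemma ctr_ub m n (a : 'M[R[i]]_(m, n)) u :
  l2norm (ctr a *m u) <= scalar_mxnorm a * l2norm u.
Proof.
set w := ctr a *m u.
have [->|w0] := eqVneq (l2norm w) 0.
  by rewrite mulr_ge0 ?scalar_mxnorm_ge0 ?l2norm_ge0.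
have wp : 0 < l2norm w by rewrite lt0r w0 l2norm_ge0.
rewrite -(ler_pM2r wp) -expr2.
have e : (l2norm w ^+ 2)%:C = \sum_i (a *m w) i 0 * (u i 0)^*.
  rewrite l2norm_sqr rmorph_sum /=.
  under eq_bigr do rewrite rnormC_sqr {2}/w mxE rmorph_sum mulr_sumr.
  rewrite exchange_big; apply: eq_bigr => i _; rewrite mxE mulr_suml.
  apply: eq_bigr => j _; rewrite mxE rmorphM /= conjCK /w mxE; ring.
have : rnorm ((l2norm w ^+ 2)%:C : R[i]) <= l2norm (a *m w) * l2norm u.
  by rewrite e; exact: l2norm_CS.
rewrite rnorm_real ger0_norm ?sqr_ge0 // => /le_trans; apply.
by rewrite mulrAC ler_wpM2r ?l2norm_ge0 // scalar_mxnorm_ub.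
Qed.

Lemma l2norm_pow_ub n (h : 'M[R[i]]_n) (s : R) N (v : 'cV[R[i]]_n) : 0 <= s ->
  (forall v, l2norm (h *m v) <= s * l2norm v) ->
  l2norm ((h ^+ N : 'M_n) *m v) <= s ^+ N * l2norm v.
Proof.
move=> s0 hs; elim: N => [|N IH]; first by rewrite !expr0 mul1mx mul1r.
rewrite !exprS -mulmxA; apply: le_trans (hs _) _.
by rewrite -mulrA ler_wpM2l.
Qed.

Lemma entry_pow_ub n (h : 'M[R[i]]_n) (s : R) N i j : 0 <= s ->
  (forall v, l2norm (h *m v) <= s * l2norm v) ->
  rnorm ((h ^+ N : 'M_n) i j) <= s ^+ N.
Proof.
move=> s0 hs; have := l2norm_pow_ub N (delta_mx j 0) s0 hs.
have -> : l2norm (delta_mx j 0 : 'cV[R[i]]_n) = 1.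
  rewrite /l2norm (bigD1 j) //= big1 => [|p pj].
    by rewrite mxE !eqxx rnorm1 expr1n addr0 sqrtr1.
  by rewrite mxE (negbTE pj) rnorm0 expr0n.
rewrite mulr1; apply: le_trans; rewrite -colE.
apply: le_trans (l2norm_entry _ i); by rewrite mxE.
Qed.

End ScalarMatrices.

(** * The operator space of multipliers *)

Section MultOpSpace.
Context {R : realType} {C : cstarType R} {I : Type} (i0 : I).
Variable nu : forall n, 'M[C]_n -> R.
Hypothesis Hnu : is_cstar_mxnorm nu.
Local Notation D := (mult C I).
Implicit Types (c d : C) (k : R[i]) (i : I).

(** Entrywise bounds; they hold up to factors that depend on the size only. *)
Definition ebd (a : D) (M : R) := forall i x, rnorm (mfun a i x) <= M * rnorm x.

Lemma ebd_ex a : exists2 M, 0 <= M & ebd a M.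
Proof.
have [M hM] := mult_bdd a; exists `|M| => // i x.
by apply: le_trans (hM i x) _; rewrite ler_wpM2r ?rnorm_ge0 ?ler_norm.
Qed.

Lemma ebd_le a M M' : M <= M' -> ebd a M -> ebd a M'.
Proof.
by move=> h hM i x; apply: le_trans (hM i x) _; rewrite ler_wpM2r ?rnorm_ge0.
Qed.

Lemma ebd_sum (J : Type) (r : seq J) (F : J -> D) (M : J -> R) :
  (forall j, ebd (F j) (M j)) -> ebd (\sum_(j <- r) F j) (\sum_(j <- r) M j).
Proof.
move=> h i x; rewrite sum_mfun mulr_suml; apply: le_trans (ler_rnorm_sum _ _ _) _.
by apply: ler_sum => j _; exact: h.
Qed.

Lemma ebdZ k a M : ebd a M -> ebd (k *: a) (rnorm k * M).
Proof.
by move=> h i x; rewrite mfunZ rnormZ -mulrA ler_wpM2l ?rnorm_ge0.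
Qed.

Lemma act_le_entries n i (a : 'M[D]_n) (M : R) x : 0 <= M ->
  (forall p q z, rnorm (mfun (a p q) i z) <= M * rnorm z) ->
  nu (act i a x) <= n%:R ^+ 3 * M * nu x.
Proof.
move=> M0 h; apply: le_trans (nu_le_sum Hnu _) _.
have hs p q : rnorm (act i a x p q) <= n%:R * (M * nu x).
  rewrite mxE; apply: le_trans (ler_rnorm_sum _ _ _) _.
  apply: le_trans (ler_sum _ (_ : forall j, true -> _ <= M * nu x)) _.
    move=> j _; apply: le_trans (h _ _ _) _; rewrite ler_wpM2l //.
    exact: (nu_entry tt Hnu).
  by rewrite sumr_const card_ord mulr_natl.
apply: le_trans (ler_sum _ (fun p _ => ler_sum _ (fun q _ => hs p q))) _.
rewrite !sumr_const !card_ord -[X in X *+ n <= _]mulr_natl -[X in X <= _]mulr_natl.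
by rewrite le_eqVlt; apply/orP; left; apply/eqP; ring.
Qed.

Definition mu n (a : 'M[D]_n) : R :=
  sup [set r | exists i x, nu x <= 1 /\ r = nu (act i a x)].

Lemma mu_has_ubound n (a : 'M[D]_n) :
  has_ubound [set r | exists i x, nu x <= 1 /\ r = nu (act i a x)].
Proof.
pose M p q := projT1 (cid2 (ebd_ex (a p q))).
have M0 p q : 0 <= M p q by rewrite /M; case: cid2.
have hM p q : ebd (a p q) (M p q) by rewrite /M; case: cid2.
pose K := \sum_p \sum_q M p q.
have K0 : 0 <= K by apply: sumr_ge0 => p _; apply: sumr_ge0.
have hK p q : ebd (a p q) K.
  apply: ebd_le (hM p q); rewrite /K (bigD1 p) //= (bigD1 q) //= -addrA lerDl.
  by rewrite addr_ge0 // sumr_ge0 // => j _; exact: sumr_ge0.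
exists (n%:R ^+ 3 * K) => _ [i [x [x1 ->]]].
apply: le_trans (act_le_entries _ K0 (fun p q => hK p q i)) _.
by rewrite -[leRHS]mulr1 ler_wpM2l // mulr_ge0 // exprn_ge0.
Qed.

Lemma mu_le n (a : 'M[D]_n) (M : R) : 0 <= M ->
  (forall i x, nu (act i a x) <= M * nu x) -> mu a <= M.
Proof.
move=> M0 h; apply: ge_sup.
  exists (nu (act i0 a 0)), i0, 0; split => //.
  by rewrite (nu_0 Hnu).
move=> _ [i [x [x1 ->]]]; apply: le_trans (h _ _) _.
by rewrite -[leRHS]mulr1 ler_wpM2l.
Qed.

Lemma mu_act n i (a : 'M[D]_n) x : nu (act i a x) <= mu a * nu x.
Proof.
have [x0|x0] := eqVneq (nu x) 0.
  have /(nu_def Hnu) -> := x0.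
  rewrite (_ : act i a 0 = 0) ?(nu_0 Hnu) ?mulr0 //.
  apply/matrixP => p q; rewrite !mxE big1 // => j _.
  by rewrite mxE mfun_arg0.
have xp : 0 < nu x by rewrite lt0r x0 (nu_ge0 Hnu).
have inv : rnorm ((nu x)^-1%:C : R[i]) = (nu x)^-1.
  by rewrite rnorm_real ger0_norm // invr_ge0 ltW.
rewrite -ler_pdivrMr // mulrC -inv -(nu_Z Hnu) -act_argZ.
apply: ub_le_sup; first exact: mu_has_ubound.
by exists i, ((nu x)^-1%:C *:: x); rewrite (nu_Z Hnu) inv mulVf.
Qed.

Lemma mu_ge0 n (a : 'M[D]_n) : 0 <= mu a.
Proof.
apply: le_trans (_ : nu (act i0 a 0) <= _); first exact: nu_ge0 Hnu _ _.
apply: ub_le_sup; first exact: mu_has_ubound.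
by exists i0, 0; rewrite (nu_0 Hnu).
Qed.

Lemma mu_D n (a b : 'M[D]_n) : mu (a + b) <= mu a + mu b.
Proof.
apply: mu_le => [|i x]; first by rewrite addr_ge0 ?mu_ge0.
rewrite actD mulrDl; apply: le_trans (nu_D Hnu _ _) _.
by apply: lerD; exact: mu_act.
Qed.

Lemma mu_M n (a b : 'M[D]_n) : mu (a *m b) <= mu a * mu b.
Proof.
apply: mu_le => [|i x]; first by rewrite mulr_ge0 ?mu_ge0.
rewrite actM; apply: le_trans (mu_act _ _ _) _.
by rewrite -mulrA ler_wpM2l ?mu_ge0 // mu_act.
Qed.

Lemma mu_S n (a : 'M[D]_n) : mu a ^+ 2 <= mu (adag a *m a).
Proof.
suff : mu a <= Num.sqrt (mu (adag a *m a)).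
  by rewrite -(@ler_pXn2r _ 2) ?nnegrE ?mu_ge0 ?sqrtr_ge0 // sqr_sqrtr ?mu_ge0.
apply: mu_le => [|i x]; first exact: sqrtr_ge0.
rewrite -(@ler_pXn2r _ 2) ?nnegrE ?mulr_ge0 ?sqrtr_ge0 ?(nu_ge0 Hnu) //.
rewrite exprMn sqr_sqrtr ?mu_ge0 // -(nu_S Hnu) act_dag -actM.
apply: le_trans (nu_M Hnu _ _) _; rewrite (nu_star Hnu) mulrC expr2 mulrA.
by rewrite ler_wpM2r ?(nu_ge0 Hnu) // mu_act.
Qed.

Lemma mu_dag n (a : 'M[D]_n) : mu (adag a) = mu a.
Proof.
suff h (b : 'M[D]_n) : mu b <= mu (adag b).
  by apply/eqP; rewrite eq_le h andbT -{2}(adagK a) h.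
have [->|b0] := eqVneq (mu b) 0; first exact: mu_ge0.
have bp : 0 < mu b by rewrite lt0r b0 mu_ge0.
rewrite -(ler_pM2r bp) -expr2; exact: le_trans (mu_S _) (mu_M _ _).
Qed.

Lemma mu_entry n (a : 'M[D]_n) p q : ebd (a p q) (mu a).
Proof.
move=> i c; have := mu_act i a (cdelta q q c); rewrite (nu_delta Hnu).
apply: le_trans; have <- : act i a (cdelta q q c) p q = mfun (a p q) i c.
  rewrite mxE (bigD1 q) //= big1 => [|j jq]; first by rewrite mxE !eqxx addr0.
  by rewrite mxE (negbTE jq) mfun_arg0.
exact: (nu_entry tt Hnu).
Qed.

Lemma mu_def n (a : 'M[D]_n) : mu a = 0 -> a = 0.
Proof.
move=> a0; apply/matrixP => p q; apply: mfun_inj => i x.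
rewrite mxE mfun0; apply: rnorm_eq0; apply/eqP; rewrite eq_le rnorm_ge0 andbT.
by have := @mu_entry _ a p q i x; rewrite a0 mul0r.
Qed.

Lemma mu_Z n k (a : 'M[D]_n) : mu (k *:: a) = rnorm k * mu a.
Proof.
have h k' (b : 'M[D]_n) : mu (k' *:: b) <= rnorm k' * mu b.
  apply: mu_le => [|i x]; first by rewrite mulr_ge0 ?rnorm_ge0 ?mu_ge0.
  by rewrite actZ (nu_Z Hnu) -mulrA ler_wpM2l ?rnorm_ge0 ?mu_act.
apply/eqP; rewrite eq_le h /=; have [->|k0] := eqVneq k 0.
  by rewrite rnorm0 mul0r mu_ge0.
have kk : rnorm k * rnorm k^-1 = 1 by rewrite -rnormM divff // rnorm1.
have := h k^-1 (k *:: a).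
have -> : k^-1 *:: (k *:: a) = a.
  by apply/matrixP => p q; rewrite !mxE scalerA mulVf // scale1r.
by move=> /(ler_wpM2l (rnorm_ge0 k)); rewrite mulrA kk mul1r.
Qed.

Lemma mu_le_entries n (a : 'M[D]_n) (M : R) : 0 <= M ->
  (forall p q, ebd (a p q) M) -> mu a <= n%:R ^+ 3 * M.
Proof.
move=> M0 h; apply: mu_le => [|i x]; first by rewrite mulr_ge0 ?exprn_ge0.
by apply: act_le_entries => // p q; exact: h.
Qed.

Lemma adag_pow n (h : 'M[D]_n) N : adag h = h -> adag (h ^+ N) = h ^+ N.
Proof.
move=> sh; elim: N => [|N IH]; first by rewrite expr0 adag1.
by rewrite {1}exprSr [LHS]adagM IH sh exprS.
Qed.

Lemma mu_pow n (h : 'M[D]_n) (k : nat) : adag h = h -> mu h ^+ (2 ^ k) <= mu (h ^+ (2 ^ k)).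
Proof.
move=> sh; elim: k => [|k IH]; first by rewrite !expr1.
rewrite expnSr !exprM; apply: le_trans (_ : mu (h ^+ (2 ^ k)) ^+ 2 <= _).
  by rewrite ler_pXn2r ?nnegrE ?exprn_ge0 ?mu_ge0.
by apply: le_trans (mu_S _) _; rewrite adag_pow.
Qed.

(** The spectral radius formula: a crude entrywise bound on the powers of a
    selfadjoint matrix controls its norm, because constants are invisible to
    [2^k]-th roots. *)
Lemma mu_spectral n (h : 'M[D]_n) (K q : R) : adag h = h -> 0 <= K -> 0 <= q ->
  (forall (k : nat) r s, ebd ((h ^+ (2 ^ k) : 'M_n) r s) (K * q ^+ (2 ^ k).-1)) ->
  mu h <= q.
Proof.
move=> sh K0 q0 hK; apply: (@root_le _ _ _ (n%:R ^+ 3 * K)) => //.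
  exact: mu_ge0.
move=> k; apply: le_trans (mu_pow k sh) _; rewrite -mulrA.
by apply: mu_le_entries => //; rewrite mulr_ge0 ?exprn_ge0.
Qed.

Lemma mu_powM n (h g : 'M[D]_n) N : mu (h ^+ N *m g) <= mu h ^+ N * mu g.
Proof.
elim: N => [|N IH]; first by rewrite !expr0 mul1mx mul1r.
rewrite !exprS -mulmxA; apply: le_trans (mu_M _ _) _.
by rewrite -mulrA ler_wpM2l ?mu_ge0.
Qed.

Definition smx m n (a : 'M[R[i]]_(m, n)) : 'M[D]_(m, n) :=
  \matrix_(p, q) (a p q *: (1 : D)).

Lemma smxM m n p (a : 'M[R[i]]_(m, n)) (b : 'M[R[i]]_(n, p)) :
  smx (a *m b) = smx a *m smx b.
Proof.
apply/matrixP => r s; rewrite !mxE scaler_suml; apply: eq_bigr => j _.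
by rewrite !mxE -mult_scalAl mul1r scalerA.
Qed.

Lemma smx1 n : smx (1%:M : 'M_n) = 1%:M.
Proof. by apply/matrixP => r s; rewrite !mxE; case: eqP; rewrite ?scale1r ?scale0r. Qed.

Lemma smx_pow n (a : 'M[R[i]]_n) N : smx (a ^+ N) = smx a ^+ N.
Proof.
elim: N => [|N IH]; first by rewrite !expr0 smx1.
by rewrite !exprS smxM IH.
Qed.

Lemma adag_smx m n (a : 'M[R[i]]_(m, n)) : adag (smx a) = smx (ctr a).
Proof. by apply/matrixP => r s; rewrite !mxE dagZ dag1. Qed.

Lemma scalar_mxmulE m n (a : 'M[R[i]]_(m, n)) (x : 'M[D]_n) b :
  scalar_mxmul a x b = smx a *m x *m smx b.
Proof.
apply/matrixP => r s; rewrite !mxE; under [RHS]eq_bigr do rewrite !mxE mulr_suml.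
rewrite [RHS]exchange_big; apply: eq_bigr => p _; apply: eq_bigr => q _ /=.
by rewrite mxE -mult_scalAl mul1r -mult_scalAr mulr1 scalerA mulrC.
Qed.

Lemma ebd_smx m n (a : 'M[R[i]]_(m, n)) p q (s : R) : rnorm (a p q) <= s ->
  ebd (smx a p q) s.
Proof.
move=> h i x; rewrite mxE mfunZ mfun1 rnormZ.
by rewrite ler_wpM2r ?rnorm_ge0.
Qed.

Lemma ctrK m n (a : 'M[R[i]]_(m, n)) : ctr (ctr a) = a.
Proof. by apply/matrixP => r s; rewrite !mxE conjCK. Qed.

Lemma mu_smx_sa n (h : 'M[R[i]]_n) (s : R) : ctr h = h -> 0 <= s ->
  (forall v, l2norm (h *m v) <= s * l2norm v) -> mu (smx h) <= s.
Proof.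
move=> sh s0 hs; apply: (@mu_spectral _ _ s) => //.
  by rewrite adag_smx sh.
move=> k p q; rewrite -smx_pow -exprS prednK ?expn_gt0 //.
by apply: ebd_smx; exact: entry_pow_ub.
Qed.

Lemma ctrM m n p (a : 'M[R[i]]_(m, n)) (b : 'M[R[i]]_(n, p)) :
  ctr (a *m b) = ctr b *m ctr a.
Proof.
apply/matrixP => r s; rewrite !mxE rmorph_sum; apply: eq_bigr => j _.
by rewrite rmorphM !mxE mulrC.
Qed.

Lemma mu_smx_ctrM m n (a : 'M[R[i]]_(m, n)) :
  mu (smx (ctr a *m a)) <= scalar_mxnorm a ^+ 2.
Proof.
apply: mu_smx_sa; [by rewrite ctrM ctrK|by rewrite sqr_ge0|move=> v].
rewrite -mulmxA; apply: le_trans (ctr_ub _ _) _.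
by rewrite expr2 -mulrA ler_wpM2l ?scalar_mxnorm_ge0 ?scalar_mxnorm_ub.
Qed.

Lemma mu_smx_Mctr m n (a : 'M[R[i]]_(m, n)) :
  mu (smx (a *m ctr a)) <= scalar_mxnorm a ^+ 2.
Proof.
apply: mu_smx_sa; [by rewrite ctrM ctrK|by rewrite sqr_ge0|move=> v].
rewrite -mulmxA; apply: le_trans (scalar_mxnorm_ub _ _) _.
by rewrite expr2 -mulrA ler_wpM2l ?scalar_mxnorm_ge0 ?ctr_ub.
Qed.

Lemma smx_compress_entry m n (b : 'M[R[i]]_(m, n)) (z : 'M[D]_m) (M : R) r s :
  0 <= M -> mu z <= M ->
  ebd ((adag (smx b) *m z *m smx b) r s)
    ((\sum_p \sum_q rnorm (b p r) * rnorm (b q s)) * M).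
Proof.
move=> M0 hz; rewrite adag_smx -scalar_mxmulE mxE mulr_suml.
apply: ebd_sum => p; rewrite mulr_suml; apply: ebd_sum => q.
have -> : rnorm (b p r) * rnorm (b q s) = rnorm (ctr b r p * b q s).
  by rewrite rnormM mxE rnormC_conj.
by apply: ebdZ; apply: ebd_le hz _; exact: mu_entry.
Qed.

(** With [w = a x b], the powers of [w^* w] are [b^* Z^N G b] for square [Z] and
    [G] of the size of [x], with [|Z| <= (|a| |x| |b|)^2].  The outer factors
    cost a constant, which [mu_spectral] ignores; the inner scalar factors
    [a^* a] and [b b^*] are square, and their norms are controlled by their own
    powers ([mu_smx_sa]). *)
Lemma mu_scalar m n (a : 'M[R[i]]_(m, n)) (x : 'M[D]_n) (b : 'M[R[i]]_(n, m)) :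
  mu (scalar_mxmul a x b) <= scalar_mxnorm a * mu x * scalar_mxnorm b.
Proof.
rewrite scalar_mxmulE; set w := _ *m _.
set sa := scalar_mxnorm a; set sb := scalar_mxnorm b.
have sa0 : 0 <= sa by exact: scalar_mxnorm_ge0.
have sb0 : 0 <= sb by exact: scalar_mxnorm_ge0.
rewrite -(@ler_pXn2r _ 2) ?nnegrE ?mulr_ge0 ?mu_ge0 //.
apply: le_trans (mu_S _) _.
pose G := adag x *m smx (ctr a *m a) *m x.
pose Z := G *m smx (b *m ctr b).
have muG : mu G <= sa ^+ 2 * mu x ^+ 2.
  apply: le_trans (mu_M _ _) _; rewrite expr2 mulrA ler_wpM2r ?mu_ge0 //.
  apply: le_trans (mu_M _ _) _; rewrite mu_dag mulrC ler_wpM2r ?mu_ge0 //.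
  exact: mu_smx_ctrM.
have muZ : mu Z <= (sa * mu x * sb) ^+ 2.
  apply: le_trans (mu_M _ _) _; rewrite !exprMn ler_pM ?mu_ge0 //.
  exact: mu_smx_Mctr.
have wE : adag w *m w = adag (smx b) *m G *m smx b.
  by rewrite /w !adagM adag_smx /G smxM !mulmxA adag_smx.
have powE N : (adag w *m w : 'M_m) ^+ N.+1 =
    adag (smx b) *m (Z ^+ N *m G) *m smx b.
  elim: N => [|N IH]; first by rewrite expr1 expr0 mul1mx.
  rewrite [LHS]exprS IH [Z ^+ N.+1]exprS wE /Z smxM -adag_smx.
  by rewrite /GRing.mul /= !mulmxA.
pose K := \sum_r \sum_s \sum_p \sum_q rnorm (b p r) * rnorm (b q s).
have Kb r s : \sum_p \sum_q rnorm (b p r) * rnorm (b q s) <= K.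
  have nn r' s' : 0 <= \sum_p \sum_q rnorm (b p r') * rnorm (b q s').
    by apply: sumr_ge0 => p _; apply: sumr_ge0 => q _; rewrite mulr_ge0 ?rnorm_ge0.
  rewrite /K (bigD1 r) //= (bigD1 s) //= -addrA lerDl addr_ge0 //.
    by apply: sumr_ge0.
  by apply: sumr_ge0 => j _; apply: sumr_ge0.
have K0 : 0 <= K.
  by do 4!(apply: sumr_ge0 => ? _); rewrite mulr_ge0 ?rnorm_ge0.
apply: (@mu_spectral _ _ (K * (sa ^+ 2 * mu x ^+ 2))).
- by rewrite adagM adagK.
- by rewrite mulr_ge0 // mulr_ge0 ?sqr_ge0.
- exact: sqr_ge0.
move=> k r s; rewrite -(@prednK (2 ^ k)) ?expn_gt0 //; move: (2 ^ k).-1 => N /=.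
rewrite powE; apply: ebd_le; last first.
  apply: smx_compress_entry; last first.
    apply: le_trans (mu_powM _ _ _) _.
    apply: le_trans (_ : ((sa * mu x * sb) ^+ 2) ^+ N * (sa ^+ 2 * mu x ^+ 2) <= _).
      apply: ler_pM; rewrite ?exprn_ge0 ?mu_ge0 //.
      by rewrite lerXn2r ?nnegrE ?mu_ge0 ?sqr_ge0.
    exact: lexx.
  by rewrite !mulr_ge0 ?exprn_ge0 ?mulr_ge0 ?mu_ge0.
rewrite [leRHS](_ : _ = K * (((sa * mu x * sb) ^+ 2) ^+ N * (sa ^+ 2 * mu x ^+ 2)));
  last by rewrite -mulrA; congr (_ * _); rewrite mulrC.
apply: ler_wpM2r; last exact: Kb.
by rewrite !mulr_ge0 ?exprn_ge0 ?mulr_ge0 ?mu_ge0.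
Qed.

Lemma block_pow m n (x : 'M[D]_m) (y : 'M[D]_n) N :
  (block_mx x 0 0 y : 'M_(m + n)) ^+ N = block_mx (x ^+ N) 0 0 (y ^+ N).
Proof.
elim: N => [|N IH]; first by rewrite !expr0 -scalar_mx_block.
rewrite !exprS IH [LHS]mulmx_block.
by rewrite !mulmx0 !mul0mx !addr0 !add0r.
Qed.

(** The powers of [w^* w] are block diagonal as well, so their entries are
    bounded by the powers of the larger of the two norms. *)
Lemma mu_block_le m n (x : 'M[D]_m) (y : 'M[D]_n) :
  mu (block_mx x 0 0 y) <= Num.max (mu x) (mu y).
Proof.
set M := Num.max _ _; have M0 : 0 <= M by rewrite le_max mu_ge0.
rewrite -(@ler_pXn2r _ 2) ?nnegrE ?mu_ge0 //; apply: le_trans (mu_S _) _.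
have powle p (z : 'M[D]_p) (k : nat) : mu z <= M ->
    mu ((adag z *m z) ^+ (2 ^ k)) <= M ^+ 2 * (M ^+ 2) ^+ (2 ^ k).-1.
  move=> zM; rewrite -exprS prednK ?expn_gt0 //.
  have := mu_powM (adag z *m z) 1%:M (2 ^ k); rewrite mulmx1 => /le_trans; apply.
  have h1 : mu (1%:M : 'M[D]_p) <= 1.
    by apply: mu_le => // i u; rewrite act1 mul1r.
  rewrite -[leRHS]mulr1; apply: ler_pM; rewrite ?exprn_ge0 ?mu_ge0 //.
  rewrite lerXn2r ?nnegrE ?mu_ge0 ?sqr_ge0 //.
  apply: le_trans (mu_M _ _) _; rewrite mu_dag -expr2.
  by rewrite lerXn2r ?nnegrE ?mu_ge0.
apply: (@mu_spectral _ _ (M ^+ 2)); rewrite ?sqr_ge0 //.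
  by rewrite adagM adagK.
move=> k r s; rewrite adag_block mulmx_block !mulmx0 !mul0mx !addr0 !add0r.
rewrite block_pow.
have px := powle _ x k (_ : mu x <= M); have py := powle _ y k (_ : mu y <= M).
rewrite !le_max !lexx ?orbT in px py.
case: (split_ordP r) => p ->; case: (split_ordP s) => q ->;
  rewrite !(block_mxEul, block_mxEur, block_mxEdl, block_mxEdr).
- by apply: ebd_le (px isT) _; exact: mu_entry.
- by move=> i u; rewrite mxE mfun0 rnorm0 !mulr_ge0 ?exprn_ge0 ?rnorm_ge0.
- by move=> i u; rewrite mxE mfun0 rnorm0 !mulr_ge0 ?exprn_ge0 ?rnorm_ge0.
- by apply: ebd_le (py isT) _; exact: mu_entry.
Qed.

Lemma mu_block m n (x : 'M[D]_m) (y : 'M[D]_n) :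
  mu (block_mx x 0 0 y) = Num.max (mu x) (mu y).
Proof.
apply/eqP; rewrite eq_le mu_block_le ge_max /=.
(* The diagonal blocks are recovered by compression with the coordinate
   isometries. *)
have smx0 p q : smx (0 : 'M_(p, q)) = 0.
  by apply/matrixP => r s; rewrite !mxE scale0r.
have smx_row p q r (u : 'M[R[i]]_(p, q)) (v : 'M_(p, r)) :
    smx (row_mx u v) = row_mx (smx u) (smx v).
  apply/matrixP => s t; rewrite mxE.
  by case: (split_ordP t) => j ->; rewrite !(row_mxEl, row_mxEr) mxE.
have smx_col p q r (u : 'M[R[i]]_(q, p)) (v : 'M_(r, p)) :
    smx (col_mx u v) = col_mx (smx u) (smx v).
  apply/matrixP => s t; rewrite mxE.
  by case: (split_ordP s) => j ->; rewrite !(col_mxEu, col_mxEd) mxE.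
have l2col p q (u : 'cV[R[i]]_p) (v : 'cV_q) :
    l2norm (col_mx u v) ^+ 2 = l2norm u ^+ 2 + l2norm v ^+ 2.
  rewrite !l2norm_sqr big_split_ord; congr (_ + _); apply: eq_bigr => j _.
    by rewrite col_mxEu.
  by rewrite col_mxEd.
have l2z p : l2norm (0 : 'cV[R[i]]_p) = 0 by exact: l2norm0.
have shrink p q (a : 'M[R[i]]_(p, q)) (z : 'M[D]_q) (b : 'M_(q, p)) :
    (forall v, l2norm (a *m v) ^+ 2 <= l2norm v ^+ 2) ->
    (forall v, l2norm (b *m v) ^+ 2 <= l2norm v ^+ 2) ->
    mu (smx a *m z *m smx b) <= mu z.
  move=> ha hb; rewrite -scalar_mxmulE; apply: le_trans (mu_scalar _ _ _) _.
  have a1 : scalar_mxnorm a <= 1.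
    apply: scalar_mxnorm_le => // v; rewrite mul1r.
    by rewrite -(@ler_pXn2r _ 2) ?nnegrE ?l2norm_ge0.
  have b1 : scalar_mxnorm b <= 1.
    apply: scalar_mxnorm_le => // v; rewrite mul1r.
    by rewrite -(@ler_pXn2r _ 2) ?nnegrE ?l2norm_ge0.
  rewrite -[leRHS]mulr1 ler_pM ?mulr_ge0 ?scalar_mxnorm_ge0 ?mu_ge0 //.
  by rewrite -[leRHS]mul1r ler_wpM2r ?mu_ge0.
set w := block_mx _ _ _ _.
have ex : x = smx (row_mx 1%:M 0) *m w *m smx (col_mx 1%:M 0).
  rewrite smx_row smx_col !smx0 !smx1 /w mul_row_block !mul0mx !mul1mx !addr0.
  by rewrite mul_row_col mulmx0 mulmx1 addr0.
have ey : y = smx (row_mx 0 1%:M) *m w *m smx (col_mx 0 1%:M).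
  rewrite smx_row smx_col !smx0 !smx1 /w mul_row_block !mul0mx !mul1mx !add0r.
  by rewrite mul_row_col mulmx0 mulmx1 add0r.
apply/andP; split.
- rewrite {1}ex; apply: shrink => v.
    rewrite -[v]vsubmxK mul_row_col mul1mx mul0mx addr0 l2col lerDl; exact: sqr_ge0.
  by rewrite mul_col_mx mul1mx mul0mx l2col l2z expr0n addr0.
- rewrite {1}ey; apply: shrink => v.
    rewrite -[v]vsubmxK mul_row_col mul1mx mul0mx add0r l2col lerDr; exact: sqr_ge0.
  by rewrite mul_col_mx mul1mx mul0mx l2col l2z expr0n add0r.
Qed.

Lemma mu_is_mxnorm n : is_mxnorm (@mu n).
Proof. by split; [exact: mu_D|exact: mu_Z|exact: mu_def]. Qed.

Definition mult_opspace : opSpaceType R :=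
  HB.pack D (@isOpSpace.Build R D mu mu_is_mxnorm mu_block mu_scalar).

End MultOpSpace.

(** * Limits of families of multipliers and their extension *)

Section Extension.
Context {R : realType} {C : cstarType R} {I : Type} (i0 : I).
Variable nu : forall n, 'M[C]_n -> R.
Hypothesis Hnu : is_cstar_mxnorm nu.
Variable F : set_system I.
Hypothesis FF : ProperFilter F.
Local Notation D := (mult C I).
Implicit Types (c d l : C) (k : R[i]) (y : D).

Definition cvg_mult y l : Prop := forall e : R, 0 < e ->
  F [set i | forall x, rnorm (mfun y i x - l ** x) <= e * rnorm x].

Lemma cvg_mult_lmul c : cvg_mult (lmul c) c.
Proof.
move=> e e0; apply: (@filterS _ F _ setT) => [i _ x|]; last exact: filterT.
by rewrite mfun_lmul subrr rnorm0 mulr_ge0 ?rnorm_ge0 // ltW.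
Qed.

Lemma cvg_mult_uniq y l l' : cvg_mult y l -> cvg_mult y l' -> l = l'.
Proof.
move=> h h'; apply/eqP; rewrite -subr_eq0; apply/eqP.
apply: (can_inj cstarK); rewrite cstar0; apply: cmul_nondeg => x.
rewrite cstarK; apply: (@rnorm_small _ _ _ (2 * rnorm x)) => e e0.
have [i [h1 h2]] := filter_ex (filterI (h e e0) (h' e e0)).
have -> : (l - l') ** x = (mfun y i x - l' ** x) - (mfun y i x - l ** x).
  by rewrite cmulBl; abel.
by have := ler_rnormB (mfun y i x - l' ** x) (mfun y i x - l ** x);
  have := h1 x; have := h2 x; lra.
Qed.

Lemma cvg_mult_lin k y y' l l' : cvg_mult y l -> cvg_mult y' l' ->
  cvg_mult (k *: y + y') (k *: l + l').
Proof.
move=> h h' e e0.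
pose e' := e / (rnorm k + 1).
have kp : 0 < rnorm k + 1 by rewrite ltr_wpDl ?rnorm_ge0.
have e'0 : 0 < e' by rewrite divr_gt0.
apply: filterS (filterI (h e' e'0) (h' e' e'0)) => i [h1 h2] x.
have -> : mfun (k *: y + y') i x - (k *: l + l') ** x =
    k *: (mfun y i x - l ** x) + (mfun y' i x - l' ** x).
  by rewrite mfunD mfunZ cmulDl cmulZl scalerBr; abel.
apply: le_trans (ler_rnormD _ _) _; rewrite rnormZ.
have -> : e * rnorm x = rnorm k * (e' * rnorm x) + e' * rnorm x.
  by rewrite /e'; field; rewrite gt_eqF.
by apply: lerD (h2 x); rewrite ler_wpM2l ?rnorm_ge0.
Qed.

(** The limit is a complete contraction: apply the inequality for [l x] to
    [x = l^*]. *)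
Lemma cvg_mult_norm n (y : 'M[D]_n) (l : 'M[C]_n) :
  (forall p q, cvg_mult (y p q) (l p q)) -> nu l <= mu nu y.
Proof.
move=> h.
have nl x : nu (cmxmul l x) <= mu nu y * nu x.
  apply/ler_addgt0Pr => e e0.
  pose K : R := n%:R ^+ 3 * nu x + 1.
  have Kp : 0 < K by rewrite ltr_wpDl // mulr_ge0 ?exprn_ge0 ?(nu_ge0 Hnu).
  have e'0 : 0 < e / K by rewrite divr_gt0.
  have [i hi] : exists i, forall p q z,
      rnorm (mfun (y p q) i z - l p q ** z) <= e / K * rnorm z.
    apply: (@filter_ex _ F); apply: filter_forall => p; apply: filter_forall => q.
    exact: h.
  have -> : cmxmul l x = act i y x - act i (y - map_mx lmul l) x.
    by rewrite actD actN act_lmul; abel.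
  apply: le_trans (nu_D Hnu _ _) _; rewrite (nu_N Hnu); apply: lerD.
    exact: (mu_act Hnu).
  have hh : forall p q z, rnorm (mfun ((y - map_mx lmul l) p q) i z) <= e / K * rnorm z.
    by move=> p q z; rewrite !mxE mfunD mfunN mfun_lmul; exact: hi.
  have := act_le_entries Hnu x (ltW e'0) hh.
  move/le_trans; apply.
  rewrite (_ : _ * nu x = e * ((K - 1) / K)); last first.
    by rewrite /K; ring.
  by rewrite -[leRHS]mulr1 ler_wpM2l ?(ltW e0) // ler_pdivrMr // mul1r gerBl.
have [->|l0] := eqVneq (nu l) 0; first exact: mu_ge0.
have lp : 0 < nu l by rewrite lt0r l0 (nu_ge0 Hnu).
rewrite -(ler_pM2r lp) -expr2 -{2}(nu_star Hnu) -(nu_star Hnu) -(nu_S Hnu) cmxstarK.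
exact: nl.
Qed.

(** Injectivity extends the limit, without any increase of the cb-norm, from
    the convergent families to all of [mult C I]. *)
Lemma mult_limit_extension : 
  (forall (Y : opSpaceType R) (X : set Y) (u : Y -> C),
      lin_subspace X -> completely_bounded nu X u ->
      exists v : Y -> C,
        [/\ forall x, X x -> v x = u x,
            completely_bounded nu setT v
          & cbnorm nu setT v = cbnorm nu X u]) ->
  exists v : D -> C,
   [/\ forall (k : R[i]) (x y : D), v (k *: x + y) = k *: v x + v y,
       forall y l, cvg_mult y l -> v y = l
     & forall n (y : 'M[D]_n), nu (map_mx v y) <= mu nu y].
Proof.
move=> hinj; pose Y := mult_opspace i0 Hnu.
pose X : set Y := [set y | exists l, cvg_mult y l].
pose u : Y -> C := fun y => get (cvg_mult (y : D)).
have uE (y : D) l : cvg_mult y l -> u y = l.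
  move=> yl; apply: (@cvg_mult_uniq y) => //.
  by apply: (@getPex _ (cvg_mult y)); exists l.
have Xlin : lin_subspace X.
  split; first by exists 0; rewrite -lmul0; exact: cvg_mult_lmul.
  by move=> k x y [l xl] [l' yl]; exists (k *: l + l'); exact: cvg_mult_lin.
have ubd n (x : 'M[Y]_n) : (forall i j, X (x i j)) -> nu (map_mx u x) <= mu nu x.
  move=> Xx; apply: cvg_mult_norm => p q; rewrite mxE.
  by have [l xl] := Xx p q; rewrite (uE _ _ xl).
have ub1 : ubound (cb_values nu X u) 1.
  by move=> _ [n [x [Xx x1 ->]]]; exact: le_trans (ubd _ _ Xx) x1.
have ucb : completely_bounded nu X u.
  split; last by exists 1.
  by move=> k x y [l xl] [l' yl]; rewrite (uE _ _ xl) (uE _ _ yl); apply: uE; exact: cvg_mult_lin.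
have [v [vu [vlin vub] vn]] := hinj Y X u Xlin ucb.
exists v; split.
- by move=> k x y; exact: vlin.
- by move=> y l yl; rewrite vu; [exact: uE|exists l].
have v1 n (y : 'M[Y]_n) : mu nu y <= 1 -> nu (map_mx v y) <= 1.
  move=> y1; apply: (@le_trans _ _ (cbnorm nu setT v)).
    by apply: ub_le_sup => //; exists n, y.
  rewrite vn; apply: ge_sup => //.
  exists (nu (map_mx u (0 : 'M[Y]_0))), 0%N, 0; split => //.
    by move=> [].
  have -> : mxnorm (0 : 'M[Y]_0) = mu nu (0 : 'M[D]_0) by [].
  by apply: mu_le => // i x; rewrite (_ : act i 0 x = 0) ?(nu_0 Hnu) ?mulr_ge0 ?(nu_ge0 Hnu) //; apply/matrixP => -[].
move=> n y.
have vZ k x : v (k *: x) = k *: v x.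
  have v0 : v 0 = 0.
    by have := vlin 1 0 0 Logic.I Logic.I; rewrite scaler0 addr0 scale1r => /eqP; rewrite -subr_eq0 opprD addNKr oppr_eq0 => /eqP.
  by have := vlin k x 0 Logic.I Logic.I; rewrite v0 !addr0.
have [y0|y0] := eqVneq (mu nu y) 0.
  rewrite y0 (mu_def Hnu y0) (_ : map_mx v 0 = 0) ?(nu_0 Hnu) //.
  by apply/matrixP => p q; rewrite !mxE -(scale0r 0) vZ !scale0r.
have yp : 0 < mu nu y by rewrite lt0r y0 (mu_ge0 i0 Hnu).
have inv : rnorm ((mu nu y)^-1%:C : R[i]) = (mu nu y)^-1.
  by rewrite rnorm_real ger0_norm // invr_ge0 ltW.
have := v1 n ((mu nu y)^-1%:C *:: y); rewrite (mu_Z i0 Hnu) inv mulVf // => /(_ (lexx _)).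
have -> : map_mx v ((mu nu y)^-1%:C *:: y) = (mu nu y)^-1%:C *:: map_mx v y.
  by apply/matrixP => p q; rewrite !mxE vZ.
by rewrite (nu_Z Hnu) inv mulrC ler_pdivrMr // mul1r.
Qed.

End Extension.

(** * Module properties of contractive retractions *)

Lemma linear_growth_bound (R : realType) (a K : R) : 0 <= a ->
  (forall n : nat, n%:R * a <= K) -> a = 0.
Proof.
move=> a0 h; apply/eqP; rewrite eq_le a0 andbT leNgt; apply/negP => ap.
have := archi_boundP (_ : 0 <= `|K| / a); rewrite divr_ge0 // => /(_ isT).
move: (Num.bound _) => n; rewrite ltr_pdivrMr // => hn.
have := h n; have := ler_norm K; lra.
Qed.

Section Tomiyama.
Context {R : realType} {C : cstarType R} {I : Type} (i0 : I).
Variable nu : forall n, 'M[C]_n -> R.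
Hypothesis Hnu : is_cstar_mxnorm nu.
Local Notation D := (mult C I).
Implicit Types (c d l : C) (k : R[i]) (y : D).

Definition cc_retraction (v : D -> C) : Prop :=
  [/\ forall k (x y : D), v (k *: x + y) = k *: v x + v y,
      forall c, v (lmul c) = c
    & forall n (y : 'M[D]_n), nu (map_mx v y) <= mu nu y].

(** Entrywise independence of the index [i]; such matrices map the image of
    [C] into itself, by [map_lmulM]. *)
Definition const_mult y : Prop := forall i, mfun y i = mfun y i0.

Section Retraction.
Variable v : D -> C.
Hypothesis Hv : cc_retraction v.

Lemma retr_lin k (x y : D) : v (k *: x + y) = k *: v x + v y.
Proof. by case: Hv. Qed.
Lemma retr_lmul c : v (lmul c) = c. Proof. by case: Hv. Qed.
Lemma retr_D (x y : D) : v (x + y) = v x + v y.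
Proof. by rewrite -[x]scale1r retr_lin !scale1r. Qed.
Lemma retr_0 : v 0 = 0.
Proof. by have := retr_lmul 0; rewrite lmul0. Qed.
Lemma retr_Z k (x : D) : v (k *: x) = k *: v x.
Proof. by rewrite -[k *: x]addr0 retr_lin retr_0 addr0. Qed.
Lemma retr_N (x : D) : v (- x) = - v x.
Proof. by rewrite -scaleN1r retr_Z scaleN1r. Qed.

Definition mx_retr n (y : 'M[D]_n) : 'M[D]_n := map_mx (fun x => lmul (v x)) y.

Lemma mx_retr_norm n (y : 'M[D]_n) : mu nu (mx_retr y) <= mu nu y.
Proof.
have -> : mx_retr y = map_mx lmul (map_mx v y).
  by apply/matrixP => p q; rewrite !mxE.
apply: le_trans (_ : nu (map_mx v y) <= _); last by case: Hv.
apply: (mu_le i0 Hnu) => [|i x]; first exact: nu_ge0.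
by rewrite act_lmul (nu_M Hnu).
Qed.

Lemma mx_retrD n (x y : 'M[D]_n) : mx_retr (x + y) = mx_retr x + mx_retr y.
Proof. by apply/matrixP => p q; rewrite !mxE retr_D lmulD. Qed.

Lemma mx_retrZ n k (x : 'M[D]_n) : mx_retr (k *:: x) = k *:: mx_retr x.
Proof. by apply/matrixP => p q; rewrite !mxE retr_Z lmulZ. Qed.

Lemma mulmx_mxscale n k (x y : 'M[D]_n) : x *m (k *:: y) = k *:: (x *m y).
Proof.
apply/matrixP => p q; rewrite !mxE scaler_sumr; apply: eq_bigr => j _.
by rewrite mxE -mult_scalAr.
Qed.

Lemma mxscale_mulmx n k (x y : 'M[D]_n) : (k *:: x) *m y = k *:: (x *m y).
Proof.
apply/matrixP => p q; rewrite !mxE scaler_sumr; apply: eq_bigr => j _.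
by rewrite mxE -mult_scalAl.
Qed.

(** For a projection [p], put [w = (1 - p) v(p z)].  Then [p z] and [w] have
    orthogonal ranges, so [|p z + t w|^2] grows at most like [t^2 |w|^2],
    whereas contractivity of [v] forces it to grow at least like
    [(1 + t)^2 |w|^2]. *)
Lemma tomiyama_orth n (p z : 'M[D]_n) : adag p = p -> p *m p = p ->
  (forall r s, const_mult (p r s)) ->
  (1%:M - p) *m mx_retr (p *m z) = 0.
Proof.
move=> sp pp cp; set q := 1%:M - p; set w := q *m _.
have sq : adag q = q by rewrite adagD adagN adag1 sp.
have qq : q *m q = q.
  by rewrite /q mulmxBl !mulmxBr mul1mx mulmx1 mul1mx pp; abel.
have pq : p *m q = 0 by rewrite mulmxBr mulmx1 pp subrr.
have qp : q *m p = 0 by rewrite mulmxBl mul1mx pp subrr.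
have cq r s : const_mult (q r s).
  move=> i; apply/funext => x; rewrite !mxE !mfunD !mfunN (cp r s i).
  by case: (_ == _).
have mq : mu nu q <= 1.
  have := mu_S i0 Hnu q; rewrite sq qq.
  by have := mu_ge0 i0 Hnu q; nra.
have rw : mx_retr w = w.
  have wE : w = map_mx lmul (act i0 q (map_mx v (p *m z))).
    rewrite -(map_lmulM (i := i0) _ (fun r s i => cq r s i)).
    by congr (_ *m _); apply/matrixP => r s; rewrite !mxE.
  by rewrite wE; apply/matrixP => r s; rewrite !mxE retr_lmul.
have qw : q *m w = w by rewrite /w mulmxA qq.
have pw : p *m w = 0 by rewrite /w mulmxA pq mul0mx.
have wp : adag w *m p = 0 by rewrite -sp -adagM pw adag0.
apply: (mu_def Hnu); apply/eqP; rewrite -sqrf_eq0; apply/eqP.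
apply: (@linear_growth_bound _ _ (mu nu (adag z *m (p *m z)))).
  exact: sqr_ge0.
move=> t; set K := mu nu (adag z *m _).
have tE : rnorm (t%:R : R[i]) = t%:R by exact: rnorm_nat.
have conj_t : (t%:R : R[i])^* = t%:R by rewrite conjC_nat.
pose u := p *m z + t%:R *:: w.
have uu : adag u *m u = adag z *m (p *m z) + t%:R *:: (t%:R *:: (adag w *m w)).
  have du : adag u = adag z *m p + t%:R *:: adag w.
    rewrite adagD adagM sp; congr (_ + _).
    by apply/matrixP => r s; rewrite !mxE dagZ conj_t.
  rewrite du /u mulmxDl !mulmxDr !mulmx_mxscale !mxscale_mulmx.
  rewrite -[adag z *m p *m w]mulmxA pw mulmx0.
  rewrite [adag w *m (p *m z)]mulmxA wp mul0mx.
  have z0 k : k *:: (0 : 'M[D]_n) = 0.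
    by apply/matrixP => r s; rewrite !mxE scaler0.
  rewrite !z0 addr0 add0r -[adag z *m p *m _]mulmxA (mulmxA p p) pp //.
have up : mu nu u ^+ 2 <= K + t%:R * (t%:R * mu nu w ^+ 2).
  apply: le_trans (mu_S i0 Hnu _) _; rewrite uu.
  apply: le_trans (mu_D i0 Hnu _ _) _; rewrite lerD2l !(mu_Z i0 Hnu) tE.
  rewrite !ler_wpM2l //; apply: le_trans (mu_M i0 Hnu _ _) _.
  by rewrite (mu_dag i0 Hnu) expr2.
have low : (1 + t%:R) * mu nu w <= mu nu u.
  have e : q *m mx_retr u = (1 + t%:R) *:: w.
    rewrite mx_retrD mx_retrZ rw mulmxDr mulmx_mxscale qw -/w.
    by apply/matrixP => r s; rewrite !mxE scalerDl scale1r.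
  have tE1 : rnorm (1 + t%:R : R[i]) = 1 + t%:R.
    by rewrite -[1 in LHS](mulr1n) -natrD rnorm_nat natrD.
  rewrite -tE1 -(mu_Z i0 Hnu) -e.
  apply: le_trans (mu_M i0 Hnu _ _) _; rewrite -[leRHS]mul1r.
  by apply: ler_pM => //; rewrite ?(mu_ge0 i0 Hnu) // mx_retr_norm.
have w0 := mu_ge0 i0 Hnu w; have t0 : 0 <= t%:R :> R by [].
have : ((1 + t%:R) * mu nu w) ^+ 2 <= mu nu u ^+ 2.
  by rewrite lerXn2r ?nnegrE ?mulr_ge0 ?addr_ge0 ?(mu_ge0 i0 Hnu).
have := sqr_ge0 (mu nu w); nra.
Qed.

(** Apply [tomiyama_orth] to [p] and to [1 - p]. *)
Lemma tomiyama n (p z : 'M[D]_n) : adag p = p -> p *m p = p ->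
  (forall r s, const_mult (p r s)) ->
  mx_retr (p *m z) = p *m mx_retr z.
Proof.
move=> sp pp cp.
have h1 := tomiyama_orth z sp pp cp.
have h2 : (1%:M - (1%:M - p)) *m mx_retr ((1%:M - p) *m z) = 0.
  apply: tomiyama_orth.
  - by rewrite adagD adagN adag1 sp.
  - by rewrite mulmxBl !mulmxBr mul1mx mulmx1 mul1mx pp; abel.
  - move=> r s i; apply/funext => x; rewrite !mxE !mfunD !mfunN (cp r s i).
    by case: (_ == _).
have e1 : 1%:M - (1%:M - p) = p by abel.
have zE : z = p *m z + (1%:M - p) *m z by rewrite -mulmxDl addrC subrK mul1mx.
rewrite {2}zE mx_retrD mulmxDr -{4}e1 h2 addr0.
by apply/eqP; rewrite -subr_eq0 -{1}[mx_retr _]mul1mx -mulmxBl h1.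
Qed.

(** The projection [[a; b] [a; b]^*] has [a a^*] in its corner. *)
Lemma retr_corner (a b y : D) : const_mult a -> const_mult b ->
  dag a = a -> dag b = b -> a * a + b * b = 1 ->
  lmul (v (a * a * y)) = a * a * lmul (v y).
Proof.
move=> ca cb sa sb ab.
pose f (i : 'I_2) : D := if i == ord0 then a else b.
pose col : 'M[D]_(2, 1) := \matrix_(i, j) f i.
pose p := col *m adag col.
have pE i j : p i j = f i * f j.
  rewrite mxE big_ord1 !mxE; congr (_ * _).
  by rewrite /f; case: ifP.
have cc : adag col *m col = 1%:M.
  apply/matrixP => i j; rewrite !ord1 !mxE big_ord_recl big_ord1 !mxE /f /=.
  by rewrite sa sb ab.
have cM x x' : const_mult x -> const_mult x' -> const_mult (x * x').
  by move=> h h' i; apply/funext => z; rewrite !mfunM h h'.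
pose z : 'M[D]_2 := \matrix_(i, j) if (i == ord0) && (j == ord0) then y else 0.
have : mx_retr (p *m z) = p *m mx_retr z.
  apply: tomiyama.
  - by rewrite /p adagM adagK.
  - by rewrite /p mulmxA -(mulmxA col) cc mulmx1.
  - by move=> i j; rewrite pE; apply: cM; rewrite /f; case: ifP.
clearbody p; move/matrixP/(_ ord0 ord0); rewrite !mxE !big_ord_recl !big_ord0 !mxE !pE /f /=.
by rewrite !mulr0 !addr0 retr_0 lmul0 mulr0 addr0.
Qed.

End Retraction.
End Tomiyama.

Section SelfadjointSpan.
Context {R : realType} {C : cstarType R}.

Lemma sa_span (P : C -> Prop) :
  (forall (k : R[i]) x y, P x -> P y -> P (k *: x + y)) ->
  (forall x, cstar x = x -> P x) -> forall x, P x.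
Proof.
move=> Plin Psa x.
pose s := x + cstar x; pose t := 'i *: (x - cstar x).
have Ps : P s by apply: Psa; rewrite cstarD cstarK addrC.
have Pt : P t.
  by apply: Psa; rewrite cstarZ conjCi cstarB cstarK scaleNr -scalerN opprB.
have P0 : P 0 by apply: Psa; exact: cstar0.
have -> : x = 2^-1 *: (- 'i *: t + s) + 0.
  have -> : - 'i *: t = x - cstar x.
    by rewrite scalerA mulNr -expr2 sqrCi opprK scale1r.
  rewrite (_ : x - cstar x + s = 2%:R *: x); last first.
    by rewrite /s scaler_nat mulr2n; abel.
  by rewrite scalerA mulVf ?pnatr_eq0 // scale1r addr0.
by apply: (Plin _ _ _ _ P0); exact: Plin.
Qed.

End SelfadjointSpan.

Section Modularity.
Context {R : realType} {C : cstarType R} {I : Type} (i0 : I).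
Variable nu : forall n, 'M[C]_n -> R.
Hypothesis Hnu : is_cstar_mxnorm nu.
Local Notation D := (mult C I).
Implicit Types (c d l : C) (k : R[i]) (y : D).


Lemma lmul_inj : injective (lmul : C -> D).
Proof.
move=> c d h; apply/eqP; rewrite -subr_eq0; apply/eqP.
apply: (can_inj cstarK); rewrite cstar0; apply: cmul_nondeg => x.
have := congr1 (fun a : D => mfun a i0 x) h.
by rewrite cstarK cmulBl !mfun_lmul => ->; rewrite subrr.
Qed.

Section Left.
Variable v : D -> C.
Hypothesis Hv : cc_retraction nu v.

(** The partner [sqrt (1 - z^2)] of a contraction [z] exists among the
    multipliers, even if [C] has no unit. *)
Lemma retr_sqr c y : cstar c = c -> v (lmul (c ** c) * y) = (c ** c) ** v y.
Proof.
move=> sc; have [c0|c0] := eqVneq (rnorm c) 0.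
  by rewrite (rnorm_eq0 c0) !cmul0l lmul0 mul0r (retr_0 Hv).
have cp : 0 < rnorm c by rewrite lt0r c0 rnorm_ge0.
pose r : R[i] := (rnorm c)%:C; pose z := (rnorm c)^-1%:C *: c.
have sz : cstar z = z by rewrite cstarZr sc.
have z1 : rnorm z <= 1.
  by rewrite rnormZ rnorm_real ger0_norm ?invr_ge0 ?rnorm_ge0 // mulVf.
have cz : c = r *: z.
  by rewrite scalerA -rmorphM /= divff // scale1r.
have sx : cstar (z ** z) = z ** z by rewrite cstarM sz.
have x1 : rnorm (z ** z) <= 1.
  by rewrite -{1}sz rnorm_star_sqr exprn_ile1 ?rnorm_ge0.
have [u [su _ hu _]] := cstar_sqrt sx x1.
have zE : v (lmul (z ** z) * y) = (z ** z) ** v y.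
  apply: lmul_inj; rewrite !lmulM.
  apply: (retr_corner Hnu Hv (i0 := i0) (b := 1 - lmul u)) => //.
  - by rewrite dag_lmul sz.
  - exact: (dag_1B_lmul _ su).
  - by rewrite (lmul_sqrt _ hu) -lmulM; abel.
clearbody z; rewrite cz !cmulZl !cmulZr !lmulZ -!mult_scalAl !(retr_Z Hv) zE.
by rewrite !cmulZl.
Qed.

Definition retr_unit := v 1.

(** The image of the identity multiplier fixes all
    squares of selfadjoint elements, hence everything, since
    [(c e - c)^* (c e - c)] only involves [c^2]. *)
Lemma retr_unitr c : c ** retr_unit = c.
Proof.
move: c; apply: sa_span => [k x y hx hy|c sc].
  by rewrite cmulDl cmulZl hx hy.
have h : (c ** c) ** retr_unit = c ** c.
  by rewrite -retr_sqr // mulr1 (retr_lmul Hv).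
apply/eqP; rewrite -subr_eq0; apply/eqP; apply: rnorm_eq0; apply/eqP.
rewrite -sqrf_eq0 -rnorm_star_sqr cstarB cstarM sc cmulBl !cmulBr.
have -> : cstar retr_unit ** c ** (c ** retr_unit) = cstar retr_unit ** c ** c.
  by rewrite -!cmulA (cmulA c c) h.
by rewrite (cmulA c c) h !subrr rnorm0.
Qed.

Lemma retr_unit_sa : cstar retr_unit = retr_unit.
Proof. by rewrite -[LHS]retr_unitr -{2}[retr_unit]cstarK -cstarM retr_unitr cstarK. Qed.

Lemma retr_unitl c : retr_unit ** c = c.
Proof. by apply: (can_inj cstarK); rewrite cstarM retr_unit_sa retr_unitr. Qed.

(** With the unit [e] at hand, [4 c = (e + c)^2 - (e - c)^2] reduces a
    selfadjoint [c] to squares. *)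
Lemma retr_left c y : v (lmul c * y) = c ** v y.
Proof.
move: c; apply: sa_span => [k x z hx hz|c sc].
  by rewrite lmulD lmulZ mulrDl -mult_scalAl (retr_lin Hv) hx hz cmulDl cmulZl.
pose e := retr_unit.
have eE : (e + c) ** (e + c) - (e - c) ** (e - c) = 4%:R *: c.
  rewrite !cmulDl !cmulDr !cmulNl !cmulNr !retr_unitl !retr_unitr.
  by rewrite scaler_nat !mulrS mulr0n; abel.
have : v (lmul (4%:R *: c) * y) = (4%:R *: c) ** v y.
  have h : forall b, cstar b = b -> v (lmul (b ** b) * y) = (b ** b) ** v y.
    by move=> b sb; exact: retr_sqr.
  rewrite -eE lmulB mulrBl (retr_D Hv) (retr_N Hv) [RHS]cmulBl.
  by rewrite !h // cstarD ?cstarN sc retr_unit_sa.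
rewrite lmulZ -mult_scalAl (retr_Z Hv) cmulZl.
by apply: scalerI; rewrite pnatr_eq0.
Qed.

End Left.

(** Conjugation by the involution exchanges left and right modules. *)
Lemma retr_star v : cc_retraction nu v -> cc_retraction nu (fun y => cstar (v (dag y))).
Proof.
move=> Hv; split.
- by move=> k x y; rewrite dagD dagZ (retr_lin Hv) cstarD cstarZ conjCK.
- by move=> c; rewrite dag_lmul (retr_lmul Hv) cstarK.
move=> n y; rewrite -(mu_dag i0 Hnu).
have -> : map_mx (fun y => cstar (v (dag y))) y = cmxstar (map_mx v (adag y)).
  by apply/matrixP => p q; rewrite !mxE.
by rewrite (nu_star Hnu); case: Hv.
Qed.

Lemma retr_right v c y : cc_retraction nu v -> v (y * lmul c) = v y ** c.
Proof.
move=> Hv; have := retr_left (retr_star Hv) (cstar c) (dag y).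
rewrite -dag_lmul -dagM !dagK => /(congr1 cstar).
by rewrite cstarM !cstarK.
Qed.

End Modularity.

(** * Generalized limits in an injective C*-algebra *)

Section GeneralizedLimit.
Context {R : realType} {C : cstarType R}.
Implicit Types (c d l z : C).

Lemma injective_retraction (I : Type) (F : set_system I) : ProperFilter F ->
  injective_cstar C ->
  exists nu (v : mult C I -> C), [/\ is_cstar_mxnorm nu, cc_retraction nu v
    & forall y l, cvg_mult F y l -> v y = l].
Proof.
move=> FF [nu Hnu hinj]; have [i0 _] := filter_ex (filterT : F setT).
have [v [vlin vcvg vcc]] := mult_limit_extension i0 Hnu FF hinj.
exists nu, v; split => //; split => // c.
by apply: vcvg; exact: cvg_mult_lmul.
Qed.

Theorem injective_unital : injective_cstar C ->
  exists e : C, forall c, e ** c = c /\ c ** e = c.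
Proof.
move=> Cinj.
have [nu [v [Hnu Hv _]]] := injective_retraction (principal_filter_proper tt) Cinj.
exists (retr_unit v) => c.
by split; [exact: (retr_unitl tt Hnu Hv)|exact: (retr_unitr tt Hnu Hv)].
Qed.

(** Every bounded family in an injective C*-algebra has a generalized limit
    along a filter, although [C] carries no topology in which bounded sets are
    compact: it commutes with whatever commutes with the family, and it
    multiplies elements as a limit would, whenever that limit exists in
    norm. *)
Theorem injective_generalized_limit (I : Type) (F : set_system I) (s : I -> C) :
  ProperFilter F -> injective_cstar C ->
  (exists M : R, forall i, rnorm (s i) <= M) ->
  exists c, (forall d, (forall i, s i ** d = d ** s i) -> c ** d = d ** c) /\
    (forall z l, (forall e : R, 0 < e -> F [set i | rnorm (s i ** z - l) <= e]) ->
       c ** z = l).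
Proof.
move=> FF Cinj hs; have [i0 _] := filter_ex (filterT : F setT).
have [nu [v [Hnu Hv vcvg]]] := injective_retraction FF Cinj.
pose S : mult C I := lmul_fam hs.
exists (v S); split.
  move=> d hd; rewrite -(retr_right i0 Hnu _ _ Hv) -(retr_left i0 Hnu Hv).
  congr (v _); apply: mfun_inj => i x; rewrite !mfunM !mfun_lmul /=.
  by rewrite !cmulA hd.
move=> z l hz; rewrite -(retr_right i0 Hnu _ _ Hv); apply: vcvg => e e0.
apply: filterS (hz e e0) => i /= hi x; rewrite cmulA -cmulBl.
by apply: le_trans (rnormcM _ _) _; rewrite ler_wpM2r ?rnorm_ge0.
Qed.

End GeneralizedLimit.

(** * Hilbert space *)

Section Hilbert.
Context {R : realType} {H : hilbertType R}.
Implicit Types (x y z : H) (k : R[i]) (r t : R) (T S a g : H -> H).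

Lemma innerDl x y z : inner (x + y) z = inner x z + inner y z.
Proof. by rewrite linearDl. Qed.
Lemma innerDr x y z : inner z (x + y) = inner z x + inner z y.
Proof. by rewrite linearDr. Qed.
Lemma innerZl k x z : inner (k *: x) z = k * inner x z.
Proof. by rewrite linearZl_LR. Qed.
Lemma innerZr k x z : inner z (k *: x) = k^* * inner z x.
Proof. by rewrite linearZr_LR. Qed.
Lemma innerC x y : inner x y = (inner y x)^*.
Proof. by rewrite hermC expr0 mul1r. Qed.

Definition rin x y : R := complex.Re (inner x y).

Lemma ReD (u v : R[i]) : complex.Re (u + v) = complex.Re u + complex.Re v.
Proof. by case: u v => [? ?] [? ?]. Qed.
Lemma Re_conj (u : R[i]) : complex.Re u^* = complex.Re u.
Proof. by case: u. Qed.
Lemma Re_realM r (u : R[i]) : complex.Re (r%:C * u) = r * complex.Re u.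
Proof. by case: u => a b /=; rewrite mul0r subr0. Qed.

Lemma rinDl x y z : rin (x + y) z = rin x z + rin y z.
Proof. by rewrite /rin innerDl ReD. Qed.
Lemma rinZl r x z : rin (r%:C *: x) z = r * rin x z.
Proof. by rewrite /rin innerZl Re_realM. Qed.
Lemma rinC x y : rin x y = rin y x.
Proof. by rewrite /rin innerC Re_conj. Qed.
Lemma rinDr x y z : rin z (x + y) = rin z x + rin z y.
Proof. by rewrite !(rinC z) rinDl. Qed.
Lemma rinZr r x z : rin z (r%:C *: x) = r * rin z x.
Proof. by rewrite !(rinC z) rinZl. Qed.
Lemma rinNl x z : rin (- x) z = - rin x z.
Proof.
have -> : - x = (- 1 : R)%:C *: x by rewrite rmorphN1 scaleN1r.
by rewrite rinZl mulN1r.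
Qed.
Lemma rinNr x z : rin z (- x) = - rin z x.
Proof. by rewrite !(rinC z) rinNl. Qed.
Lemma rin_norm x : rin x x = rnorm x ^+ 2.
Proof. by rewrite /rin -inner_norm normE -rmorphXn. Qed.
Lemma rinBl x y z : rin (x - y) z = rin x z - rin y z.
Proof. by rewrite rinDl rinNl. Qed.
Lemma rin0l x : rin 0 x = 0.
Proof. by rewrite -(subrr 0) rinBl subrr. Qed.

Lemma rnormDsqr x y : rnorm (x + y) ^+ 2 = rnorm x ^+ 2 + 2 * rin x y + rnorm y ^+ 2.
Proof. by rewrite -!rin_norm rinDl !rinDr (rinC y x); ring. Qed.

Lemma rin_CS x y : rin x y <= rnorm x * rnorm y.
Proof.
have [y0|y0] := eqVneq (rnorm y) 0.
  by rewrite (rnorm_eq0 y0) rinC rin0l mulr_ge0 ?rnorm_ge0.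
have yp : 0 < rnorm y by rewrite lt0r y0 rnorm_ge0.
case: (leP (rin x y) 0) => [h|h]; first by rewrite (le_trans h) ?mulr_ge0 ?rnorm_ge0.
rewrite -(@ler_pXn2r _ 2) ?nnegrE ?mulr_ge0 ?rnorm_ge0 ?(ltW h) //.
have := sqr_ge0 (rnorm (x + (- (rin x y / rnorm y ^+ 2))%:C *: y)).
rewrite rnormDsqr rinZr rnormZ rnorm_real exprMn real_normK ?num_real //.
have y2 : 0 < rnorm y ^+ 2 by rewrite exprn_gt0.
set b := rin x y; set N := rnorm y ^+ 2 in y2 *.
have -> : rnorm x ^+ 2 + 2 * (- (b / N) * b) + (- (b / N)) ^+ 2 * N =
   rnorm x ^+ 2 - b ^+ 2 / N by field; rewrite gt_eqF.
by rewrite subr_ge0 ler_pdivrMr // exprMn.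
Qed.

Lemma inner_CS x y : rnorm (inner x y) <= rnorm x * rnorm y.
Proof.
set k := inner x y.
have [k0|k0] := eqVneq (rnorm k) 0; first by rewrite k0 mulr_ge0 ?rnorm_ge0.
have kp : 0 < rnorm k by rewrite lt0r k0 rnorm_ge0.
have := rin_CS (k^* *: x) y.
rewrite /rin innerZl -/k mulrC -rnormC_sqr /= rnormZ rnormC_conj -mulrA.
by rewrite expr2 ler_pM2l.
Qed.

Lemma inner_ext x y : (forall z, inner z x = inner z y) -> x = y.
Proof.
move=> h; apply/eqP; rewrite -subr_eq0; apply/eqP/rnorm_eq0/eqP.
rewrite -sqrf_eq0 -rin_norm /rin innerDr -scaleN1r innerZr h rmorphN1 mulN1r.
by rewrite subrr.
Qed.

(** Real parts suffice: the imaginary part of [(x, y)] is the real part of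
    [(x, i y)]. *)
Lemma rin_ext T S : (forall x y, rin (T x) y = rin x (S y)) ->
  (forall k x, T (k *: x) = k *: T x) -> is_adjoint T S.
Proof.
move=> h TZ x y; apply/eqP; rewrite eq_complex; apply/andP; split; apply/eqP.
  exact: h.
have Im_Re (u : R[i]) : complex.Im u = - complex.Re ('i * u).
  by case: u => a b; rewrite -complexiE /= mul0r mul1r sub0r opprK.
rewrite !Im_Re -!innerZl -TZ; congr (- _); exact: h.
Qed.

End Hilbert.

Section Riesz.
Context {R : realType} {H : hilbertType R}.

(** Riesz representation for a real-linear functional [f] on a real subspace
    [S], measured in a finite power of [H] through [j]: the representing
    vector [w] is the limit of a sequence minimizing [|j x|^2 - 2 f x], so it
    lies in the closure of [j S].  With [S = H] this gives adjoints, and with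
    [f x = (j x, v)] it gives the orthogonal projection of [v]. *)
Lemma riesz_approx (V : lmodType R[i]) (S : set V) n (j : V -> 'I_n -> H)
    (f : V -> R) (B : R) :
  S 0 -> (forall (r : R) x y, S x -> S y -> S (r%:C *: x + y)) ->
  (forall (r : R) x y i, j (r%:C *: x + y) i = r%:C *: j x i + j y i) ->
  (forall (r : R) x y, S x -> S y -> f (r%:C *: x + y) = r * f x + f y) ->
  (forall x, S x -> - B <= (\sum_i rnorm (j x i) ^+ 2) - 2 * f x) ->
  exists w : 'I_n -> H,
    (forall x, S x -> f x = \sum_i rin (j x i) (w i)) /\
    (forall e : R, 0 < e -> exists2 x, S x & forall i, rnorm (j x i - w i) < e).
Proof.
move=> S0 Slin jlin flin fB.
pose nn x := \sum_i rnorm (j x i) ^+ 2.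
pose Q x := nn x - 2 * f x.
pose m := inf [set Q x | x in S].
have hinf : has_inf [set Q x | x in S].
  by split; [exists (Q 0), 0|exists (- B) => _ [x Sx <-]; exact: fB].
have mQ x : S x -> m <= Q x.
  by move=> Sx; apply: inf_lbound; [case: hinf|exists x].
have ex k : exists2 x, S x & Q x < m + k.+1%:R^-1.
  have [_ [x Sx <-] h] : exists2 y, [set Q x | x in S] y & y < m + k.+1%:R^-1.
    by apply: inf_adherent => //; rewrite invr_gt0.
  by exists x.
pose x_ k := projT1 (cid2 (ex k)).
have Sx k : S (x_ k) by rewrite /x_; case: cid2.
have Qx k : Q (x_ k) < m + k.+1%:R^-1 by rewrite /x_; case: cid2.
have expand r x y : nn (r%:C *: x + y) =
    r ^+ 2 * nn x + 2 * r * (\sum_i rin (j x i) (j y i)) + nn y.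
  rewrite /nn !mulr_sumr -!big_split /=; apply: eq_bigr => i _.
  rewrite jlin rnormDsqr rnormZ rnorm_real exprMn real_normK ?num_real // rinZl.
  by ring.
have cau k l : nn (x_ k - x_ l) <= 2 * (k.+1%:R^-1 + l.+1%:R^-1).
  have eB : x_ k - x_ l = (- 1 : R)%:C *: x_ l + x_ k.
    by rewrite rmorphN1 scaleN1r addrC.
  pose h := (2^-1 : R)%:C *: ((1 : R)%:C *: x_ k + x_ l) + 0.
  have Sh : S h by apply: (Slin) => //; exact: Slin.
  have := mQ _ Sh; have := Qx k; have := Qx l.
  rewrite eB expand /Q /h !expand (flin _ _ _ (Slin 1 _ _ (Sx k) (Sx l)) S0) (flin _ _ _ (Sx k) (Sx l)).
  have j0 i : j 0 i = 0.
    by have := jlin 1 0 0 i; rewrite scaler0 addr0 rmorph1 scale1r => /eqP; rewrite -subr_eq0 opprD addNKr oppr_eq0 => /eqP.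
  have nn0 : nn 0 = 0 by rewrite /nn big1 // => i _; rewrite j0 rnorm0 expr0n.
  have s0 (y : V) : \sum_i rin (j y i) (j 0 i) = 0.
    by rewrite big1 // => i _; rewrite j0 rinC rin0l.
  have f0 : f 0 = 0.
    by have := flin 1 0 0 S0 S0; rewrite scaler0 addr0 mul1r; lra.
  have -> : \sum_i rin (j (x_ l) i) (j (x_ k) i) = \sum_i rin (j (x_ k) i) (j (x_ l) i).
    by apply: eq_bigr => i _; rewrite rinC.
  rewrite s0 nn0 f0; set u := \sum_i rin _ _.
  move: (nn (x_ k)) (nn (x_ l)) (f (x_ k)) (f (x_ l)) => p q p' q'.
  have -> : (2^-1 : R) ^+ 2 = 4^-1 by rewrite exprVn -natrX.
  rewrite !mulr0 !addr0 !expr1n sqrrN !expr1n !mul1r; move: (k.+1%:R^-1) (l.+1%:R^-1).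
  by move=> r s; lra.
have le1 (e : R) : 0 < e -> exists N, forall k, (N <= k)%N -> k.+1%:R^-1 < e.
  move=> e0; have := archi_boundP (_ : 0 <= e^-1); rewrite invr_ge0 (ltW e0) => /(_ isT).
  move: (Num.bound _) => N hN; exists N => k Nk.
  rewrite invf_plt ?posrE //; apply: lt_le_trans hN _.
  by rewrite ler_nat (leq_trans Nk).
have jB x y i : j (x - y) i = j x i - j y i.
  have -> : x - y = (- 1 : R)%:C *: y + x by rewrite rmorphN1 scaleN1r addrC.
  by rewrite jlin rmorphN1 scaleN1r addrC.
have wex i : exists w, forall e : R, 0 < e -> exists N, forall k, (N <= k)%N ->
    rnorm (j (x_ k) i - w) < e.
  apply: complete_rnorm => e e0.
  have e4 : 0 < e ^+ 2 / 4 by rewrite divr_gt0 ?exprn_gt0.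
  have [N hN] := le1 _ e4.
  exists N => k l Nk kl; rewrite -jB.
  rewrite -(@ltr_pXn2r _ 2) ?nnegrE ?rnorm_ge0 ?(ltW e0) //.
  apply: le_lt_trans (_ : nn (x_ l - x_ k) < _).
    by rewrite /nn (bigD1 i) //= lerDl sumr_ge0 // => ? _; exact: sqr_ge0.
  apply: le_lt_trans (cau _ _) _.
  move: (hN k Nk) (hN l (leq_trans Nk kl)).
  by move: (k.+1%:R^-1) (l.+1%:R^-1) (e ^+ 2) => r s q; lra.
pose w i := projT1 (cid (wex i)).
have hw i (e : R) : 0 < e -> exists N, forall k, (N <= k)%N -> rnorm (j (x_ k) i - w i) < e.
  by rewrite /w; case: cid => w' hw' e0; exact: hw'.
have hw_all (e : R) : 0 < e -> exists N, forall i k, (N <= k)%N -> rnorm (j (x_ k) i - w i) < e.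
  move=> e0; pose N i := projT1 (cid (hw i e e0)).
  exists (\max_i N i)%N => i k hk.
  have : (N i <= k)%N by apply: leq_trans hk; exact: (leq_bigmax i).
  by rewrite /N; case: cid => N' /= hN'; exact: hN'.
exists w; split; last first.
  by move=> e e0; have [N hN] := hw_all e e0; exists (x_ N) => // i; exact: hN.
move=> y Sy; pose b := \sum_i rin (j y i) (w i).
have key t : 0 <= 2 * t * (b - f y) + t ^+ 2 * nn y.
  pose L := \sum_i rnorm (j y i).
  have L0 : 0 <= L by apply: sumr_ge0 => i _; exact: rnorm_ge0.
  apply/ler_addgt0Pr => e e0.
  pose d := e / 2 / (2 * `|t| * L + 1).
  have d1 : 0 < 2 * `|t| * L + 1 by rewrite ltr_wpDl // !mulr_ge0.
  have d0 : 0 < d by rewrite divr_gt0 // divr_gt0.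
  have [N1 hN1] := hw_all d d0.
  have e2 : 0 < e / 2 by rewrite divr_gt0.
  have [N2 hN2] := le1 _ e2.
  pose k := maxn N1 N2.
  have St : S (t%:C *: y + x_ k) by apply: Slin.
  have := mQ _ St; have := Qx k; have := hN2 k (leq_maxr _ _).
  rewrite /Q expand flin //.
  pose bk := \sum_i rin (j y i) (j (x_ k) i).
  rewrite -/bk.
  have hb : t * (bk - b) <= `|t| * L * d.
    apply: le_trans (_ : `|t| * (L * d) <= _); last by rewrite mulrA.
    apply: le_trans (ler_norm _) _; rewrite normrM ler_wpM2l //.
    rewrite /bk /b -sumrB mulr_suml; apply: le_trans (ler_norm_sum _ _ _) _.
    apply: ler_sum => i _; rewrite -rinNr -rinDr ler_norml -lerNl -rinNr.
    have nb : rnorm (j (x_ k) i - w i) <= d by apply/ltW/hN1; exact: leq_maxl.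
    apply/andP; split.
      apply: le_trans (rin_CS _ _) _; rewrite rnormN.
      by rewrite ler_wpM2l ?rnorm_ge0.
    by apply: le_trans (rin_CS _ _) _; rewrite ler_wpM2l ?rnorm_ge0.
  have hd : 2 * `|t| * L * d <= e / 2.
    rewrite /d [leRHS](_ : _ = (2 * `|t| * L + 1) * (e / 2 / (2 * `|t| * L + 1))).
      by rewrite ler_wpM2r ?(ltW d0) // lerDl.
    by rewrite [RHS]mulrC divfK // gt_eqF.
  move: (nn y) (nn (x_ k)) (f (x_ k)) (f y) => p q p' q'.
  have {}hd : 2 * (`|t| * L * d) <= e / 2 by move: hd; rewrite !mulrA.
  move: (`|t| * L * d) hd hb (k.+1%:R^-1) => s1 hd hb s2 h1 h2 h3.
  by lra.
have [n0|n0] := eqVneq (nn y) 0.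
  have := key (f y - b); have := key (b - f y); rewrite n0 -/b; nra.
have n1 : 0 < nn y by rewrite lt0r n0; apply: sumr_ge0 => i _; exact: sqr_ge0.
have := key (- (b - f y) / nn y); rewrite -/b.
have -> : 2 * (- (b - f y) / nn y) * (b - f y) + (- (b - f y) / nn y) ^+ 2 * nn y =
   - ((b - f y) ^+ 2 / nn y) by field.
rewrite oppr_ge0 pmulr_lle0 ?invr_gt0 // => h.
apply/eqP; rewrite -subr_eq0 -sqrf_eq0 eq_le sqr_ge0 andbT.
by apply: le_trans h; rewrite -sqrrN opprB.
Qed.

End Riesz.

(** * Bounded operators and the bounded transform *)

Section Operators.
Context {R : realType} {H : hilbertType R}.
Implicit Types (x y z : H) (k : R[i]) (r t : R) (T S a g : H -> H).

Lemma linear_D T x y : linear T -> T (x + y) = T x + T y.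
Proof. by move=> h; have := h 1 x y; rewrite !scale1r. Qed.
Lemma linear_0 T : linear T -> T 0 = 0.
Proof.
move=> h; have := linear_D 0 0 h; rewrite addr0 => /eqP.
by rewrite -subr_eq0 opprD addNKr oppr_eq0 => /eqP.
Qed.
Lemma linear_Z T k x : linear T -> T (k *: x) = k *: T x.
Proof. by move=> h; have := h k x 0; rewrite (linear_0 h) !addr0. Qed.
Lemma linear_N T x : linear T -> T (- x) = - T x.
Proof. by move=> h; rewrite -scaleN1r linear_Z // scaleN1r. Qed.
Lemma linear_B T x y : linear T -> T (x - y) = T x - T y.
Proof. by move=> h; rewrite linear_D // linear_N. Qed.

Lemma bounded_opP T : bounded_op T ->
  exists2 M : R, 0 <= M & forall x, rnorm (T x) <= M * rnorm x.
Proof.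
move=> [_ [M hM]]; exists `|M| => // x; apply: le_trans (hM x) _.
by rewrite ler_wpM2r ?rnorm_ge0 ?ler_norm.
Qed.

Lemma opnorm_le T (M : R) : 0 <= M -> (forall x, rnorm (T x) <= M * rnorm x) ->
  opnorm T <= M.
Proof.
move=> M0 h; apply: ge_sup.
  by exists (rnorm (T 0)), 0; rewrite //= rnorm0.
move=> _ [x /= x1 <-]; apply: le_trans (h x) _.
by rewrite -[leRHS]mulr1 ler_wpM2l.
Qed.


Lemma opnorm_ge0 T : bounded_op T -> 0 <= opnorm T.
Proof.
move=> bT; have [M M0 hM] := bounded_opP bT; apply: ub_le_sup.
  exists M => _ [y /= y1 <-]; apply: le_trans (hM y) _.
  by rewrite -[leRHS]mulr1 ler_wpM2l.
by exists 0; rewrite //= ?rnorm0 // (linear_0 bT.1) rnorm0.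
Qed.

Lemma is_adjointC T S : is_adjoint T S -> is_adjoint S T.
Proof. by move=> h x y; rewrite innerC -h -innerC. Qed.

Lemma adjoint_linear T S : is_adjoint T S -> linear S.
Proof.
move=> h k x y; apply: inner_ext => z.
by rewrite -h !innerDr !innerZr !h.
Qed.

Lemma adjoint_bounded T S (M : R) : is_adjoint T S -> 0 <= M ->
  (forall x, rnorm (T x) <= M * rnorm x) -> forall x, rnorm (S x) <= M * rnorm x.
Proof.
move=> h M0 hM x; have [s0|s0] := eqVneq (rnorm (S x)) 0.
  by rewrite s0 mulr_ge0 ?rnorm_ge0.
have sp : 0 < rnorm (S x) by rewrite lt0r s0 rnorm_ge0.
rewrite -(ler_pM2l sp) -expr2 -rin_norm.
have -> : rin (S x) (S x) = rin (T (S x)) x by rewrite /rin h.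
apply: le_trans (rin_CS _ _) _; rewrite mulrA ler_wpM2r ?rnorm_ge0 //.
by rewrite mulrC; apply: le_trans (hM _) _; rewrite mulrC.
Qed.

Lemma adjoint_exists T : bounded_op T -> exists2 S, bounded_op S & is_adjoint T S.
Proof.
move=> bT; have [M M0 hM] := bounded_opP bT; have [linT _] := bT.
have ex y : exists w, forall x, rin (T x) y = rin x w.
  have [|||||w [hw _]] := @riesz_approx R H H setT 1 (fun x _ => x)
    (fun x => rin (T x) y) ((M * rnorm y) ^+ 2) => //.
  - by move=> r x x' _ _; rewrite linT rinDl rinZl.
  - move=> x _; rewrite big_ord1.
    have h1 : rin (T x) y <= M * rnorm x * rnorm y.
      by apply: le_trans (rin_CS _ _) _; rewrite ler_wpM2r ?rnorm_ge0.
    have := sqr_ge0 (rnorm x - M * rnorm y); nra.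
  by exists (w ord0) => x; rewrite hw // big_ord1.
have [S hS] := choice ex.
have TS : is_adjoint T S by apply: rin_ext => // k x; exact: linear_Z.
exists S => //; split; first exact: adjoint_linear TS.
by exists M; exact: adjoint_bounded TS M0 hM.
Qed.


(** [g = a (1 + a^2)^-1], the bounded transform of a selfadjoint [a]. *)
Definition bounded_transform a g : Prop :=
  [/\ linear g, is_adjoint g g, forall x, g (a x) = a (g x)
    & forall x, g x + a (a (g x)) = a x].

(** With [w = (1 + a^2)^-1 x] one has
    [|x|^2 = |w|^2 + 2 |a w|^2 + |a^2 w|^2]. *)
Lemma bounded_transform_contract a g x : linear a -> is_adjoint a a ->
  bounded_transform a g ->
  rnorm (g x) <= rnorm x /\ rnorm (x - a (g x)) <= rnorm x.
Proof.
move=> la sa [lg sg ga gE]; pose w := x - a (g x).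
have aw : a w = g x by rewrite linear_B // -gE addrK.
have xE : x = w + a (a w) by rewrite aw subrK.
have h : rnorm x ^+ 2 = rnorm w ^+ 2 + 2 * rnorm (a w) ^+ 2 + rnorm (a (a w)) ^+ 2.
  by rewrite {1}xE rnormDsqr -[rnorm (a w) ^+ 2]rin_norm /rin sa.
have := sqr_ge0 (rnorm w); have := sqr_ge0 (rnorm (a w)).
have := sqr_ge0 (rnorm (a (a w))) => h1 h2 h3.
rewrite -/w -aw; split; rewrite -(@ler_pXn2r _ 2) ?nnegrE ?rnorm_ge0 //; lra.
Qed.

Lemma exprn_small (q : R) : 0 <= q -> q < 1 -> forall e, 0 < e ->
  exists N, forall n, (N <= n)%N -> q ^+ n < e.
Proof.
move=> q0 q1 e e0.
have q1' : `|q| < 1 by rewrite ger0_norm.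
have [N _ hN] := (cvgrPdist_lt (F := \oo) _ _).1 (cvg_expr q1') e e0.
exists N => n Nn; have := hN n Nn.
by rewrite /= sub0r normrN ger0_norm // exprn_ge0.
Qed.

Section Construction.
Variables (a : H -> H) (M : R).
Hypotheses (la : linear a) (sa : is_adjoint a a) (M0 : 0 <= M)
  (aM : forall x, rnorm (a x) <= M * rnorm x).

Let t : R := M ^+ 2.
Let s : R := (1 + t)^-1.
Let q : R := s * t.

(* The equation [g + a^2 g = a] as the fixed point equation
   [(1 + t) g = a + (t - a^2) g]; the right-hand side is [t]-Lipschitz in [g]
   as soon as [|a|^2 <= 2 t]. *)
Let step g : H -> H := s%:C *: (a + t%:C *: g - (a \o (a \o g))).
Let g_ n := iter n step 0.

Let t0 : 0 <= t. Proof. exact: sqr_ge0. Qed.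
Let s0 : 0 < s. Proof. by rewrite invr_gt0 ltr_wpDr. Qed.
Let q0 : 0 <= q. Proof. by rewrite mulr_ge0 // ltW. Qed.
Let q1 : q < 1.
Proof. by rewrite /q /s mulrC ltr_pdivrMr ?ltr_wpDr // mul1r ltrDr. Qed.

Let gS n x : g_ n.+1 x = s%:C *: (a x + t%:C *: g_ n x - a (a (g_ n x))).
Proof. exact: erefl. Qed.

Let shift_bound v : rnorm (t%:C *: v - a (a v)) <= t * rnorm v.
Proof.
rewrite -(@ler_pXn2r _ 2) ?nnegrE ?mulr_ge0 ?rnorm_ge0 //.
rewrite rnormDsqr rinNr rnormN rinZl rnormZ rnorm_real (ger0_norm t0).
have -> : rin v (a (a v)) = rnorm (a v) ^+ 2 by rewrite -rin_norm /rin sa.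
have h : rnorm (a (a v)) ^+ 2 <= t * rnorm (a v) ^+ 2.
  by rewrite -exprMn lerXn2r ?nnegrE ?mulr_ge0 ?rnorm_ge0.
have := mulr_ge0 t0 (sqr_ge0 (rnorm (a v))); rewrite exprMn; lra.
Qed.

Let s_abs : rnorm (s%:C : R[i]) = s.
Proof. by rewrite rnorm_real ger0_norm // ltW. Qed.

Let g_bd n x : rnorm (g_ n x) <= M * rnorm x.
Proof.
elim: n => [|n IH]; first by rewrite rnorm0 mulr_ge0 ?rnorm_ge0.
rewrite gS rnormZ s_abs -addrA.
have h1 := ler_rnormD (a x) (t%:C *: g_ n x - a (a (g_ n x))).
have h2 := shift_bound (g_ n x).
have h3 := aM x.
have h4 : t * rnorm (g_ n x) <= t * (M * rnorm x) by rewrite ler_wpM2l.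
rewrite -ler_pdivlMl // /s invrK; lra.
Qed.

Let g_cau (m k : nat) x : rnorm (g_ (m + k)%N x - g_ m x) <= q ^+ m * (M * rnorm x).
Proof.
elim: m => [|m IH]; first by rewrite expr0 mul1r subr0; exact: g_bd.
rewrite addSn !gS -scalerBr rnormZ s_abs exprS -(mulrA q) {1}/q -(mulrA s t) ler_pM2l //.
have -> : a x + t%:C *: g_ (m + k)%N x - a (a (g_ (m + k)%N x)) -
  (a x + t%:C *: g_ m x - a (a (g_ m x))) =
  t%:C *: (g_ (m + k)%N x - g_ m x) - a (a (g_ (m + k)%N x - g_ m x)).
  by rewrite !(linear_B _ _ la) scalerBr; abel.
apply: le_trans (shift_bound _) _; apply: ler_wpM2l; [exact: t0|exact: IH].
Qed.

Let g_lin n : linear (g_ n).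
Proof.
elim: n => [|n IH] k x y; first by rewrite /= scaler0 addr0.
have sw (u : R[i]) (z : H) : u *: (k *: z) = k *: (u *: z).
  by rewrite !scalerA mulrC.
rewrite !gS IH !(linear_D _ _ la) !(linear_Z _ _ la).
have -> : k *: a x + a y + t%:C *: (k *: g_ n x + g_ n y) -
    (k *: a (a (g_ n x)) + a (a (g_ n y))) =
  k *: (a x + t%:C *: g_ n x - a (a (g_ n x))) +
    (a y + t%:C *: g_ n y - a (a (g_ n y))).
  by rewrite scalerBr !scalerDr sw; abel.
by rewrite scalerDr sw.
Qed.

Let g_comm n x : g_ n (a x) = a (g_ n x).
Proof.
elim: n => [|n IH]; first by rewrite /= linear_0.
by rewrite !gS IH (linear_Z _ _ la) (linear_B _ _ la) (linear_D _ _ la) (linear_Z _ _ la).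
Qed.

Let g_sa n : is_adjoint (g_ n) (g_ n).
Proof.
elim: n => [|n IH] x y; first by rewrite /= !linear0l linear0r.
have cr (r : R) : (r%:C)^* = r%:C by rewrite (CrealP _) // complex_real.
rewrite !gS innerZl innerZr cr; congr (_ * _).
rewrite !innerDl !innerDr innerZl innerZr cr sa IH; congr (_ + _).
by rewrite linearNl linearNr /= !sa -!g_comm IH.
Qed.

Let lim_ex x : exists l, forall n, rnorm (g_ n x - l) <= q ^+ n * (M * rnorm x).
Proof.
have [|l hl] := complete_rnorm (u := fun n => g_ n x).
  move=> e e0.
  have K0 : 0 < M * rnorm x + 1 by rewrite ltr_wpDl // mulr_ge0 ?rnorm_ge0.
  have [N hN] := exprn_small q0 q1 (divr_gt0 e0 K0).
  exists N => m n Nm mn; rewrite -(subnKC mn).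
  apply: le_lt_trans (g_cau _ _ _) _.
  have := hN m Nm; rewrite ltr_pdivlMr //; apply: le_lt_trans.
  by rewrite ler_wpM2l ?exprn_ge0 // lerDl.
exists l => n; apply/ler_addgt0Pr => e e0.
have [N hN] := hl e e0.
have -> : g_ n x - l = (g_ (n + N)%N x - l) - (g_ (n + N)%N x - g_ n x) by abel.
apply: le_trans (ler_rnormB _ _) _; rewrite addrC lerD ?g_cau //.
by apply/ltW/hN; exact: leq_addl.
Qed.

(** The iterates are polynomials in [a] without constant term, so they stay in
    any algebra that contains [a], whether or not it is unital. *)
Lemma bounded_transform_exists : exists g, [/\ bounded_transform a g, bounded_op g
  & forall A, cstar_subalgebra A -> A a -> A g].
Proof.
have [g hg] := choice lim_ex.
have small (z : H) (K : R) : (forall n, rnorm z <= K * q ^+ n) -> z = 0.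
  move=> hz; apply: (@rnorm_small _ _ _ `|K|) => e e0.
  have [N hN] := exprn_small q0 q1 e0.
  apply: le_trans (hz N) _; apply: le_trans (_ : `|K| * q ^+ N <= _).
    by rewrite ler_wpM2r ?exprn_ge0 ?ler_norm.
  by rewrite ler_wpM2l // ltW // hN.
have gn x n : rnorm (g x - g_ n x) <= M * rnorm x * q ^+ n.
  by rewrite rnormBC mulrC.
have glin : linear g.
  move=> k x y; apply/eqP; rewrite -subr_eq0; apply/eqP.
  apply: (small _ (M * rnorm (k *: x + y) + (rnorm k * (M * rnorm x) + M * rnorm y))) => n.
  have -> : g (k *: x + y) - (k *: g x + g y) =
     (g (k *: x + y) - g_ n (k *: x + y)) - (k *: (g x - g_ n x) + (g y - g_ n y)).
    by rewrite g_lin scalerBr; abel.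
  apply: le_trans (ler_rnormB _ _) _; rewrite mulrDl lerD ?gn //.
  apply: le_trans (ler_rnormD _ _) _; rewrite mulrDl lerD ?gn //.
  by rewrite rnormZ -mulrA ler_wpM2l ?rnorm_ge0.
have gbd x : rnorm (g x) <= M * rnorm x.
  have := hg x 0%N; rewrite expr0 mul1r.
  by rewrite (_ : g_ 0 x = 0) // sub0r rnormN.
have gcomm x : g (a x) = a (g x).
  apply/eqP; rewrite -subr_eq0; apply/eqP.
  apply: (small _ (M * rnorm (a x) + M * (M * rnorm x))) => n.
  have -> : g (a x) - a (g x) = (g (a x) - g_ n (a x)) - a (g x - g_ n x).
    by rewrite (linear_B _ _ la) g_comm; abel.
  apply: le_trans (ler_rnormB _ _) _; rewrite mulrDl lerD ?gn //.
  by apply: le_trans (aM _) _; rewrite -mulrA ler_wpM2l.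
have geq x : g x + a (a (g x)) = a x.
  apply/eqP; rewrite -subr_eq0; apply/eqP.
  apply: (small _ ((1 + t) * (M * rnorm x) + M * (M * (M * rnorm x))
     + t * (M * rnorm x))) => n.
  have -> : g x + a (a (g x)) - a x =
     (1 + t)%:C *: (g x - g_ n.+1 x) + a (a (g x - g_ n x))
     - t%:C *: (g x - g_ n x).
    rewrite gS (scalerBr (1 + t)%:C) (scalerBr t%:C) scalerA -rmorphM /= /s divff; last by rewrite gt_eqF // ltr_wpDr.
    by rewrite rmorph1 scale1r !(linear_B _ _ la) rmorphD scalerDl rmorph1 scale1r; abel.
  apply: le_trans (ler_rnormB _ _) _; rewrite [leRHS]mulrDl; apply: lerD; last first.
    by rewrite rnormZ rnorm_real ger0_norm // -(mulrA t) ler_wpM2l.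
  apply: le_trans (ler_rnormD _ _) _; rewrite mulrDl; apply: lerD; last first.
    apply: le_trans (aM _) _; rewrite -(mulrA M) ler_wpM2l //.
    by apply: le_trans (aM _) _; rewrite -(mulrA M) ler_wpM2l.
  have t1 : 0 <= 1 + t by rewrite addr_ge0.
  rewrite rnormZ rnorm_real ger0_norm // -(mulrA (1 + t)) ler_wpM2l //.
  apply: le_trans (gn _ _) _; rewrite ler_wpM2l ?mulr_ge0 ?rnorm_ge0 //.
  by rewrite exprS -[leRHS]mul1r ler_wpM2r ?exprn_ge0 // ltW.
have gsa : is_adjoint g g.
  apply: rin_ext => [x y|k x]; last exact: linear_Z.
  apply/eqP; rewrite -subr_eq0; apply/eqP.
  have r0 (r : R) (K : R) : 0 <= K -> (forall n, `|r| <= K * q ^+ n) -> r = 0.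
    move=> K0 hr; apply/eqP; rewrite -normr_le0; apply/ler_addgt0Pl => e e0.
    rewrite addr0; have Kp : 0 < K + 1 by rewrite ltr_wpDl.
    have [N hN] := exprn_small q0 q1 (divr_gt0 e0 Kp).
    apply: le_trans (hr N) _; have := hN N (leqnn _); rewrite ltr_pdivlMr //.
    by have := exprn_ge0 N q0; nra.
  apply: (r0 _ (M * rnorm x * rnorm y + rnorm x * (M * rnorm y))) => [|n].
    by rewrite addr_ge0 ?mulr_ge0 ?rnorm_ge0.
  have -> : rin (g x) y - rin x (g y) = rin (g x - g_ n x) y - rin x (g y - g_ n y).
    have e : rin (g_ n x) y = rin x (g_ n y) by rewrite /rin g_sa.
    by rewrite rinBl rinDr rinNr e; ring.
  have absr (u v : H) : `|rin u v| <= rnorm u * rnorm v.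
    by rewrite ler_norml lerNl -rinNl -{1}(rnormN u) !rin_CS.
  apply: le_trans (ler_normB _ _) _; rewrite mulrDl; apply: lerD.
    apply: le_trans (absr _ _) _; rewrite mulrAC ler_wpM2r ?rnorm_ge0 //.
  apply: le_trans (absr _ _) _; rewrite -mulrA ler_wpM2l ?rnorm_ge0 //.
exists g; split; first by split.
  by split => //; exists M.
move=> A [[Ab [A0 Alin] AM _] Acl] Aa; apply: Acl.
  by split => //; exists M.
have An n : A (g_ n).
  elim: n => [//|n IH].
  have -> : g_ n.+1 = s%:C *: (t%:C *: g_ n + ((- 1) *: ((a \o (a \o g_ n)) : H -> H) + a)) + 0.
    apply/funext => x; rewrite gS.
    rewrite -[RHS]/(s%:C *: (t%:C *: g_ n x + (-1 *: a (a (g_ n x)) + a x)) + 0).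
    by rewrite addr0 scaleN1r; congr (_ *: _); abel.
  apply: (Alin) => //; apply: (Alin) => //; apply: (Alin) => //.
  by apply: (AM) => //; exact: AM.
move=> e e0; have M1 : 0 < M + 1 by rewrite ltr_wpDl.
have [N hN] := exprn_small q0 q1 (divr_gt0 e0 M1).
exists (g_ N) => //.
have qM : 0 <= M * q ^+ N by rewrite mulr_ge0 ?exprn_ge0.
apply: le_lt_trans (opnorm_le qM _) _.
  by move=> x; rewrite /= mulrAC; exact: gn.
have := hN N (leqnn _); rewrite ltr_pdivlMr //; apply: le_lt_trans.
by rewrite mulrC ler_wpM2l ?exprn_ge0 // lerDl.
Qed.

End Construction.

(** The identity behind the strong continuity of the bounded transform:
    [g - b = r (a - k) rho + g (k - a) k rho] with contractions
    [r = (1 + a^2)^-1] and [g], where [rho = (1 + k^2)^-1] and [b = k rho]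
    do not depend on [a]. *)
Lemma bounded_transform_dist (a g k b : H -> H) x :
  linear a -> is_adjoint a a -> bounded_transform a g ->
  linear k -> is_adjoint k k -> bounded_transform k b ->
  rnorm (g x - b x) <= rnorm (a (x - k (b x)) - k (x - k (b x)))
                       + rnorm (a (b x) - k (b x)).
Proof.
move=> la sa btg lk sk btb.
have [lg sg ga gE] := btg; have [lb sb bk bE] := btb.
set rho := x - k (b x).
have krho : k rho = b x by rewrite (linear_B _ _ lk) -bE addrK.
have xE : x = rho + k (b x) by rewrite subrK.
pose r y := y - a (g y).
have ra y : r (a y) = g y by rewrite /r ga -gE addrK.
have rD y z : r (y + z) = r y + r z.
  by rewrite /r (linear_D _ _ lg) (linear_D _ _ la); abel.
have rN y : r (- y) = - r y.
  by rewrite /r (linear_N _ lg) (linear_N _ la); abel.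
have rinv y : r y + g (a y) = y by rewrite /r ga; abel.
have -> : g x - b x = r (a rho - k rho) - g (a (b x) - k (b x)).
  rewrite rD rN ra krho {1}xE (linear_D _ _ lg) (linear_B _ _ lg).
  by rewrite -[X in _ - X = _]rinv; abel.
apply: le_trans (ler_rnormB _ _) _; apply: lerD.
  by have [] := bounded_transform_contract (a rho - k rho) la sa btg.
by have [] := bounded_transform_contract (a (b x) - k (b x)) la sa btg.
Qed.

End Operators.

(** * Weak closure and strong approximation *)

Section WeakClosure.
Context {R : realType} {H : hilbertType R}.
Implicit Types (A : set (H -> H)).

(** The weak closure of a subspace, described by the finite-rank functionals that
    vanish on it. *)
Definition weakly_adherent A (k : H -> H) : Prop :=
  forall l : seq (H * H),
    (forall a, A a -> \sum_(p <- l) inner (a p.1) p.2 = 0) ->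
    \sum_(p <- l) inner (k p.1) p.2 = 0.

Lemma wot_closure_adherent A T : closure (A : set (wot H)) T -> weakly_adherent A T.
Proof.
move=> clT l hA.
have ct p : continuous (fun S : wot H => inner (S p.1) p.2 : R[i]^o).
  move=> S; apply: (@continuous_comp (wot H) {ptws (H * H)%type -> R[i]^o} R[i]^o
    (fun S p => inner (S p.1) p.2) (fun h => h p)).
    exact: initial_continuous.
  exact: proj_continuous.
pose NB : set_system (wot H) := nbhs (T : wot H).
have FT : Filter NB by exact: nbhs_filter.
have nb (e : R) : 0 < e -> NB [set S : wot H | forall p, p \in l ->
    rnorm (inner (T p.1) p.2 - inner (S p.1) p.2) < e].
  move=> e0; have eC : 0 < e%:C by rewrite ltcR.
  elim: l {hA} => [|p l IH]; first by exact: (@filterS _ _ FT setT _ _ (@filterT _ _ FT)).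
  have hp : NB [set S | `|(inner (T p.1) p.2 : R[i]^o) - inner (S p.1) p.2| < e%:C].
    exact: (cvgrPdist_lt (F := NB) _ _).1 (ct p T) _ eC.
  apply: (@filterS _ _ FT _ _ _ (@filterI _ _ FT _ _ hp IH)) => S [h1 h2] q.
  rewrite inE => /orP[/eqP ->|]; last exact: h2.
  by move: h1; rewrite /= normE ltcR.
apply: (@rnorm_small _ _ _ (size l)%:R) => e /nb nbT.
have [a [Aa ha]] := clT _ nbT.
rewrite (_ : \sum_(p <- l) inner (T p.1) p.2 =
  \sum_(p <- l) (inner (T p.1) p.2 - inner (a p.1) p.2)); last by rewrite sumrB (hA a Aa) subr0.
have -> : (size l)%:R * e = \sum_(p <- l) e.
  by rewrite big_const_seq count_predT iter_addr_0 mulr_natl.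
apply: le_trans (ler_rnorm_sum _ _ _) _; rewrite big_seq [leRHS]big_seq.
by apply: ler_sum => p pl; apply/ltW/ha.
Qed.

Lemma weakly_adherent_lin A (c : R[i]) S T : weakly_adherent A S ->
  weakly_adherent A T -> weakly_adherent A (c *: S + T).
Proof.
move=> hS hT l hl.
have -> : \sum_(p <- l) inner ((c *: S + T) p.1) p.2 =
  c * (\sum_(p <- l) inner (S p.1) p.2) + \sum_(p <- l) inner (T p.1) p.2.
  rewrite mulr_sumr -big_split; apply: eq_bigr => p _.
  by rewrite -[LHS]/(inner (c *: S p.1 + T p.1) p.2) innerDl innerZl.
by rewrite (hS _ hl) (hT _ hl) mulr0 addr0.
Qed.

Lemma weakly_adherent_adj A S T : star_subalgebra A -> is_adjoint T S ->
  weakly_adherent A T -> weakly_adherent A S.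
Proof.
move=> [_ _ _ Astar] TS hT l hl.
have swapE (U V : H -> H) : is_adjoint U V ->
  \sum_(p <- l) inner (V p.1) p.2 =
  (\sum_(p <- [seq (p.2, p.1) | p <- l]) inner (U p.1) p.2)^*.
  move=> UV; rewrite big_map rmorph_sum; apply: eq_bigr => p _ /=.
  by rewrite UV -innerC.
rewrite (swapE _ _ TS) hT ?rmorph0 // => a /Astar[b Ab ab].
by apply: (can_inj conjCK); rewrite -(swapE _ _ ab) rmorph0 hl.
Qed.

(** Weak and strong closures of a convex set coincide.  Let [w] be the
    orthogonal projection of the vector of all [k x] onto the closure of the
    real subspace formed by the vectors of all [a x], with [a] selfadjoint in
    [A].  The residual [u] defines the functional [Re (a x, u)] that vanishes on
    these [a].  Symmetrized as [(a x, u) + (a u, x)] it is complex linear and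
    vanishes on all of [A], hence at [k]; so [|u|^2 = Re (k x - w, u) = 0]. *)
Lemma strong_approx A (k : H -> H) (s : seq H) (e : R) :
  star_subalgebra A -> is_adjoint k k -> weakly_adherent A k -> 0 < e ->
  exists a, [/\ A a, is_adjoint a a
    & forall x, x \in s -> rnorm (a x - k x) < e].
Proof.
move=> [Ab [A0 Alin] _ Astar] sk wk e0.
pose n := size s; pose xi (i : 'I_n) := nth 0 s i.
pose S := [set a : H -> H | A a /\ is_adjoint a a].
pose j (a : H -> H) (i : 'I_n) := a (xi i).
pose f (a : H -> H) : R := \sum_i rin (a (xi i)) (k (xi i)).
have conjR (r : R) : (r%:C : R[i])^* = r%:C.
  by rewrite (CrealP _) // complex_real.
have adjlin (c : R[i]) (a b a' b' : H -> H) : is_adjoint a a' -> is_adjoint b b' ->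
    is_adjoint (c *: a + b) (c^* *: a' + b').
  move=> ha hb x y; rewrite -[(c *: a + b) x]/(c *: a x + b x).
  rewrite -[(c^* *: a' + b') y]/(c^* *: a' y + b' y).
  by rewrite innerDl innerZl innerDr innerZr conjCK ha hb.
have S0 : S 0.
  split; first exact: A0.
  by move=> x y; rewrite /= linear0l linear0r.
have Slin (r : R) x y : S x -> S y -> S (r%:C *: x + y).
  move=> [Ax sx] [Ay sy]; split; first exact: Alin.
  by have := adjlin r%:C _ _ _ _ sx sy; rewrite conjR.
have [||w [fw wS]] := @riesz_approx R H (H -> H) S n j f
    (\sum_i rnorm (k (xi i)) ^+ 2) S0 Slin (fun _ _ _ _ => erefl).
- move=> r x y _ _; rewrite /f mulr_sumr -big_split; apply: eq_bigr => i _.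
  by rewrite -[LHS]/(rin (r%:C *: x (xi i) + y (xi i)) _) rinDl rinZl.
- move=> x _; rewrite -subr_ge0 opprK mulr_sumr -sumrB -big_split.
  apply: sumr_ge0 => i _ /=.
  have := sqr_ge0 (rnorm (x (xi i) - k (xi i))).
  by rewrite rnormDsqr rinNr rnormN /j; lra.
pose u i := k (xi i) - w i.
have au a : S a -> \sum_i rin (a (xi i)) (u i) = 0.
  move=> Sa; under eq_bigr do rewrite /u rinDr rinNr.
  by rewrite sumrB -/(f a) (fw _ Sa) subrr.
have wu : \sum_i rin (w i) (u i) = 0.
  apply/eqP; rewrite -normr_le0; apply/ler_addgt0Pl => d d0; rewrite addr0.
  pose L := \sum_i rnorm (u i) + 1.
  have L0 : 0 < L by rewrite ltr_wpDl // sumr_ge0 // => i _; exact: rnorm_ge0.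
  have [a Sa ha] := wS _ (divr_gt0 d0 L0).
  have -> : \sum_i rin (w i) (u i) = \sum_i rin (w i - a (xi i)) (u i).
    under [RHS]eq_bigr do rewrite rinBl.
    by rewrite sumrB (au _ Sa) subr0.
  apply: le_trans (ler_norm_sum _ _ _) _.
  apply: le_trans (_ : \sum_i (d / L) * rnorm (u i) <= _).
    apply: ler_sum => i _.
    apply: le_trans (_ : rnorm (w i - a (xi i)) * rnorm (u i) <= _).
      by rewrite ler_norml lerNl -rinNl -{1}(rnormN (w i - _)) !rin_CS.
    by rewrite ler_wpM2r ?rnorm_ge0 // rnormBC; apply/ltW/ha.
  rewrite -mulr_sumr mulrAC ler_pdivrMr // ler_wpM2l ?(ltW d0) //.
  by rewrite lerDl.
have ku : \sum_i rin (k (xi i)) (u i) = 0.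
  pose l := [seq (xi i, u i) | i <- index_enum 'I_n] ++ [seq (u i, xi i) | i <- index_enum 'I_n].
  have lE (a : H -> H) : \sum_(p <- l) inner (a p.1) p.2 =
      \sum_i (inner (a (xi i)) (u i) + inner (a (u i)) (xi i)).
    by rewrite big_cat /= !big_map big_split.
  have lsa (a : H -> H) : is_adjoint a a ->
      \sum_(p <- l) inner (a p.1) p.2 = (2 * \sum_i rin (a (xi i)) (u i))%:C.
    move=> sa; rewrite lE mulr_sumr rmorph_sum; apply: eq_bigr => i _ /=.
    rewrite (sa (u i)) (innerC (u i)) /rin; case: (inner _ _) => p q.
    by apply/eqP; rewrite eq_complex /= subrr eqxx andbT; apply/eqP; ring.
  have lA a : A a -> \sum_(p <- l) inner (a p.1) p.2 = 0.
    move=> Aa; have [b Ab' ab] := Astar _ Aa; have ba := is_adjointC ab.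
    have lin (c : R[i]) (a1 a2 : H -> H) :
        \sum_(p <- l) inner ((c *: a1 + a2) p.1) p.2 =
        c * \sum_(p <- l) inner (a1 p.1) p.2 + \sum_(p <- l) inner (a2 p.1) p.2.
      rewrite mulr_sumr -big_split; apply: eq_bigr => p _.
      by rewrite -[LHS]/(inner (c *: a1 p.1 + a2 p.1) p.2) innerDl innerZl.
    have S1 : S (1 *: a + b).
      split; first exact: Alin.
      by have := adjlin 1 _ _ _ _ ab ba; rewrite rmorph1 !scale1r addrC.
    have S2 : S ('i *: (-1 *: b + a) + 0).
      split; first by apply: (Alin) => //; exact: (Alin).
      have h0 : is_adjoint (0 : H -> H) 0 by case: S0.
      have := adjlin 'i _ _ _ _ (adjlin (-1) _ _ _ _ ba ab) h0.
      rewrite rmorphN1 conjCi; congr is_adjoint; congr (_ + _).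
      by rewrite scaleNr -scalerN; congr (_ *: _); rewrite !scaleN1r opprD opprK addrC.
    have e1 : \sum_(p <- l) inner ((1 *: a + b) p.1) p.2 = 0.
      by rewrite lsa ?(au _ S1) ?mulr0 //; case: S1.
    have e2 : \sum_(p <- l) inner (('i *: (-1 *: b + a) + 0) p.1) p.2 = 0.
      by rewrite lsa ?(au _ S2) ?mulr0 //; case: S2.
    move: e1 e2; rewrite !lin mul1r mulN1r.
    have -> : \sum_(p <- l) inner ((0 : H -> H) p.1) p.2 = 0.
      by rewrite big1 // => p _; rewrite /= linear0l.
    move: (\sum_(p <- l) _) (\sum_(p <- l) _) => P Q; rewrite addr0 => h1 /eqP.
    rewrite mulf_eq0 (negbTE (neq0Ci _)) /= addrC subr_eq0 => /eqP h2.
    by move: h1; rewrite -h2 -mulr2n => /eqP; rewrite mulrn_eq0 => /orP[//|/eqP].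
  have := wk l lA; rewrite lsa // => /(congr1 (@complex.Re R)) /= h.
  by move/eqP: h; rewrite mulf_eq0 pnatr_eq0 /= => /eqP.
have u0 : \sum_i rnorm (u i) ^+ 2 = 0.
  under eq_bigr do rewrite -rin_norm {1}/u rinBl.
  by rewrite sumrB ku wu subrr.
have ui i : k (xi i) = w i.
  apply/eqP; rewrite -subr_eq0 -/(u i); apply/eqP/rnorm_eq0/eqP.
  rewrite -sqrf_eq0; have /eqP := u0.
  by rewrite psumr_eq0 => [/allP/(_ i)|? _]; [rewrite mem_index_enum; apply|exact: sqr_ge0].
have [a [Aa sa] ha] := wS _ e0; exists a; split => // x xs.
have xn : (index x s < n)%N by rewrite index_mem.
have := ha (Ordinal xn); rewrite /j -ui /xi /= nth_index //.
Qed.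

End WeakClosure.

(** * Compact operators *)

Section Compactness.
Context {R : realType} {H : hilbertType R}.
Implicit Types (K : set H) (T : H -> H).

Lemma precompact_net K (e : R) : precompact K -> 0 < e ->
  exists s : seq H, forall y, K y -> exists2 x, x \in s & rnorm (y - x) < e.
Proof.
move=> [B KB [cB _]] e0; move: cB; rewrite compact_cover => cB.
have eC : 0 < e%:C by rewrite ltcR.
have [||D' _ hD] := cB H setT (fun x => ball x e%:C).
- by move=> x _; exact: ball_open.
- by move=> y _; exists y => //; exact: ballxx.
exists (finmap.enum_fset D') => y /KB/hD[x /= xD].
by rewrite -ball_normE /= normE ltcR rnormBC; exists x.
Qed.

Lemma precompact_of_compact K (B : set H) : K `<=` B -> compact B -> precompact K.
Proof.
move=> KB cB; apply: precompact_subset KB _.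
by apply: compact_precompact => //; exact: norm_hausdorff.
Qed.

Lemma bounded_op_continuous T : bounded_op T -> continuous T.
Proof.
move=> bT; have [M M0 hM] := bounded_opP bT; have [lT _] := bT => x.
apply/cvgrPdist_lt => e e0.
have [r re] : exists r : R, e = r%:C.
  move: e0; rewrite ltcE => /andP[/eqP h _].
  by exists (complex.Re e); case: e h => a b /= ->.
move: e0; rewrite re ltcR => r0.
have M1 : 0 < M + 1 by rewrite ltr_wpDl.
have rM : 0 < (r / (M + 1))%:C by rewrite ltcR divr_gt0.
near=> y.
have : `|x - y| < (r / (M + 1))%:C by near: y; exact: cvgr_dist_lt.
rewrite !normE !ltcR ltr_pdivlMr // -(linear_B _ _ lT) => h.
apply: le_lt_trans (hM _) _; apply: le_lt_trans h.
by rewrite mulrC ler_wpM2l ?rnorm_ge0 // lerDl.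
Unshelve. all: by end_near. Qed.

Lemma precompact_image T K : bounded_op T -> precompact K -> precompact (T @` K).
Proof.
move=> bT [B KB [cB _]]; apply: (@precompact_of_compact _ (T @` B)).
  by move=> _ [x /KB Bx <-]; exists x.
apply: continuous_compact => //; apply: continuous_subspaceT.
exact: bounded_op_continuous.
Qed.

Lemma precompact_add K K' : precompact K -> precompact K' ->
  precompact [set z | exists x y, [/\ K x, K' y & z = x + y]].
Proof.
move=> [B KB [cB _]] [B' KB' [cB' _]].
apply: (@precompact_of_compact _ ((fun p : H * H => p.1 + p.2) @` (B `*` B'))).
  by move=> _ [x [y [/KB Bx /KB' By ->]]]; exists (x, y).
apply: continuous_compact; last exact: compact_setX.
by apply: continuous_subspaceT => -[x y]; exact: add_continuous.
Qed.

Lemma compact_op_bounded T : compact_op T -> bounded_op T.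
Proof.
move=> [lT pT]; split => //.
have [s hs] := precompact_net pT ltr01.
pose M := \sum_(x <- s) rnorm x + 1.
have M0 : 0 <= M by rewrite addr_ge0 // sumr_ge0 // => x _; exact: rnorm_ge0.
have ball x : rnorm x <= 1 -> rnorm (T x) <= M.
  move=> x1; have [|y ys h] := hs (T x); first by exists x.
  have -> : T x = y + (T x - y) by abel.
  apply: le_trans (ler_rnormD _ _) _; apply: lerD (ltW h).
  rewrite (big_rem y) //= lerDl sumr_ge0 // => z _; exact: rnorm_ge0.
exists M => x; have [x0|x0] := eqVneq (rnorm x) 0.
  by rewrite (rnorm_eq0 x0) (linear_0 lT) !rnorm0 mulr0.
have xp : 0 < rnorm x by rewrite lt0r x0 rnorm_ge0.
have inv : rnorm ((rnorm x)^-1%:C : R[i]) = (rnorm x)^-1.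
  by rewrite rnorm_real ger0_norm // invr_ge0 ltW.
rewrite -ler_pdivrMr // mulrC -inv -rnormZ -(linear_Z _ _ lT).
by apply: ball; rewrite rnormZ inv mulVf.
Qed.

Lemma compact_op_comp S T : bounded_op S -> compact_op T -> compact_op (S \o T).
Proof.
move=> bS [lT pT]; split.
  by have [lS _] := bS; move=> k x y; rewrite /= lT lS.
by rewrite -image_comp; exact: precompact_image.
Qed.

Lemma compact_op_lin (k : R[i]) S T : compact_op S -> compact_op T ->
  compact_op (k *: S + T).
Proof.
move=> [lS pS] [lT pT]; split.
  move=> c x y; rewrite -[LHS]/(k *: S (c *: x + y) + T (c *: x + y)) lS lT.
  rewrite -[RHS]/(c *: (k *: S x + T x) + (k *: S y + T y)).
  rewrite !scalerDr !scalerA (mulrC k); abel.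
have bk : bounded_op ( *:%R k : H -> H).
  split; first by move=> c x y; rewrite scalerDr !scalerA mulrC.
  by exists (rnorm k) => x; rewrite rnormZ.
apply: precompact_subset (precompact_add (precompact_image bk pS) pT).
move=> _ [x x1 <-]; exists (k *: S x), (T x); split => //.
by exists (S x).
Qed.

(** The image of the unit ball lies in the sum of two compact real segments. *)
Lemma compact_op_rank_one (v : H) : compact_op (fun x => inner x v *: v).
Proof.
split; first by move=> k x y; rewrite innerDl innerZl scalerDl scalerA.
have seg (u : H) (r : R) : precompact [set (t%:C : R[i]) *: u | t in `[- r, r]%classic].
  apply: (@precompact_of_compact _ [set (t%:C : R[i]) *: u | t in `[- r, r]%classic]) => //.
  apply: continuous_compact; last exact: segment_compact.
  apply: continuous_subspaceT => t.
  apply/cvgrPdist_lt => e e0.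
  have [d de] : exists d : R, e = d%:C.
    move: e0; rewrite ltcE => /andP[/eqP h _].
    by exists (complex.Re e); case: e h => a b /= ->.
  move: e0; rewrite de ltcR => d0.
  have u1 : 0 < rnorm u + 1 by rewrite ltr_wpDl ?rnorm_ge0.
  have du : 0 < d / (rnorm u + 1) by rewrite divr_gt0.
  near=> t'.
  have : `|t - t'| < d / (rnorm u + 1) by near: t'; exact: cvgr_dist_lt.
  rewrite normE ltcR ltr_pdivlMr // -scalerBl -rmorphB rnormZ rnorm_real => h.
  apply: le_lt_trans h; rewrite ler_wpM2l // lerDl //.
apply: precompact_subset (precompact_add (seg v (rnorm v)) (seg ('i *: v) (rnorm v))).
move=> _ [x /= x1 <-].
have hC : rnorm (inner x v) <= rnorm v.
  by apply: le_trans (inner_CS _ _) _; rewrite -[leRHS]mul1r ler_wpM2r ?rnorm_ge0.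
have Rb (z : R[i]) : rnorm z <= rnorm v -> complex.Re z \in `[- rnorm v, rnorm v].
  move=> hz; rewrite in_itv /= lerNl; apply/andP; split; last first.
    exact: le_trans (Re_le_rnorm _) hz.
  have -> : - complex.Re z = complex.Re (- z) by case: z {hz}.
  by apply: le_trans (Re_le_rnorm _) _; rewrite rnormN.
have zE : inner x v = (complex.Re (inner x v))%:C + 'i * (complex.Re (- 'i * inner x v))%:C.
  case: (inner x v) => a b; rewrite -complexiE; apply/eqP; rewrite eq_complex /=.
  by apply/andP; split; apply/eqP; ring.
exists ((complex.Re (inner x v))%:C *: v), ((complex.Re (- 'i * inner x v))%:C *: ('i *: v)).
split.
- by exists (complex.Re (inner x v)) => //=; exact: Rb.
- exists (complex.Re (- 'i * inner x v)) => //=; apply: Rb.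
  by rewrite rnormM rnormN [rnorm 'i]/rnorm normCi mul1r.
- by rewrite {1}zE scalerDl !scalerA (mulrC 'i).
Unshelve. all: by end_near. Qed.

End Compactness.

(** * Bicommutants and weak closure *)

Section Main.
Context {R : realType} {H : hilbertType R} {C : cstarType R}.
Variables (A : set (H -> H)) (pi phi : (H -> H) -> C).
Hypotheses (cA : cstar_subalgebra A) (hpi : star_morphism A pi).

(** The image of a bounded transform is a contraction because
    [2 g + i (1 - 2 a g)] is unitary: up to the factor [i], it is a Cayley
    transform of [a]. *)
Lemma morphism_transform_contract a g : A a -> is_adjoint a a -> A g ->
  bounded_transform a g -> rnorm (pi g) <= 1.
Proof.
move=> Aa sa Ag [lg sg ga gE]; have [plin pM pS] := hpi.
have [[_ _ AM _] _] := cA.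
pose z := pi a; pose y := pi g.
have sz : cstar z = z by rewrite -(pS _ _ Aa Aa sa).
have sy : cstar y = y by rewrite -(pS _ _ Ag Ag sg).
have zy : z ** y = y ** z.
  by rewrite -(pM _ _ Aa Ag) -(pM _ _ Ag Aa); congr pi; apply/funext => x /=; rewrite ga.
have yE : y + z ** (z ** y) = z.
  have Aag := AM _ _ Aa Ag.
  rewrite -(pM _ _ Aa Ag) -(pM _ _ Aa Aag).
  have := plin 1 _ _ Ag (AM _ _ Aa Aag); rewrite !scale1r => <-.
  by congr pi; apply/funext => x; rewrite -[LHS]/(g x + a (a (g x))) gE.
pose Z : mult C unit := lmul z; pose Y : mult C unit := lmul y.
have ZY : Z * Y = Y * Z by rewrite /Z /Y -!lmulM zy.
have ZZY : Z * (Z * Y) = Z - Y.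
  by rewrite /Z /Y -!lmulM -lmulB; congr lmul; rewrite -[X in _ = X - _]yE; abel.
have dZ : dag Z = Z by rewrite dag_lmul sz.
have dY : dag Y = Y by rewrite dag_lmul sy.
have h x : rnorm (y ** x + y ** x) <= rnorm x.
  have := @cn_contract _ _ _ _ (Y + Y) (1 - (Z * Y + Z * Y)) tt x
    (rnorm_is_cstar_norm (C := C)); rewrite mfunD mfun_lmul; apply.
  - by rewrite dagD dY.
  - by rewrite dagD dagN dag1 dagD dagM dZ dY -ZY.
  - have YZY : Y * (Z * Y) = Z * Y * Y by rewrite mulrA -ZY.
    clearbody Z Y.
    by rewrite mulrBr mulrBl mulr1 mul1r !mulrDl !mulrDr YZY.
  have ZYZY : Z * Y * (Z * Y) = Z * Y - Y * Y.
    by rewrite {1}ZY -mulrA ZZY mulrBr -ZY.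
  clearbody Z Y.
  have sq (U : mult C unit) : (1 - U) * (1 - U) = 1 - U - (U - U * U).
    by rewrite mulrBl !mulrBr !mul1r mulr1.
  by rewrite sq !mulrDl !mulrDr ZYZY; abel.
have := h (cstar y); rewrite -mulr2n -scaler_nat rnormZ rnorm_nat.
rewrite (cn_star (rnorm_is_cstar_norm (C := C))) -{1}(cstarK y) rnorm_star_sqr.
rewrite (cn_star (rnorm_is_cstar_norm (C := C))) -/y.
by have := rnorm_ge0 y; nra.
Qed.

Hypotheses (Cinj : injective_cstar C)
  (philin : linear_on compact_op phi) (phibd : bounded_on compact_op phi)
  (phimod : forall a x, A a -> compact_op x -> phi (a \o x) = pi a ** phi x)
  (phiker : forall J : set (H -> H), compact_right_ideal J ->
     (forall x, J x -> phi x = 0) -> J = [set 0])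
  (bicomm : commutant (commutant (pi @` A)) = pi @` A).

Let phiB x y : compact_op x -> compact_op y -> phi (x - y) = phi x - phi y.
Proof.
move=> cx cy; have := philin (-1) cy cx.
by rewrite !scaleN1r ![- _ + _]addrC.
Qed.

(** The operators [d x] with [x] compact form a right ideal, and those with [x]
    of rank one detect [d]. *)
Lemma right_ideal_detects d : bounded_op d ->
  (forall x, compact_op x -> phi (d \o x) = 0) -> forall v, d v = 0.
Proof.
move=> bd hd v; have [ld _] := bd.
pose J := [set y : H -> H | exists2 x, compact_op x & y = d \o x].
have c0 : compact_op (0 : H -> H).
  have -> : (0 : H -> H) = (fun x => inner x 0 *: (0 : H)).
    by apply/funext => x; rewrite scaler0.
  exact: compact_op_rank_one.
have JJ : compact_right_ideal J.
  split.
  - by move=> _ [x cx ->]; exact: compact_op_comp.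
  - split; first by exists 0 => //; apply/funext => x; rewrite /= (linear_0 ld).
    move=> k _ _ [x cx ->] [y cy ->]; exists (k *: x + y); first exact: compact_op_lin.
    by apply/funext => z; rewrite /= -[(k *: x + y) z]/(k *: x z + y z) ld.
  - move=> _ T [x cx ->] cT; exists (x \o T) => //.
    by apply: compact_op_comp => //; exact: compact_op_bounded.
have J0 : J = [set 0] by apply: phiker => // _ [x cx ->]; exact: hd.
have [v0|v0] := eqVneq v 0; first by rewrite v0 (linear_0 ld).
have : J (d \o (fun x => inner x v *: v)).
  by exists (fun x => inner x v *: v) => //; exact: compact_op_rank_one.
rewrite J0 => /(congr1 (fun f => f v)); rewrite /= (linear_Z _ _ ld) => /eqP.
rewrite scaler_eq0 => /orP[|/eqP//]; rewrite -inner_norm expf_eq0 /= normr_eq0.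
by rewrite (negbTE v0).
Qed.

(** The double commutant of [pi A] contains [c], so [c = pi a] with [a] in [A],
    and [phi] kills the right ideal generated by [a - b]. *)
Lemma bicommutant_mem c b : bounded_op b -> commutant (commutant (pi @` A)) c ->
  (forall x, compact_op x -> c ** phi x = phi (b \o x)) -> A b.
Proof.
move=> bb; rewrite bicomm => -[a Aa <-] h.
suff -> : b = a by [].
have [[Ab _ _ _] _] := cA; have ba := Ab _ Aa.
apply/funext => v; apply/eqP; rewrite eq_sym -subr_eq0; apply/eqP.
have bB : bounded_op (a - b).
  have [la _] := ba; have [lb _] := bb; split.
    move=> k x y; rewrite -[LHS]/(a (k *: x + y) - b (k *: x + y)) la lb.
    rewrite -[RHS]/(k *: (a x - b x) + (a y - b y)) scalerBr; abel.
  have [M M0 hM] := bounded_opP ba; have [N N0 hN] := bounded_opP bb.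
  exists (M + N) => x; apply: le_trans (ler_rnormB _ _) _.
  by rewrite mulrDl lerD.
apply: (right_ideal_detects bB) => x cx.
have -> : (a - b) \o x = (a \o x) - (b \o x) by [].
have cax := compact_op_comp ba cx; have cbx := compact_op_comp bb cx.
by rewrite (phiB cax cbx) (phimod Aa cx) (h x cx) subrr.
Qed.

Lemma unit_mem : A idfun.
Proof.
have [e he] := injective_unital Cinj.
apply: (@bicommutant_mem e).
- by split => //; exists 1 => x; rewrite mul1r.
- by move=> d _; have [-> ->] := he d.
- by move=> x cx; have [-> _] := he (phi x).
Qed.

(** A finite net of the image of the unit ball under [x] reduces the norm
    distance of [g x] and [b x] to finitely many vectors. *)
Lemma opnorm_compact_close (e : R) x : 0 < e -> compact_op x ->
  exists s : seq H, forall g b, bounded_op g -> bounded_op b ->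
    (forall v, rnorm (g v) <= rnorm v) -> (forall v, rnorm (b v) <= rnorm v) ->
    (forall v, v \in s -> rnorm (g v - b v) < e) ->
    opnorm ((g \o x) - (b \o x)) <= 3 * e.
Proof.
move=> e0 [lx px]; have [s hs] := precompact_net px e0.
exists s => g b [lg _] [lb _] g1 b1 gb; apply: ge_sup.
  by exists (rnorm (((g \o x) - (b \o x)) 0)), 0; rewrite //= rnorm0.
move=> _ [v /= v1 <-]; rewrite -[((g \o x) - (b \o x)) v]/(g (x v) - b (x v)).
have [|w ws h] := hs (x v); first by exists v.
have -> : g (x v) - b (x v) = (g w - b w) + (g (x v - w) - b (x v - w)).
  by rewrite (linear_B _ _ lg) (linear_B _ _ lb); abel.
apply: le_trans (ler_rnormD _ _) _.
have h1 := gb _ ws; have h2 := ler_rnormB (g (x v - w)) (b (x v - w)).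
have h3 := g1 (x v - w); have h4 := b1 (x v - w); lra.
Qed.

(** Kaplansky's density argument supplies a bounded family [g] in [A] that
    converges strongly to [b]; the generalized limit of [pi g] then acts on
    the range of [phi] as [b] does. *)
Lemma transform_mem k b : is_adjoint k k -> bounded_op k -> weakly_adherent A k ->
  bounded_transform k b -> bounded_op b -> A b.
Proof.
move=> sk bk wk btb bb; have [lk _] := bk; have [sA _] := cA.
have [Abd _ _ _] := sA.
pose G := [set g | A g /\ exists a, [/\ A a, is_adjoint a a & bounded_transform a g]].
have Gbd g : G g -> bounded_op g by move=> [Ag _]; exact: Abd.
have G1 g v : G g -> rnorm (g v) <= rnorm v.
  move=> [_ [a [Aa sa btg]]]; have [la _] := Abd _ Aa.
  by have [] := bounded_transform_contract v la sa btg.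
have b1 v : rnorm (b v) <= rnorm v.
  by have [] := bounded_transform_contract v lk sk btb.
pose near_b (l : seq H) (e : R) := [set g | G g /\ forall v, v \in l -> rnorm (g v - b v) < e].
have near_ex l e : 0 < e -> near_b l e !=set0.
  move=> e0; have e2 : 0 < e / 2 by rewrite divr_gt0.
  have [a [Aa sa ha]] :=
    strong_approx ([seq v - k (b v) | v <- l] ++ [seq b v | v <- l]) sA sk wk e2.
  have [M M0 hM] := bounded_opP (Abd _ Aa); have [la _] := Abd _ Aa.
  have [g [btg bg Ag]] := bounded_transform_exists la sa M0 hM.
  exists g; split.
    by split; [exact: Ag|exists a].
  move=> v vl; apply: le_lt_trans (bounded_transform_dist v la sa btg lk sk btb) _.
  have h1 := ha (v - k (b v)); have h2 := ha (b v).
  rewrite [e](_ : _ = e / 2 + e / 2); last by field.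
  apply: ltrD.
    by apply: h1; rewrite mem_cat; apply/orP; left; exact: (map_f (fun v => v - k (b v))).
  by apply: h2; rewrite mem_cat; apply/orP; right; exact: map_f.
(* The trace on [G] of the strong neighbourhoods of [b]; it is proper because
   [b] is a strong limit of elements of [G]. *)
pose F : set_system (H -> H) :=
  [set P | exists l e, 0 < e /\ near_b l e `<=` P].
have FF : ProperFilter F.
  split.
    by move=> [l [e [e0 h]]]; have [g /h] := near_ex l e e0.
  split.
  - by exists [::], 1; split.
  - move=> P Q [l [e [e0 hP]]] [l' [e' [e'0 hQ]]].
    exists (l ++ l'), (Num.min e e'); split; first by rewrite lt_min e0.
    move=> g [Gg hg]; split.
      apply: hP; split => // v vl; have := hg v.
      by rewrite mem_cat vl => /(_ isT); rewrite lt_min => /andP[].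
    apply: hQ; split => // v vl; have := hg v.
    by rewrite mem_cat vl orbT => /(_ isT); rewrite lt_min => /andP[].
  - by move=> P Q PQ [l [e [e0 h]]]; exists l, e; split => // g /h/PQ.
pose s g := if `[< G g >] then pi g else 0.
have sG g : G g -> s g = pi g by move=> Gg; rewrite /s asboolT.
have sbd : exists M : R, forall g, rnorm (s g) <= M.
  exists 1 => g; rewrite /s; case: asboolP => [[Ag [a [Aa sa btg]]]|_].
    exact: morphism_transform_contract btg.
  by rewrite rnorm0.
have [c [ccomm clim]] := injective_generalized_limit FF Cinj sbd.
apply: (@bicommutant_mem c) => //.
  move=> d hd; apply: ccomm => g; rewrite /s; case: asboolP => [[Ag _]|_].
    by rewrite hd //; exists g.
  by rewrite cmul0l cmul0r.
move=> x cx; apply: clim => e e0.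
have [M hM] := phibd.
pose K := 3 * (`|M| + 1).
have K0 : 0 < K by rewrite mulr_gt0 // ltr_wpDl.
have eK : 0 < e / K by rewrite divr_gt0.
have [l hl] := opnorm_compact_close eK cx.
exists l, (e / K); split => // g [Gg hg] /=; rewrite sG //.
have [Ag _] := Gg.
have cgx : compact_op (g \o x) by apply: compact_op_comp => //; exact: Gbd.
have cbx : compact_op (b \o x) by exact: compact_op_comp.
rewrite -phimod // -phiB //.
have op0 := hl g b (Gbd g Gg) bb (fun v => G1 g v Gg) b1 hg.
have cB : compact_op ((g \o x) - (b \o x)).
  by have := compact_op_lin (-1) cbx cgx; rewrite scaleN1r addrC.
apply: le_trans (hM _ cB) _.
have n0 := opnorm_ge0 (compact_op_bounded cB).
have M1 : 0 <= `|M| + 1 by rewrite addr_ge0.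
apply: le_trans (_ : (`|M| + 1) * opnorm ((g \o x) - (b \o x)) <= _).
  by rewrite ler_wpM2r // (le_trans (ler_norm M)) // lerDl.
apply: le_trans (ler_wpM2l M1 op0) _.
rewrite [leLHS](_ : _ = e) // /K; field.
by rewrite gt_eqF // ltr_wpDl.
Qed.

(** Norm closedness removes the bounded transform: as [t] tends to [0], the
    transform of [t k], divided by [t], tends to [k] in norm. *)
Lemma adherent_mem k : is_adjoint k k -> bounded_op k -> weakly_adherent A k -> A k.
Proof.
move=> sk bk wk; have [_ Acl] := cA; apply: Acl => // e e0.
have [M M0 hM] := bounded_opP bk; have [lk _] := bk.
have [[_ [A0 Alin] _ _] _] := cA.
pose N := M ^+ 2 + 1; have N0 : 0 < N by rewrite ltr_wpDl ?sqr_ge0.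
pose t := e / N; have t0 : 0 < t by rewrite divr_gt0.
have tE : rnorm (t%:C : R[i]) = t by rewrite rnorm_real gtr0_norm.
have conjR (r : R) : (r%:C : R[i])^* = r%:C by rewrite (CrealP _) // complex_real.
pose a : H -> H := t%:C *: k.
have aE x : a x = t%:C *: k x by [].
have la : linear a.
  by move=> c x y; rewrite !aE lk scalerDr !scalerA mulrC.
have sa : is_adjoint a a.
  by move=> x y; rewrite !aE innerZl innerZr conjR sk.
have aM x : rnorm (a x) <= t * M * rnorm x.
  by rewrite aE rnormZ tE -mulrA ler_wpM2l // ltW.
have tM : 0 <= t * M by rewrite mulr_ge0 // ltW.
have ba : bounded_op a by split => //; exists (t * M).
have wz : weakly_adherent A (0 : H -> H) by move=> l h; exact: h.
have wa : weakly_adherent A a.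
  by have := weakly_adherent_lin t%:C wk wz; rewrite addr0.
have [g [btg bg _]] := bounded_transform_exists la sa tM aM.
have Ag : A g by exact: transform_mem btg bg.
have [_ _ ga gE] := btg.
exists ((t^-1)%:C *: g + 0); first exact: Alin.
have d x : (k - ((t^-1)%:C *: g + 0)) x = t%:C *: k (k (g x)).
  rewrite addr0 -[LHS]/(k x - (t^-1)%:C *: g x).
  have -> : k x = (t^-1)%:C *: a x.
    by rewrite aE scalerA -rmorphM /= mulVf ?gt_eqF // scale1r.
  rewrite -gE scalerDr [LHS]addrC addKr !aE !(linear_Z _ _ lk) scalerA.
  by rewrite -rmorphM /= mulVf ?gt_eqF // scale1r.
apply: le_lt_trans (opnorm_le (M := t * M ^+ 2) _ _) _.
- by rewrite mulr_ge0 ?sqr_ge0 // ltW.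
- move=> x; rewrite d rnormZ tE -(mulrA t) ler_wpM2l ?(ltW t0) //.
  apply: le_trans (hM _) _; rewrite expr2 -mulrA ler_wpM2l //.
  apply: le_trans (hM _) _; rewrite ler_wpM2l //.
  by have [] := bounded_transform_contract x la sa btg.
- by rewrite /t mulrAC ltr_pdivrMr // ltr_pM2l // ltrDl.
Qed.

Lemma injective_bicommutant_von_neumann : von_neumann A.
Proof.
have [sA _] := cA; split=> //; first exact: unit_mem.
move=> T [clT bT].
have wT := wot_closure_adherent clT.
have [S bS TS] := adjoint_exists bT; have ST := is_adjointC TS.
have wS := weakly_adherent_adj sA TS wT.
have [[_ [A0 Alin] _ _] _] := cA.
have [lT _] := bT; have [lS _] := bS.
have [M M0 hM] := bounded_opP bT; have [N N0 hN] := bounded_opP bS.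
have A1 : A (1 *: S + T).
  apply: adherent_mem; last exact: weakly_adherent_lin.
    move=> x y; rewrite scale1r -[(S + T) x]/(S x + T x) -[(S + T) y]/(S y + T y).
    by rewrite innerDl innerDr TS ST addrC.
  rewrite scale1r; split.
    move=> k x y; rewrite -[LHS]/(S (k *: x + y) + T (k *: x + y)) lS lT.
    rewrite -[RHS]/(k *: (S x + T x) + (S y + T y)) scalerDr; abel.
  exists (N + M) => x; apply: le_trans (ler_rnormD _ _) _.
  by rewrite mulrDl lerD.
have A2 : A ('i *: ((-1) *: S + T) + 0).
  apply: adherent_mem.
  - move=> x y; rewrite addr0.
    rewrite -[('i *: _) x]/('i *: (-1 *: S x + T x)) -[('i *: _) y]/('i *: (-1 *: S y + T y)).
    rewrite innerZl innerZr conjCi !scaleN1r innerDl innerDr linearNl linearNr /= TS ST.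
    by ring.
  - rewrite addr0 scaleN1r; split.
      move=> k x y; rewrite -[LHS]/('i *: (- S (k *: x + y) + T (k *: x + y))) lS lT.
      rewrite -[RHS]/(k *: ('i *: (- S x + T x)) + 'i *: (- S y + T y)).
      rewrite !scalerA (mulrC k) -scalerA -scalerDr; congr (_ *: _).
      rewrite scalerDr scalerN; abel.
    exists (N + M) => x; rewrite -[('i *: _) x]/('i *: (- S x + T x)) rnormZ.
    rewrite [rnorm 'i]/rnorm normCi mul1r; apply: le_trans (ler_rnormD _ _) _.
    by rewrite mulrDl rnormN lerD.
  - have wz : weakly_adherent A (0 : H -> H) by move=> l h; exact: h.
    apply: weakly_adherent_lin => //; exact: weakly_adherent_lin.
have -> : T = 2^-1 *: (- 'i *: ('i *: ((-1) *: S + T) + 0) + (1 *: S + T)) + 0.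
  apply/funext => x; rewrite !addr0 scale1r.
  rewrite -[RHS]/(2^-1 *: (- 'i *: ('i *: (-1 *: S x + T x)) + (S x + T x))).
  rewrite scalerA mulNr -expr2 sqrCi opprK scale1r scaleN1r.
  have -> : - S x + T x + (S x + T x) = 2%:R *: T x by rewrite scaler_nat mulr2n; abel.
  by rewrite scalerA mulVf ?pnatr_eq0 // scale1r.
by apply: (Alin) => //; exact: (Alin).
Qed.

End Main.

Theorem theorem6p1 (R : realType) (H : hilbertType R) (C : cstarType R)
  (A : set (H -> H)) (pi phi : (H -> H) -> C) :
  cstar_subalgebra A ->
  star_morphism A pi ->
  injective_cstar C ->
  linear_on compact_op phi ->
  bounded_on compact_op phi ->
  (forall a x, A a -> compact_op x -> phi (a \o x) = cmul (pi a) (phi x)) ->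
  (forall J : set (H -> H), compact_right_ideal J ->
     (forall x, J x -> phi x = 0) -> J = [set 0]) ->
  commutant (commutant (pi @` A)) = pi @` A ->
  von_neumann A.
Proof.
by move=> cA hpi Cinj plin pbd pmod pker bic; exact: injective_bicommutant_von_neumann plin pbd pmod pker bic.
Qed.
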